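(* Let $F$ be a non-Archimedean local field and $E=F\times E'$ with $E'/F$ an unramified quadratic field extension. Let $R$ be an order of $E$ with conductor $(\pi^{f_1})\times(\pi^{f_2})\subset\mathfrak o\times\mathcal O_{E'}=\mathcal O_E$, and write $S=S(R)$. Then, with all summation indices $a',b'$ ranging over integers, $$\begin{aligned} \#\overline{\mathrm{Cl}}(R)={}&2\sum_{0\le b'\le S-f_1}\Biggl(\ \sum_{\substack{0\le a'\le f_1\\ a'\le 2b'\\ a'\le S-f_2}}q^{\min(\lfloor a'/2\rfloor,\,S-f_1-b')}+\sum_{\substack{S-f_2<a'\le f_1\\ a'\le 2b'\\ \lceil a'/2\rceil-b'\le f_1-f_2}}q^{S-f_1-b'}\Biggr)-(S-f_1+1)\\ &-\sum_{\substack{0<a'\le f_1\\ a'\le S-f_2\\ 2\mid a'}}q^{\min\left(\frac{a'}2,\,S-f_1-\frac{a'}2\right)}-\sum_{\substack{S-f_2<a'\le f_1\\ 2\mid a'\\ S-f_1\le S-f_2}}q^{S-f_1-\frac{a'}2}\\ &-\sum_{0<b'\le S-f_1}\ \sum_{\substack{0<a'\le f_1\\ a'<2b',\ 2\mid a'\\ a'\le S-f_2\\ \frac{a'}2\le S-f_1-b'}}\left(q^{\frac{a'}2}-q^{\frac{a'}2-1}\right)-\sum_{\substack{S-f_2<a'\le f_1\\ 2\mid a'\\ S-f_2<S-f_1}}q^{S-f_2-\frac{a'}2}. \end{aligned}$$ (A condition not involving the summation index means that the sum is empty unless the condition holds.)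
   Context: $F$ has any characteristic, ring of integers $\mathfrak o$, uniformizer $\pi$, residue field of cardinality $q$; $\mathcal O_{E'}$ is the ring of integers of $E'$. The maximal order of $E$ is $\mathcal O_E=\mathfrak o\times\mathcal O_{E'}$. An order of $E$ is a subring $\mathcal O\subset E$ containing $\mathfrak o$ (embedded diagonally), finitely generated as an $\mathfrak o$-module, with $F\mathcal O=E$. The conductor of $R$ is $\{a\in\mathcal O_E: a\mathcal O_E\subset R\}$, and $S(R)$ is the length of $\mathcal O_E/R$ as an $\mathfrak o$-module. A fractional $R$-ideal is a finitely generated $R$-submodule $I\subset E$ with $FI=E$; $\overline{\mathrm{Cl}}(R)$ is the set (monoid) of fractional $R$-ideals modulo multiplication by $E^\times$. *)

(* Defs.v *)
From HB Require Import structures.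
From mathcomp Require Import all_boot all_order all_algebra all_field.
From mathcomp Require Import all_classical.

Set Implicit Arguments.
Unset Strict Implicit.
Unset Printing Implicit Defensive.

Import Order.TTheory GRing.Theory Num.Theory.
Local Open Scope classical_set_scope.
Local Open Scope ring_scope.

(* Normalized discrete valuation. The value at 0 is junk: it stands for +oo,
   and every use below treats 0 separately. *)
Record discrete_valuation (K : fieldType) := DiscreteValuation {
  dval :> K -> int;
  dvalM : forall x y, x != 0 -> y != 0 -> dval (x * y) = dval x + dval y;
  dvalD : forall x y, x != 0 -> y != 0 -> x + y != 0 ->
    Num.min (dval x) (dval y) <= dval (x + y);
  dval_normalized : exists2 x, x != 0 & dval x = 1
}.

Section LocalField.
Variables (F : fieldType) (v : discrete_valuation F).

Definition val_ge (n : int) : set F := [set x | x = 0 \/ n <= v x].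

Definition int_ring : set F := val_ge 0.
Definition max_ideal : set F := val_ge 1.

Definition uniformizer (p : F) : Prop := p != 0 /\ v p = 1.

Definition residue_field : set (set F) :=
  [set [set x + m | m in max_ideal] | x in int_ring].

Definition val_cauchy (u : nat -> F) : Prop :=
  forall N : int, exists n0 : nat, forall m n : nat,
    (n0 <= m)%N -> (n0 <= n)%N -> val_ge N (u m - u n).

Definition val_cvg (u : nat -> F) (l : F) : Prop :=
  forall N : int, exists n0 : nat, forall n : nat,
    (n0 <= n)%N -> val_ge N (u n - l).

Definition nonarch_local_field : Prop :=
  (forall u, val_cauchy u -> exists l, val_cvg u l) /\
  finite_set residue_field.

End LocalField.

Section Extension.
Variables (F : fieldType) (v : discrete_valuation F) (E' : fieldExtType F).

Definition int_poly : set {poly F} := [set p | forall i, int_ring v p`_i].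

Definition int_closure : set E' :=
  [set x | exists2 p : {poly F}, p \is monic /\ int_poly p &
             root (map_poly (in_alg E') p) x].

(* The nonunits of the local ring int_closure. *)
Definition ext_max_ideal : set E' :=
  [set x | int_closure x /\ (x = 0 \/ ~ int_closure x^-1)].

(* e(E'/F) = 1: the maximal ideal of F extends to that of E'. *)
Definition ramification_index1 : Prop :=
  forall p, uniformizer v p ->
    ext_max_ideal = [set p%:A * y | y in int_closure].

(* The residue extension is separable: every residue class of E' is a
   simple root of a polynomial over the residue field of F, given by a lift. *)
Definition residue_separable : Prop :=
  forall x, int_closure x -> exists2 p : {poly F}, int_poly p &
    ext_max_ideal (map_poly (in_alg E') p).[x] /\
    ~ ext_max_ideal (map_poly (in_alg E') p^`()).[x].

Definition unramified : Prop := ramification_index1 /\ residue_separable.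

End Extension.
Arguments int_closure {F} v E'.
Arguments ext_max_ideal {F} v E'.

(* Submodules of a commutative ring K over a subset A of K acting by
   multiplication. *)
Section Modules.
Variable K : comPzRingType.
Implicit Types A X M N : set K.

Definition lin_span A X : set K :=
  [set x | exists n (a y : 'I_n -> K),
     [/\ forall i, A (a i), forall i, X (y i) & x = \sum_i a i * y i]].

Definition fin_gen A M : Prop := exists s : seq K, M = lin_span A [set` s].

Definition is_submodule A M : Prop :=
  [/\ M 0, forall x y, M x -> M y -> M (x + y)
    & forall a x, A a -> M x -> M (a * x)].

(* Submodules of M / N are encoded by the submodules between N and M. *)
Definition quot_chain A M N (n : nat) : Prop :=
  exists c : nat -> set K,
    [/\ c 0%N = N, c n = M,
        forall i, (i <= n)%N -> is_submodule A (c i)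
      & forall i, (i < n)%N -> c i `<` c i.+1].

Definition quot_length A M N (n : nat) : Prop :=
  quot_chain A M N n /\ forall m, quot_chain A M N m -> (m <= n)%N.

End Modules.

Section Orders.
Variables (F : fieldType) (v : discrete_valuation F) (E' : fieldExtType F).
Local Notation E := (F * E')%type.

Definition diag (a : F) : E := (a, a%:A).

Definition diag_int : set E := diag @` int_ring v.
Definition diag_field : set E := range diag.

Definition max_order : set E := int_ring v `*` int_closure v E'.

Definition is_order (R : set E) : Prop :=
  [/\ subring_closed [in R], diag_int `<=` R, fin_gen diag_int R
    & lin_span diag_field R = setT].

Definition conductor (R : set E) : set E :=
  [set a | max_order a /\ forall x, max_order x -> R (a * x)].

Definition order_length (R : set E) (n : nat) : Prop :=
  quot_length diag_int max_order R n.

Definition frac_ideal (R : set E) : set (set E) :=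
  [set I | fin_gen R I /\ lin_span diag_field I = setT].

Definition ideal_class (I : set E) : set (set E) :=
  [set [set u * x | x in I] | u in [set u : E | u \is a GRing.unit]].

Definition ideal_class_monoid (R : set E) : set (set (set E)) :=
  [set ideal_class I | I in frac_ideal R].

End Orders.

(* Main.v *)
Require Import Defs.
From HB Require Import structures.
From mathcomp Require Import all_boot all_order all_algebra all_field.
From mathcomp Require Import all_classical.

From mathcomp Require Import ring lra zify finmap.

(* Write [O] for the integers of [E'], [O_j = o + pi ^ j O], and call level of a
   unit [u] of [O] the largest [c] with [u] in [O_c]. An order is
   [R = {(x, x + l) | x in o, l in pi ^ d w O_n}] with [w] a unit of [O]; if [w]
   has level [k <= n], then [f2 = d + n], [f1 = d + n - k] and [S = 2 d + n].

   Projecting a fractional ideal to [F] puts it, up to units of [E], in the form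
   [{(x, x s + l) | x in o, l in O_m}], and its class is determined by [m] and
   the cyclic module [M = O_m + O_m s], because two generators of a cyclic module
   over a local ring differ by a unit. Lattices of [E'] are principal over their
   multiplier ring: [M = (pi ^ i u)^-1 O_j] with [j <= m] and [u] a unit modulo
   those of [O_j]. For fixed [j] and [u], the pairs [(m, i)] that occur are
   [2 T + 1] in number if [T >= 0] and none otherwise, where
   [T = d + level u + level (u / w) - 2 j].

   The classes of [u], for all [j], are the vertices of the [q + 1]-regular tree,
   and the levels of [u] and [u / w] are the lengths of the initial segments that
   the path from the root to [u] shares with the paths of [1] and of [w]. Hence
   [2 T + 1] is summed along these two rays, with the self-similar sums
   [G T = (2 T + 1) + q G (T - 2)] over the subtrees that leave them:
   [(k + 1) (G d - G (d - 2)) + 2 G (d - 1) + 2 G (d - 2) - G (d - (n - k) - 1)].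
   The sums of the theorem, evaluated over [b'] first, have the same value, by
   induction on [S - f2 = d] and on [f1 + f2 - S = n - k]. *)

Set Implicit Arguments.
Unset Strict Implicit.
Unset Printing Implicit Defensive.

Import Order.TTheory GRing.Theory Num.Theory.
Local Open Scope classical_set_scope.
Local Open Scope ring_scope.

(** * Tree sums and the evaluation of the formula *)

Section BranchWeight.

(** The count [2 T + 1] has two sources. The module [M] contains [1], which bounds [i] below by
    [j - level u] (levels being cut off at [j]), and stability under [R] says
    [m + i <= d + level (u / w)]. If [m = j], then [M] is principal over [O_m] and all [T + 1]
    integers [i] in this range occur. If [m > j], then [M] needs two generators over [O_m], and [1]
    can be one of them only if it lies outside [pi M]; this forces [i = j - level u] and leaves [T]
    values of [m]. The two rays are not alike. The path of [1] is infinite, but [w] matters only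
    modulo the units of [O_n], so its path stops at depth [n]; hence the subtracted
    [G (d - (n - k) - 1)]. On the [k + 1] common vertices the growth of both levels compensates
    [2 j], so [T] keeps the value [d]. The integers of [E'] are given as an integral closure,
    without a valuation. Ramification index 1 makes [pi] a uniformizer of them; completeness and
    degree 2 provide an integer [t] incongruent to all of [o], and [1, t] is then an [o]-basis of
    [O]. Everything later is done in these coordinates, uniformly in the characteristic. *)

Definition odd_count (T : int) : nat := if 0 <= T then (2 * `|T|).+1 else 0%N.

Variable Q : rat.

Fixpoint branch_nat (n : nat) : rat :=
  match n with
  | 0 => 1
  | 1 => 3
  | n'.+2 => (2 * n + 1)%:R + Q * branch_nat n'
  end.

(* The total of [odd_count] over a [Q]-ary tree whose root carries [T] and
   along which [T] decreases by 2 at each step. *)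
Definition branch (T : int) : rat :=
  if T is Posz n then branch_nat n else 0.

Arguments branch : simpl never.

Lemma branch_neg T : T < 0 -> branch T = 0.
Proof. by case: T. Qed.

Lemma odd_count_neg T : T < 0 -> odd_count T = 0%N.
Proof. by rewrite /odd_count leNgt => ->. Qed.

Lemma odd_count_nat (n : nat) : odd_count n = (2 * n).+1.
Proof. by []. Qed.

Lemma branchE T : branch T = (odd_count T)%:R + Q * branch (T - 2).
Proof.
case: T => [[|[|n]]|n].
- by rewrite [branch (_ - _)]branch_neg // mulr0 addr0.
- by rewrite [branch (_ - _)]branch_neg // mulr0 addr0.
- have -> : n.+2%:Z - 2 = n by lia.
  by rewrite /branch /= addn1.
by rewrite !branch_neg ?odd_count_neg ?mulr0 ?addr0 //; lia.
Qed.


Definition geom (m : nat) : rat := \sum_(x < m) Q ^+ x.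

Lemma geomS m : geom m.+1 = geom m + Q ^+ m.
Proof. exact: big_ord_recr. Qed.

Lemma geom_mul m : Q * geom m = geom m + Q ^+ m - 1.
Proof.
elim: m => [|m IH]; first by rewrite /geom big_ord0 mulr0 add0r subrr.
by rewrite geomS mulrDr IH -exprS; ring.
Qed.

(** The difference [D T] of consecutive values satisfies [D T = 2 + Q * D (T - 2)], and
    [1 + Q * geom e = geom e.+1] solves this in each parity. *)
Lemma branch_diff e :
  branch e.*2%:Z - branch (e.*2%:Z - 1) = 2 * geom e + Q ^+ e /\
  branch e.*2.+1%:Z - branch e.*2%:Z = 2 * geom e.+1.
Proof.
elim: e => [|e [IH1 IH2]].
  by rewrite /geom big_ord0 big_ord1; split; rewrite /branch /= ?expr0; ring.
have E1 : branch e.+1.*2%:Z - branch (e.+1.*2%:Z - 1) = 2 * geom e.+1 + Q ^+ e.+1.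
  rewrite branchE [branch (_ - 1)]branchE.
  have -> : e.+1.*2%:Z - 1 - 2 = e.*2%:Z - 1 by lia.
  have -> : e.+1.*2%:Z - 2 = e.*2%:Z by lia.
  rewrite opprD addrACA -mulrBr IH1.
  have -> : e.+1.*2%:Z - 1 = e.*2.+1%:Z by lia.
  rewrite !odd_count_nat.
  have -> : (2 * e.+1.*2).+1%:R - (2 * e.*2.+1).+1%:R = 2 :> rat.
    by rewrite -natrB; [congr (_%:R)|]; lia.
  rewrite mulrDr mulrCA geom_mul geomS exprS; ring.
split=> //; rewrite branchE [X in _ - X]branchE.
have -> : e.+1.*2.+1%:Z - 2 = e.*2.+1%:Z by lia.
have -> : e.+1.*2%:Z - 2 = e.*2%:Z by lia.
rewrite opprD addrACA -mulrBr IH2.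
rewrite !odd_count_nat.
have -> : (2 * e.+1.*2.+1).+1%:R - (2 * e.+1.*2).+1%:R = 2 :> rat.
  by rewrite -natrB; [congr (_%:R)|]; lia.
by rewrite mulrCA geom_mul !geomS; ring.
Qed.

Lemma branch_diffT T : branch T%:Z - branch (T%:Z - 1) =
  2 * geom (uphalf T) + (~~ odd T)%:R * Q ^+ T./2.
Proof.
have [h1 h2] := branch_diff T./2; have := odd_double_half T; rewrite uphalf_half.
move: (T./2) h1 h2 => e h1 h2; case: (odd T) => TE.
  have -> : T%:Z - 1 = e.*2%:Z by lia.
  have -> : T%:Z = e.*2.+1%:Z by lia.
  by rewrite h2 /= mul0r addr0.
have -> : T%:Z = e.*2%:Z by lia.
by rewrite h1 /= mul1r.
Qed.

Lemma sum_exp_min (c N : nat) : (c <= N.+1)%N ->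
  \sum_(x < N.+1) Q ^+ minn c x = geom c + (N.+1 - c)%:R * Q ^+ c.
Proof.
elim: N => [|N IH] cN.
  rewrite big_ord1 minn0 expr0; case: c cN => [|[|//]] _.
    by rewrite /geom big_ord0 expr0 mulr1 add0r.
  by rewrite /geom big_ord1 expr0 subnn mul0r addr0.
rewrite big_ord_recr /=; have [cN'|] := leqP c N.+1.
  by rewrite IH // (subSn cN') -natr1; ring.
move=> lt; have {cN lt} -> : c = N.+2 by lia.
rewrite subnn mul0r addr0 geomS; congr (_ + _).
by apply: eq_bigr => x _; have := ltn_ord x; move=> hx; congr (_ ^+ _); lia.
Qed.

(** The bridge from the powers of [Q] in the statement to the tree sums: consecutive exponents
    [a./2] repeat in pairs, as do the terms of [branch_diffT]. *)
Lemma sum_exp_half n : \sum_(a < n.+1) Q ^+ a./2 = branch n - branch (n%:Z - 1).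
Proof.
elim: n => [|n IH]; first by rewrite big_ord1 [X in _ - X]branch_neg ?subr0.
rewrite big_ord_recr /= IH !branch_diffT /= !uphalf_half.
by case: (odd n) => /=; rewrite ?add1n ?add0n ?geomS /=; ring.
Qed.

Let even_pos (a : nat) := (0 < a)%N && ~~ odd a.

Lemma sum_exp_even n :
  \sum_(a < n.+1 | even_pos a) (Q ^+ a./2 - Q ^+ a./2.-1) = Q ^+ n./2 - 1.
Proof.
elim: n => [|n IH]; first by rewrite big_mkcond big_ord_recr big_ord0 /= subrr.
rewrite big_mkcond big_ord_recr /= -big_mkcond IH /even_pos /= negbK uphalf_half.
by case: (odd n) => /=; rewrite ?add1n ?add0n ?addr0 //=; ring.
Qed.

(** The part of the formula with [a' <= S - f2], already summed over [b'], for [d = S - f2] and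
    [k = f2 - f1]. It is affine in [k]; the rest is an induction on [d]. *)
Lemma closed_eval0 (d k : nat) :
  2 * \sum_(a < d.+1) (geom a./2 + ((d + k).+1 - a)%:R * Q ^+ a./2)
  - (d + k).+1%:R - \sum_(a < d.+1 | even_pos a) Q ^+ a./2
  - \sum_(a < d.+1 | even_pos a) (d + k - a)%:R * (Q ^+ a./2 - Q ^+ a./2.-1)
  = k.+1%:R * (branch d - branch (d%:Z - 2))
    + branch (d%:Z - 1) + 2 * branch (d%:Z - 2).
Proof.
have e1 : \sum_(a < d.+1) (geom a./2 + ((d + k).+1 - a)%:R * Q ^+ a./2) =
    \sum_(a < d.+1) (geom a./2 - a%:R * Q ^+ a./2)
    + (d + k).+1%:R * (branch d - branch (d%:Z - 1)).
  rewrite -sum_exp_half mulr_sumr -big_split /=; apply: eq_bigr => a _.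
  by rewrite natrB ?mulrBl; [ring|have := ltn_ord a; lia].
have e2 : \sum_(a < d.+1 | even_pos a) (d + k - a)%:R * (Q ^+ a./2 - Q ^+ a./2.-1) =
    (d + k)%:R * (Q ^+ d./2 - 1) -
    \sum_(a < d.+1 | even_pos a) a%:R * (Q ^+ a./2 - Q ^+ a./2.-1).
  rewrite -sum_exp_even mulr_sumr -sumrB /=; apply: eq_bigr => a _.
  by rewrite natrB ?mulrBl //; have := ltn_ord a; lia.
rewrite e1 e2 {e1 e2}.
(* With [k] factored out, three running sums remain, each of which changes by one last term when [d]
   grows. *)
set A := fun d => \sum_(a < d.+1) (geom a./2 - a%:R * Q ^+ a./2).
set B := fun d => \sum_(a < d.+1 | even_pos a) Q ^+ a./2.
set C := fun d => \sum_(a < d.+1 | even_pos a) a%:R * (Q ^+ a./2 - Q ^+ a./2.-1).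
rewrite -/(A d) -/(B d) -/(C d).
have AS n : A n.+1 = A n + (geom n.+1./2 - n.+1%:R * Q ^+ n.+1./2).
  by rewrite /A big_ord_recr.
have BS n : B n.+1 = B n + (odd n)%:R * Q ^+ n.+1./2.
  rewrite /B big_mkcond big_ord_recr /= -big_mkcond /=; congr (_ + _).
  by rewrite /even_pos /= negbK; case: (odd n); rewrite ?mul1r ?mul0r.
have CS n : C n.+1 = C n + (odd n)%:R * (n.+1%:R * (Q ^+ n.+1./2 - Q ^+ n.+1./2.-1)).
  rewrite /C big_mkcond big_ord_recr /= -big_mkcond /=; congr (_ + _).
  by rewrite /even_pos /= negbK; case: (odd n); rewrite ?mul1r ?mul0r.
suff : A d * 2 - B d + C d + (d + k).+1%:R * (2 * (branch d - branch (d%:Z - 1)) - 1)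
   - (d + k)%:R * (Q ^+ d./2 - 1) = k.+1%:R * (branch d - branch (d%:Z - 2))
    + branch (d%:Z - 1) + 2 * branch (d%:Z - 2).
  by move=> <-; ring.
elim: d => [|n IH].
  have -> : A 0%N = 0 by rewrite /A big_ord1 /geom big_ord0 mul0r subrr.
  have -> : B 0%N = 0 by rewrite /B big_mkcond big_ord1.
  have -> : C 0%N = 0 by rewrite /C big_mkcond big_ord1.
  rewrite /branch /= expr0; ring.
have hn := branch_diffT n.
have hn1 := branch_diffT n.+1.
have -> : n.+1%:Z - 2 = n%:Z - 1 by lia.
have nE : n.+1%:Z - 1 = n%:Z by lia.
rewrite nE in hn1 *; rewrite AS BS CS.
(* [branch_diffT] covers natural arguments only; for [n = 0] both values of [branch] are at negative
   arguments and vanish. *)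
have hm : branch (n%:Z - 1) - branch (n%:Z - 1 - 1) =
    2 * geom n./2 + (odd n)%:R * Q ^+ n./2.
  case: (n) => [|m]; first by rewrite !branch_neg /geom ?big_ord0 //= mulr0 mul0r.
  have -> : m.+1%:Z - 1 = m%:Z by lia.
  rewrite branch_diffT /= uphalf_half; case: (odd m) => /=; last by rewrite add0n.
  by rewrite !mul0r.
move: IH; rewrite -[n%:Z - 2](_ : n%:Z - 1 - 1 = _); last by lia.
move: (branch (n%:Z - 1 - 1)) hm => g /eqP; rewrite subr_eq => /eqP hm.
move: hn => /eqP; rewrite subr_eq => /eqP hn.
move: hn1 => /eqP; rewrite subr_eq => /eqP hn1.
rewrite hn1 hn hm /= !uphalf_half {hn1 hn hm} -!natr1 !natrD.
move: (A n) (B n) (C n) (n%:R : rat) => a b c x.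
case: (odd n) => /=; rewrite ?add1n ?add0n ?geomS ?mul1r ?mul0r; lra.
Qed.

Lemma sum_ord_recr_cond n (p : pred nat) (f : nat -> rat) :
  \sum_(a < n.+1 | p a) f a = \sum_(a < n | p a) f a + (if p n then f n else 0).
Proof. by rewrite big_mkcond big_ord_recr /= -big_mkcond. Qed.

(** * From the sums of the statement to values of [branch] *)

Section Evaluation.
Variables (d r k : nat).
Hypothesis rd : (r <= d)%N.

(** With [x = d + k - b] the condition on [b] becomes [x <= d + k - uphalf a], which is the range of
    [sum_exp_min]; [uphalf a + a./2 = a] gives the coefficient. *)
Lemma sum_exp_min_shift (a : nat) : (a <= d)%N ->
  \sum_(b < (d + k).+1 | (a <= 2 * b)%N) Q ^+ minn a./2 (d + k - b) =
  geom a./2 + ((d + k).+1 - a)%:R * Q ^+ a./2.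
Proof.
move=> ad; have -> : ((d + k).+1 - a = (d + k - uphalf a).+1 - a./2)%N.
  by have := odd_double_half a; rewrite uphalf_half; lia.
rewrite -sum_exp_min; last by have := odd_double_half a; rewrite uphalf_half; lia.
rewrite (reindex_inj rev_ord_inj) /=.
rewrite (big_ord_widen_cond (d + k).+1 (fun=> true) (fun x => Q ^+ minn a./2 x)).
  apply: eq_big => x.
    by rewrite /=; have := ltn_ord x; have := odd_double_half a; rewrite uphalf_half; lia.
  by move=> _; have := ltn_ord x => hx; congr (_ ^+ minn _ _); lia.
lia.
Qed.

(** The range of [b] is the condition on the ceiling of [a' / 2], which already implies
    [a' <= 2 b']. The hypothesis [r <= d] ensures [uphalf a <= d]. *)
Lemma sum_exp_shift (a : nat) : (d < a <= d + r)%N ->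
  \sum_(b < (d + k).+1 | (uphalf a + k <= b)%N) Q ^+ (d + k - b) =
  geom (d - uphalf a).+1.
Proof.
move=> ad; rewrite (reindex_inj rev_ord_inj) /=.
have ua : (uphalf a <= d)%N by have := odd_double_half a; rewrite uphalf_half; lia.
rewrite /geom (big_ord_widen_cond (d + k).+1 (fun=> true) (fun x => Q ^+ x)); last lia.
apply: eq_big => x; first by rewrite /=; have := ltn_ord x; lia.
by move=> _; have := ltn_ord x => hx; congr (_ ^+ _); lia.
Qed.

(** The part with [S - f2 < a' <= f1]. Raising [r] by one adds the term [a = d + r], which is
    [branch T - branch (T - 1)] for [T = d - r] (with the new [r]), so the sum telescopes. *)
Lemma tail_eval : (r <= d)%N ->
  2 * \sum_(a < (d + r).+1 | (d < a)%N) geom (d - uphalf a).+1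
  - \sum_(a < (d + r).+1 | (d < a)%N && ~~ odd a) Q ^+ (d - a./2)
  = branch (d%:Z - 1) - branch (d%:Z - r%:Z - 1).
Proof.
elim: r => [|m IH] md.
  rewrite addn0 subr0 subrr !big1 ?mulr0 ?subrr // => a; have := ltn_ord a.
    by move=> ? /andP[]; lia.
  by lia.
have {}IH := IH (ltnW md).
have E1 := sum_ord_recr_cond (d + m).+1 (fun a => (d < a)%N)
  (fun a => geom (d - uphalf a).+1).
have E2 := sum_ord_recr_cond (d + m).+1 (fun a => (d < a)%N && ~~ odd a)
  (fun a => Q ^+ (d - a./2)).
rewrite addnS; cbv beta in E1, E2; rewrite E1 E2 {E1 E2}.
have -> : (d < (d + m).+1)%N by lia.
rewrite /= mulrDr opprD addrACA IH.
set T := (d - m.+1)%N.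
have hT := branch_diffT T.
have -> : (d%:Z - m%:Z - 1) = T%:Z by lia.
have -> : (d%:Z - m.+1%:Z - 1) = T%:Z - 1 by lia.
have -> : (d - uphalf (d + m).+1).+1 = (T./2).+1.
  by have := odd_double_half T; have := odd_double_half (d + m).+1; rewrite uphalf_half; lia.
have -> : ~~ odd (d + m) = odd T by lia.
move/eqP: hT; rewrite subr_eq => /eqP ->; rewrite uphalf_half geomS /=.
case oT : (odd T); rewrite ?add1n ?add0n ?geomS ?mul1r ?mul0r /=; first ring.
have -> : (d - uphalf (d + m))%N = T./2.
  have := odd_double_half T; have := odd_double_half (d + m).
  by rewrite oT uphalf_half; lia.
by ring.
Qed.

(** Carries the sums of the statement, over sets of integers cut out by propositions, to sums over
    ordinals with boolean conditions. *)
Lemma fsbig_int_nat (M : nat) (P : int -> Prop) (p : pred nat) (f : int -> rat) :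
  (forall a, P a -> 0 <= a <= M%:Z) ->
  (forall a : nat, (a <= M)%N -> P a%:Z <-> p a) ->
  \sum_(a \in [set a | P a]) f a = \sum_(a < M.+1 | p a) f a%:Z.
Proof.
move=> bP Pp; rewrite -(big_mkord p (fun a => f a%:Z)) -big_filter.
have: forall b, (b \in index_iota 0 M.+1) = (b <= M)%N by move=> b; rewrite mem_index_iota.
have uS : uniq (index_iota 0 M.+1) by apply: iota_uniq.
move: (index_iota 0 M.+1) uS => S uS mS.
rewrite -(big_map (fun a : nat => a%:Z) xpredT f) [RHS]fsbig_seq; last first.
  by rewrite map_inj_uniq ?filter_uniq // => a b [].
suff -> : [set a | P a] = [set` [seq a%:Z | a <- S & p a]] by [].
apply/seteqP; split=> a /=.
  move=> Pa; have /andP[a0 aM] := bP _ Pa.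
  have aE : a = `|a|%N%:Z by lia.
  apply/mapP; exists `|a|%N; last exact: aE.
  rewrite mem_filter mS.
  have aM' : (`|a| <= M)%N by lia.
  by apply/andP; split; [apply/(Pp _ aM'); rewrite -aE|lia].
case/mapP => b; rewrite mem_filter mS => /andP[pb bM] ->.
by apply/Pp => //; lia.
Qed.

(** The parameters are [d = S - f2], [k = f2 - f1] and [r = f1 + f2 - S]. *)
Lemma formula_eval (s g1 g2 : int) :
  s = (2 * d + r + k)%N -> g1 = (d + r)%N -> g2 = (d + r + k)%N ->
  2 * (\sum_(b \in [set b : int | 0 <= b <= s - g1])
      (\sum_(a \in [set a : int | [/\ 0 <= a <= g1, a <= 2 * b & a <= s - g2]])
          Q ^ Num.min (a %/ 2)%Z (s - g1 - b)
       + \sum_(a \in [set a : int | [/\ s - g2 < a <= g1, a <= 2 * b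
                        & - ((- a) %/ 2)%Z - b <= g1 - g2]])
          Q ^ (s - g1 - b)))
    - (s - g1 + 1)%:~R
    - \sum_(a \in [set a : int | [/\ 0 < a <= g1, a <= s - g2 & (2 %| a)%Z]])
        Q ^ Num.min (a %/ 2)%Z (s - g1 - (a %/ 2)%Z)
    - \sum_(a \in [set a : int | [/\ s - g2 < a <= g1, (2 %| a)%Z
                      & s - g1 <= s - g2]])
        Q ^ (s - g1 - (a %/ 2)%Z)
    - \sum_(b \in [set b : int | 0 < b <= s - g1])
      \sum_(a \in [set a : int | [/\ 0 < a <= g1, a < 2 * b, (2 %| a)%Z,
                      a <= s - g2 & (a %/ 2)%Z <= s - g1 - b]])
        (Q ^ (a %/ 2)%Z - Q ^ ((a %/ 2)%Z - 1))
    - \sum_(a \in [set a : int | [/\ s - g2 < a <= g1, (2 %| a)%Z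
                      & s - g2 < s - g1]])
        Q ^ (s - g2 - (a %/ 2)%Z)
  = (k + 1)%:R * (branch d - branch (d%:Z - 2)) + 2 * branch (d%:Z - 1)
    + 2 * branch (d%:Z - 2) - branch (d%:Z - r%:Z - 1).
Proof.
move=> sE gE1 gE2.
have -> : s - g1 = (d + k)%N by lia.
have -> : s - g2 = d by lia.
have -> : g1 - g2 = - k%:Z by lia.
rewrite {}gE1 {sE gE2}.
have halfE (a : nat) : (a%:Z %/ 2)%Z = a./2 by lia.
have uphalfE (a : nat) : - ((- a%:Z) %/ 2)%Z = uphalf a by lia.
have dvdE (a : nat) : (2 %| a%:Z)%Z = ~~ odd a by lia.
have minE (a b : nat) : Num.min a%:Z b%:Z = minn a b by lia.
set A1 := (X in 2 * X - _ - _ - _ - _ - _ = _).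
set A4 := (X in 2 * _ - _ - X - _ - _ - _ = _).
set A5 := (X in 2 * _ - _ - _ - X - _ - _ = _).
set A6 := (X in 2 * _ - _ - _ - _ - X - _ = _).
set A7 := (X in 2 * _ - _ - _ - _ - _ - X = _).
have E1 : A1 = \sum_(a < d.+1) (geom a./2 + ((d + k).+1 - a)%:R * Q ^+ a./2)
   + \sum_(a < (d + r).+1 | (d < a)%N) geom (d - uphalf a).+1.
  rewrite /A1 (@fsbig_int_nat (d + k) _ xpredT); [|by []|by move=> a; split; lia].
  rewrite big_split /=; congr (_ + _).
    transitivity (\sum_(b < (d + k).+1) \sum_(a < d.+1 | (a <= 2 * b)%N)
        Q ^+ minn a./2 (d + k - b)).
      apply: eq_bigr => b _; have := ltn_ord b => hb.
      rewrite (@fsbig_int_nat d _ (fun a => a <= 2 * b)%N).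
      - apply: eq_bigr => a _; rewrite halfE.
        have -> : (d + k)%N%:Z - b%:Z = (d + k - b)%N by lia.
        by rewrite minE.
      - by move=> a []; lia.
      - by move=> a ad; split=> [[]|]; [lia|split; lia].
    rewrite (exchange_big_dep xpredT) //=; apply: eq_bigr => a _.
    by apply: sum_exp_min_shift; have := ltn_ord a; lia.
  transitivity (\sum_(b < (d + k).+1) \sum_(a < (d + r).+1 | (d < a)%N && (uphalf a + k <= b)%N)
        Q ^+ (d + k - b)).
    apply: eq_bigr => b _; have := ltn_ord b => hb.
    rewrite (@fsbig_int_nat (d + r) _ (fun a => (d < a)%N && (uphalf a + k <= b)%N)).
    - apply: eq_bigr => a _.
      by have -> : (d + k)%N%:Z - b%:Z = (d + k - b)%N by lia.
    - by move=> a []; lia.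
    - move=> a ad; rewrite uphalfE; split=> [[]|/andP[]]; first by lia.
      by move=> h1 h2; split; lia.
  rewrite (exchange_big_dep (fun a : 'I_(d + r).+1 => d < a)%N) /=; last first.
    by move=> b a _ /andP[].
  apply: eq_bigr => a da; rewrite -(@sum_exp_shift a).
    by apply: eq_bigl => b; rewrite da.
  by rewrite da /=; have := ltn_ord a; lia.
(* Since [a <= d], the minimum is its first argument [a./2]. *)
have E4 : A4 = \sum_(a < d.+1 | even_pos a) Q ^+ a./2.
  rewrite /A4 (@fsbig_int_nat d _ even_pos).
  - apply: eq_bigr => a _; have := ltn_ord a => ha; rewrite halfE.
    have -> : (d + k)%N%:Z - a./2%:Z = (d + k - a./2)%N by lia.
    by rewrite minE; congr (_ ^+ _); lia.
  - by move=> a []; lia.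
  - move=> a ad; rewrite dvdE /even_pos; split=> [[]|/andP[]]; first by lia.
    by move=> h1 h2; split; lia.
(* The two sums exclude each other, one requiring [k = 0] and the other [k > 0]; for [k = 0] the
   exponents agree, so together they form one sum. *)
have E57 : A5 + A7 = \sum_(a < (d + r).+1 | (d < a)%N && ~~ odd a) Q ^+ (d - a./2).
  rewrite /A5 /A7.
  rewrite (@fsbig_int_nat (d + r) _ (fun a => [&& d < a, ~~ odd a & k == 0])%N).
  - rewrite [X in _ + X](@fsbig_int_nat (d + r) _ (fun a => [&& d < a, ~~ odd a & k != 0])%N).
    + rewrite [in RHS](bigID (fun=> k == 0%N)) /=; congr (_ + _).
        apply: eq_big => a; first by rewrite andbA.
        move=> /and3P[h1 h2 h3]; have := ltn_ord a => ha; rewrite halfE.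
        by have -> : (d + k)%N%:Z - a./2%:Z = (d - a./2)%N by lia.
      apply: eq_big => a; first by rewrite andbA.
      move=> _; have := ltn_ord a => ha; rewrite halfE.
      by have -> : d%:Z - a./2%:Z = (d - a./2)%N by lia.
    + by move=> a []; lia.
    + move=> a ad; rewrite dvdE; split=> [[]|/and3P[]]; first by lia.
      by move=> h1 h2 h3; split; lia.
  - by move=> a []; lia.
  - move=> a ad; rewrite dvdE; split=> [[]|/and3P[]]; first by lia.
    by move=> h1 h2 h3; split; lia.
(* For an even [a > 0] the index [b] satisfies [a./2 < b <= d + k - a./2], which leaves [d + k - a]
   values. *)
have E6 : A6 = \sum_(a < d.+1 | even_pos a) (d + k - a)%:R * (Q ^+ a./2 - Q ^+ a./2.-1).
  rewrite /A6 (@fsbig_int_nat (d + k) _ (fun b => 0 < b)%N).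
  - transitivity (\sum_(b < (d + k).+1 | (0 < b)%N)
        \sum_(a < d.+1 | even_pos a && (a./2 < b <= d + k - a./2)%N)
        (Q ^+ a./2 - Q ^+ a./2.-1)).
      apply: eq_bigr => b b0; have := ltn_ord b => hb.
      rewrite (@fsbig_int_nat d _ (fun a => even_pos a && (a./2 < b <= d + k - a./2)%N)).
      + apply: eq_bigr => a /andP[/andP[a0 ea] _]; rewrite halfE.
        have -> : a./2%:Z - 1 = a./2.-1 by lia.
        by [].
      + by move=> a []; lia.
      + move=> a ad; rewrite dvdE halfE /even_pos; split=> [[]|/andP[/andP[]]]; first by lia.
        by move=> h1 h2 h3; split; lia.
    rewrite (exchange_big_dep (fun a : 'I_d.+1 => even_pos a)) /=; last first.
      by move=> b a _ /andP[].
    apply: eq_bigr => a ea; have := ltn_ord a => ha.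
    rewrite big_const iter_addr_0 -[LHS]mulr_natl. congr (_ * _); congr (_%:R).
    rewrite -sum1_card; transitivity (\sum_(a./2.+1 <= b < (d + k - a./2).+1) 1)%N.
      rewrite (big_nat_widen _ _ (d + k).+1); last lia.
      rewrite (big_nat_widenl _ 0) // big_mkord.
      by apply: eq_bigl => b; rewrite unfold_in; have := ltn_ord b; move: ea; rewrite /even_pos; lia.
    by rewrite sum_nat_const_nat muln1; move: ea; rewrite /even_pos; lia.
  - by move=> a; lia.
  - by move=> a; lia.
have B1 := closed_eval0 d k; have B2 := tail_eval rd.
rewrite E1 E4 E6 -[branch (d%:Z - r%:Z - 1)]opprK.
have -> : ((d + k)%N%:Z + 1)%:~R = (d + k).+1%:R :> rat.
  by have -> : (d + k)%N%:Z + 1 = (d + k).+1%:Z by lia.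
move: E57 B1 B2; move: A5 A7 => a5 a7 <-; rewrite -[k.+1]addn1.
lra.
Qed.

End Evaluation.

End BranchWeight.

(** * Discrete valuations and integral closure *)

Section Valuation.
Variables (F : fieldType) (v : discrete_valuation F).
Implicit Types (x y : F) (m n : int).

Lemma dval1 : v 1 = 0.
Proof.
have h : v (1 * 1) = v 1 + v 1 by rewrite dvalM ?oner_neq0.
by rewrite mulr1 in h; lia.
Qed.

Lemma dvalN1 : v (-1) = 0.
Proof.
have n1 : (-1 : F) != 0 by rewrite oppr_eq0 oner_neq0.
have h : v (-1 * -1) = v (-1) + v (-1) by rewrite dvalM.
by rewrite mulrNN mulr1 dval1 in h; lia.
Qed.

Lemma dvalN x : v (- x) = v x.
Proof.
have [->|x0] := eqVneq x 0; first by rewrite oppr0.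
have n1 : (-1 : F) != 0 by rewrite oppr_eq0 oner_neq0.
by rewrite -mulN1r dvalM // dvalN1 add0r.
Qed.

Lemma dvalV x : x != 0 -> v x^-1 = - v x.
Proof.
move=> x0; have xi0 : x^-1 != 0 by rewrite invr_eq0.
have h : v (x / x) = v x + v x^-1 by rewrite dvalM.
by rewrite divff // dval1 in h; lia.
Qed.

Lemma dvalXn x (n : nat) : x != 0 -> v (x ^+ n) = n%:Z * v x.
Proof.
move=> x0; elim: n => [|n IH]; first by rewrite expr0 dval1 mul0r.
by rewrite exprS dvalM ?expf_neq0 // IH; lia.
Qed.

Lemma dvalXz x n : x != 0 -> v (x ^ n) = n * v x.
Proof.
move=> x0; case: n => n; first exact: dvalXn.
by rewrite NegzE -exprnN dvalV ?expf_neq0 // dvalXn // mulNr.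
Qed.

Lemma val_geP n x : x != 0 -> val_ge v n x <-> n <= v x.
Proof. by move=> x0; split=> [[x00|//]|]; [rewrite x00 eqxx in x0|right]. Qed.

Lemma val_geW m n x : m <= n -> val_ge v n x -> val_ge v m x.
Proof. by move=> mn [->|h]; [left|right; apply: le_trans h]. Qed.

Lemma val_geN n x : val_ge v n x -> val_ge v n (- x).
Proof. by case=> [->|h]; [left; rewrite oppr0|right; rewrite dvalN]. Qed.

Lemma val_geD n x y : val_ge v n x -> val_ge v n y -> val_ge v n (x + y).
Proof.
have [->|x0] := eqVneq x 0; first by rewrite add0r.
have [->|y0] := eqVneq y 0; first by rewrite addr0.
have [->|xy0] := eqVneq (x + y) 0; first by left.
rewrite !val_geP // => hx hy; apply: le_trans (dvalD v x0 y0 xy0).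
by rewrite le_min hx.
Qed.

Lemma val_geB n x y : val_ge v n x -> val_ge v n y -> val_ge v n (x - y).
Proof. by move=> hx hy; apply/val_geD/val_geN. Qed.

Lemma val_geM m n x y :
  val_ge v m x -> val_ge v n y -> val_ge v (m + n) (x * y).
Proof.
have [->|x0] := eqVneq x 0; first by rewrite mul0r; left.
have [->|y0] := eqVneq y 0; first by rewrite mulr0; left.
rewrite !val_geP ?mulf_neq0 // dvalM // => *; exact: lerD.
Qed.

Lemma val_ge_sum n (I : Type) (r : seq I) (f : I -> F) :
  (forall i, val_ge v n (f i)) -> val_ge v n (\sum_(i <- r) f i).
Proof.
by move=> h; elim/big_ind: _ => //; [left|apply: val_geD].
Qed.

Lemma int_ring1 : int_ring v 1.
Proof. by right; rewrite dval1. Qed.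

Lemma int_ringM x y : int_ring v x -> int_ring v y -> int_ring v (x * y).
Proof. exact: (@val_geM 0 0). Qed.

Lemma not_val_ge x n : ~ val_ge v n x -> x != 0 /\ v x < n.
Proof.
have [->|x0] := eqVneq x 0; first by case; left.
by rewrite val_geP // => h; split=> //; rewrite ltNge; apply/negP.
Qed.

Lemma int_ring_unit x : x != 0 -> v x = 0 -> int_ring v x /\ int_ring v x^-1.
Proof. by move=> x0 h; split; right; rewrite ?dvalV // h. Qed.

Lemma int_ringN1unit x : int_ring v x -> ~ val_ge v 1 x -> x != 0 /\ v x = 0.
Proof.
move=> ix /not_val_ge[x0 h]; split=> //; move/(val_geP _ x0): ix; lia.
Qed.

Variable pi : F.
Hypothesis hpi : uniformizer v pi.

Lemma unif_neq0 : pi != 0. Proof. by case: hpi. Qed.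

Lemma unifz_neq0 n : pi ^ n != 0. Proof. by rewrite expfz_neq0 // unif_neq0. Qed.

Lemma dval_unifz n : v (pi ^ n) = n.
Proof. by rewrite dvalXz ?unif_neq0 //; case: hpi => _ ->; rewrite mulr1. Qed.

Lemma val_ge_unifz n : val_ge v n (pi ^ n).
Proof. by right; rewrite dval_unifz. Qed.

Lemma val_ge_shift n m x : val_ge v n (pi ^ m * x) <-> val_ge v (n - m) x.
Proof.
have [->|x0] := eqVneq x 0; first by rewrite mulr0; split; left.
rewrite !val_geP ?mulf_neq0 ?unifz_neq0 // dvalM ?unifz_neq0 // dval_unifz.
by split; lia.
Qed.

Lemma unifzD m n : pi ^ (m + n) = pi ^ m * pi ^ n.
Proof. by rewrite expfzDr // unif_neq0. Qed.

Lemma unifzK m : pi ^ m * pi ^ (- m) = 1.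
Proof. by rewrite -unifzD subrr expr0z. Qed.

End Valuation.


Section IntegerRing.
Variables (F : fieldType) (v : discrete_valuation F).

Definition int_pred : {pred F} := fun x => `[< int_ring v x >].

Fact int_pred_subring : subring_closed int_pred.
Proof.
split; first by apply/asboolP; apply: int_ring1.
  by move=> x y /asboolP hx /asboolP hy; apply/asboolP; apply: val_geB.
by move=> x y /asboolP hx /asboolP hy; apply/asboolP; apply: int_ringM.
Qed.
HB.instance Definition _ :=
  GRing.isSubringClosed.Build F int_pred int_pred_subring.

(** The integers of [F] as a ring type, so that [integralOver] applies and supplies closure of the
    integral elements under sums and products. *)
Record int_elt := IntElt {int_val : F; int_valP : int_val \in int_pred}.
HB.instance Definition _ := [isSub for int_val].
HB.instance Definition _ := [Choice of int_elt by <:].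
HB.instance Definition _ := [SubChoice_isSubComNzRing of int_elt by <:].

End IntegerRing.

Section IntegralClosure.
Variables (F : fieldType) (v : discrete_valuation F) (K : fieldExtType F).
Local Notation O := (int_closure v K).

Let toK : {rmorphism int_elt v -> K} := in_alg K \o (val : int_elt v -> F).

Lemma int_closureP (x : K) : O x <-> integralOver toK x.
Proof.
split=> [[p [mp ip] rp]|[p mp rp]]; last first.
  exists (map_poly (val : int_elt v -> F) p); last by rewrite -map_poly_comp.
  split; first by rewrite monic_map.
  by move=> i; rewrite coef_map; apply/asboolP/(int_valP p`_i).
pose c i : int_elt v := IntElt (introT (asboolP _) (ip i)).
have cE : map_poly (val : int_elt v -> F) (\poly_(i < size p) c i) = p.
  apply/polyP => i; rewrite coef_map coef_poly.
  by case: ltnP => // h; rewrite raddf0 nth_default.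
exists (\poly_(i < size p) c i); last by rewrite map_poly_comp cE.
apply/monicP/val_inj; rewrite /= -[RHS](rmorph1 (val : int_elt v -> F)).
rewrite -[LHS](@lead_coef_map_inj _ _ (val : int_elt v -> F)) ?cE //.
by rewrite (monicP mp) rmorph1.
Qed.

Lemma int_closureD x y : O x -> O y -> O (x + y).
Proof. by rewrite !int_closureP; apply: integral_add. Qed.

Lemma int_closureM x y : O x -> O y -> O (x * y).
Proof. by rewrite !int_closureP; apply: integral_mul. Qed.

Lemma int_closureB x y : O x -> O y -> O (x - y).
Proof. by rewrite !int_closureP; apply: integral_sub. Qed.

Lemma int_closure0 : O 0.
Proof. by rewrite int_closureP; apply: integral0. Qed.

Lemma int_closure1 : O 1.
Proof. by rewrite int_closureP; apply: integral1. Qed.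

(** The ring [o] is integrally closed: if [v a < 0], dividing a monic equation of [a] by its leading
    power writes [1] as a sum of terms of positive valuation. *)
Lemma int_closure_scalar a : O a%:A <-> int_ring v a.
Proof.
split=> [[p [mp ip] rp]|ia]; last first.
  exists ('X - a%:P); last by rewrite rmorphB /= map_polyX map_polyC root_XsubC.
  split; first exact: monicXsubC.
  move=> i; rewrite coefB coefX coefC; apply: val_geB.
    by case: eqP => _; [apply: int_ring1|left].
  by case: eqP => _; [|left].
have {}rp : p.[a] = 0.
  move: rp; rewrite /root -[a%:A]/(in_alg K a) horner_map fmorph_eq0.
  by move/eqP.
case: (pselect (int_ring v a)) => // /not_val_ge[a0 va].
have iv i : val_ge v i%:Z (a^-1 ^+ i).
  by right; rewrite dvalXn ?invr_eq0 // dvalV //; nia.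
have sp : (0 < size p)%N by rewrite size_poly_gt0 monic_neq0.
have : 1 = - \sum_(i < (size p).-1) p`_i * a^-1 ^+ ((size p).-1 - i)%N.
  move: rp; rewrite (@horner_coef_wide _ (size p).-1.+1); last by rewrite prednK.
  rewrite big_ord_recr /=.
  rewrite -lead_coefE (monicP mp) mul1r => /eqP.
  rewrite addr_eq0 => /eqP /(congr1 (fun z => z * a^-1 ^+ (size p).-1)).
  rewrite mulNr -exprMn divff // expr1n => h.
  rewrite -[LHS]opprK -h mulr_suml; congr (- _); apply: eq_bigr => i _.
  rewrite -mulrA; congr (_ * _).
  have -> : a^-1 ^+ (size p).-1 = a^-1 ^+ ((size p).-1 - i)%N * a^-1 ^+ i.
    by rewrite -exprD subnK // ltnW.
  by rewrite mulrCA -exprMn divff // expr1n mulr1.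
move=> e1.
have : val_ge v 1 1.
  rewrite e1; apply/val_geN/val_ge_sum => i.
  apply: (@val_geW _ _ _ (0 + ((size p).-1 - i)%N%:Z)).
    by have := ltn_ord i; lia.
  exact: val_geM (ip i) (iv _).
by rewrite val_geP ?oner_neq0 // dval1.
Qed.

Lemma int_closureZ a x : int_ring v a -> O x -> O (a *: x).
Proof.
by move=> ia ox; rewrite -mulr_algl; apply: int_closureM => //; apply/int_closure_scalar.
Qed.

End IntegralClosure.

(** * The maximal order of the quadratic extension *)

Section UnramifiedQuadratic.
Variables (F : fieldType) (v : discrete_valuation F) (K : fieldExtType F).
Local Notation O := (int_closure v K).
Variable pi : F.
Hypothesis hpi : uniformizer v pi.

(** If [p] is the minimal polynomial, of degree [n], then [p_i pi ^ (N (n - i))] are the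
    coefficients of a monic polynomial with root [pi ^ N x]; the sum of the [|v p_i|] is a
    sufficient [N]. *)
Lemma int_closure_denom (x : K) : exists N : nat, O (pi ^+ N *: x).
Proof.
have := minPolyOver 1%AS x; case/polyOver1P => p pE.
have mp : p \is monic by rewrite -(map_monic (in_alg K)) -pE monic_minPoly.
have rp : root (map_poly (in_alg K) p) x by rewrite -pE root_minPoly.
set n := (size p).-1.
have sp : size p = n.+1 by rewrite prednK // size_poly_gt0 monic_neq0.
exists (\sum_(i < n) `|v (p`_i)%R|)%N; set N := (\sum_(i < n) _)%N.
have cn : p`_n = 1 by rewrite -(monicP mp).
pose r := \poly_(i < n.+1) (p`_i * pi ^+ (N * (n - i))%N).
have rn : r`_n = 1 by rewrite coef_poly ltnSn cn subnn muln0 expr0 mulr1.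
have sr : size r = n.+1.
  by apply: size_poly_eq; rewrite cn subnn muln0 expr0 mulr1 oner_neq0.
exists r.
  split; first by rewrite monicE lead_coefE sr /= rn.
  move=> i; rewrite coef_poly; case: ifP => [|_]; last by left.
  rewrite ltnS leq_eqVlt => /orP[/eqP->|lin].
    by rewrite cn subnn muln0 mul1r expr0; apply: int_ring1.
  have [->|pi0] := eqVneq p`_i 0; first by rewrite mul0r; left.
  right; rewrite dvalM ?expf_neq0 ?(unif_neq0 hpi) //.
  rewrite dvalXn ?(unif_neq0 hpi) //; case: hpi => _ ->; rewrite mulr1.
  have : (`|v (p`_i)%R| <= N)%N by rewrite /N (bigD1 (Ordinal lin)) //= leq_addr.
  have : (0 < n - i)%N by rewrite subn_gt0.
  nia.
apply/rootP; rewrite (@horner_coef_wide _ n.+1) ?size_map_poly ?sr //.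
move/rootP: rp; rewrite (@horner_coef_wide _ n.+1) ?size_map_poly ?sp // => rp.
transitivity ((pi ^+ (N * n)%N)%:A *
  \sum_(i < n.+1) (map_poly (in_alg K) p)`_i * x ^+ i); last first.
  by rewrite rp mulr0.
rewrite mulr_sumr; apply: eq_bigr => i _.
rewrite !coef_map /= coef_poly ltn_ord exprZn !mulr_algl !scalerA.
congr (_ *: _); rewrite mulrC [RHS]mulrC -mulrCA -exprM -exprD -mulnDr.
by rewrite subnKC // -ltnS.
Qed.



(** Some [pi ^ M] makes [x^-1] integral, so an integral [pi ^ (- n) x] makes the scalar
    [pi ^ (M - n)] integral. This bound stands in for a valuation on [K]. *)
Lemma int_closure_separated (x : K) :
  x != 0 -> exists N : nat, forall n : int, N%:Z <= n -> ~ O (pi ^ (- n) *: x).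
Proof.
move=> x0; have [M OM] := int_closure_denom x^-1.
exists M.+1 => n Mn On; have := int_closureM On OM.
rewrite -scalerAl -scalerAr divff // scalerA exprnP -(unifzD hpi).
move/int_closure_scalar/(val_geP _ _ (unifz_neq0 hpi _)).
by rewrite (dval_unifz hpi); lia.
Qed.

Hypothesis ram : ramification_index1 v K.

Definition int_unit (x : K) : Prop := [/\ x != 0, O x & O x^-1].

Lemma int_unit_notin_max x : int_unit x -> ~ O (pi ^ (-1) *: x).
Proof.
move=> [x0 ox oxi] h; have := int_closureM h oxi.
rewrite -scalerAl divff // => /int_closure_scalar/(val_geP _ _ (unifz_neq0 hpi _)).
by rewrite (dval_unifz hpi); lia.
Qed.

Lemma int_unitP x : O x -> ~ O (pi ^ (-1) *: x) -> int_unit x.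
Proof.
move=> ox nx.
have [|nm] := pselect (ext_max_ideal v K x).
  rewrite (ram hpi) => -[y oy yx]; case: nx; rewrite -yx mulr_algl scalerA.
  by rewrite exprN1 mulVf ?(unif_neq0 hpi) // scale1r.
have x0 : x != 0.
  by apply/eqP => x0; apply: nm; split => //; left.
by split=> //; apply: contrapT => h; apply: nm; split => //; right.
Qed.

(** Divide by [pi] as long as the result stays integral; [int_closure_separated] ends the descent,
    and ramification index 1 makes the last quotient a unit. *)
Lemma int_unit_decomp x : x != 0 -> exists i u, int_unit u /\ x = pi ^ i *: u.
Proof.
move=> x0; have [N hN] := int_closure_separated x0.
have [M hM] := int_closure_denom x.
have key k : (exists n : int, O (pi ^ (- n) *: x) /\ N%:Z <= n + k%:Z) ->
    exists i u, int_unit u /\ x = pi ^ i *: u.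
  elim: k => [|k IH] [n [on nk]].
    by case: (hN n) => //; lia.
  case: (pselect (O (pi ^ (-1) *: (pi ^ (- n) *: x)))) => h.
    apply: IH; exists (n + 1); split; last lia.
    by move: h; rewrite scalerA -(unifzD hpi) -opprD addrC.
  exists n, (pi ^ (- n) *: x); split; first exact: int_unitP.
  by rewrite scalerA (unifzK hpi) scale1r.
apply: (key (N + M)%N); exists (- M%:Z); rewrite opprK; split => //; lia.
Qed.

Lemma int_closureZz n (x : K) : 0 <= n -> O x -> O (pi ^ n *: x).
Proof.
move=> n0; apply: int_closureZ; apply: val_geW (val_ge_unifz hpi n) => //.
Qed.

Hypothesis hF : nonarch_local_field v.
Hypothesis hdim : \dim {:K} = 2%N.

(** Otherwise every integer has the form [a + pi y] with [a] in [o]. Iterating expands it into a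
    series in [pi] with coefficients in [o], whose limit exists in [F] by completeness; so [O] lies
    in [F], against degree 2. *)
Lemma residue_ext_proper :
  exists2 t : K, O t & forall a, int_ring v a -> ~ O (pi ^ (-1) *: (t - a%:A)).
Proof.
apply: contrapT => nex.
have step (x : K) : exists ay : F * K,
    O x -> [/\ int_ring v ay.1, O ay.2 & x = ay.1%:A + pi *: ay.2].
  case: (pselect (O x)) => ox; last by exists (0, 0).
  apply: contrapT => nx; apply: nex; exists x => // a ia oxa; apply: nx.
  exists (a, pi ^ (-1) *: (x - a%:A)) => _; split => //=.
  by rewrite scalerA exprN1 divff ?(unif_neq0 hpi) // scale1r addrC subrK.
have [f fP] := choice step.
have [compl _] := hF.
have key (x : K) : O x -> exists l, x = l%:A.
  move=> ox; pose xs n := iter n (fun y => (f y).2) x.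
  have oxs n : O (xs n) by elim: n => //= n IH; have [] := fP _ IH.
  pose s n := \sum_(i < n) pi ^+ i * (f (xs i)).1.
  have xE n : x = (s n)%:A + pi ^+ n *: xs n.
    elim: n => [|n IH]; first by rewrite /s big_ord0 scale0r add0r scale1r.
    rewrite {1}IH /s big_ord_recr /= scalerDl -addrA; congr (_ + _).
    have [_ _ {1}->] := fP _ (oxs n).
    by rewrite scalerDr !scalerA exprSr.
  have tail m N : N <= m%:Z -> O (pi ^ (- N) *: (pi ^+ m *: xs m)).
    move=> Nm; rewrite scalerA exprnP -(unifzD hpi).
    by apply: int_closureZz => //; lia.
  have cau : val_cauchy v s.
    move=> N; exists `|N|%N => m n hm hn.
    rewrite -[s m - s n](mul1r) -(expr0z pi) -(subrr N) (unifzD hpi) -mulrA.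
    apply/(val_ge_shift hpi); rewrite subrr; apply/(int_closure_scalar v K).
    have -> : (pi ^ (- N) * (s m - s n))%:A =
      pi ^ (- N) *: (pi ^+ n *: xs n) - pi ^ (- N) *: (pi ^+ m *: xs m).
      rewrite -scalerBr -scalerA; congr (_ *: _); rewrite scalerBl.
      by apply/eqP; rewrite subr_eq addrAC eq_sym subr_eq -!xE addrC -xE.
    by apply: int_closureB; apply: tail; lia.
  have [l cvl] := compl _ cau; exists l; apply: contrapT => xl.
  have /int_closure_separated[N hN] : x - l%:A != 0.
    by rewrite subr_eq0; apply/eqP.
  have [n0 hn0] := cvl N%:Z.
  apply: (hN N%:Z) => //.
  set n := maxn n0 N.
  have -> : x - l%:A = (s n - l)%:A + pi ^+ n *: xs n.
    by rewrite {1}(xE n) scalerBl addrAC.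
  rewrite scalerDr; apply: int_closureD; last by apply: tail; rewrite lez_nat leq_maxr.
  rewrite scalerA; apply/int_closure_scalar/(val_ge_shift hpi).
  by rewrite opprK add0r; apply: hn0; rewrite leq_maxl.
have sub : ({:K} <= 1%VS)%VS.
  apply/subvP => x _; have [M oM] := int_closure_denom x.
  have [l xl] := key _ oM.
  have -> : x = (pi ^- M * l)%:A.
    by rewrite -scalerA -xl scalerA mulVf ?scale1r // expf_neq0 // (unif_neq0 hpi).
  by rewrite rpredZ // mem1v.
by have := dimvS sub; rewrite hdim dimv1.
Qed.

Definition int_basis (t : K) : Prop :=
  (forall x : K, exists a b, x = a%:A + b *: t) /\
  (forall a b, O (a%:A + b *: t) <-> int_ring v a /\ int_ring v b).

(** The residues of [1] and [t] are independent over the residue field of [F], so denominators of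
    the coordinates are removed one power of [pi] at a time. *)
Lemma int_basis_exists : exists t, int_basis t.
Proof.
have [t ot tP] := residue_ext_proper; exists t.
have nt (c : F) : t <> c%:A.
  move=> tc; have ic : int_ring v c by apply/(int_closure_scalar v K); rewrite -tc.
  by apply: (tP c ic); rewrite tc subrr scaler0; apply: int_closure0.
have gen : forall x : K, exists a b, x = a%:A + b *: t.
  have fr : free [:: 1; t].
    rewrite free_cons free_cons nil_free andbT span_nil memv0 span_seq1.
    apply/andP; split; last by apply/eqP => t0; apply: (nt 0); rewrite scale0r.
    apply/negP => /vlineP[c c1].
    have c0 : c != 0.
      by apply/eqP => c0; move: c1; rewrite c0 scale0r => /eqP; rewrite oner_eq0.
    by apply: (nt c^-1); rewrite c1 scalerA mulVf // scale1r.
  have spanE : span [:: 1; t] = {:K}%VS.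
    by apply/eqP; rewrite eqEdim subvf hdim (eqnP fr).
  move=> x; have : x \in span [:: 1; t] by rewrite spanE memvf.
  rewrite span_cons span_seq1 => /memv_addP[y /vlineP[a ->] [z /vlineP[b ->] ->]].
  by exists a, b.
split=> // a b; split=> [oab|[ia ib]]; last first.
  by apply: int_closureD; apply: int_closureZ => //; apply: int_closure1.
(* A pair [(c, d)] that is primitive at [pi] stays nonzero modulo [pi]. *)
have prim (c d : F) : int_ring v c -> int_ring v d ->
    O (pi ^ (-1) *: (c%:A + d *: t)) -> val_ge v 1 c /\ val_ge v 1 d.
  move=> ic id' ocd.
  have d1 : val_ge v 1 d.
    apply: contrapT => nd; have [d0 vd] := int_ringN1unit id' nd.
    have [_ idi] := int_ring_unit d0 vd.
    apply: (tP (- (d^-1 * c))); first exact/val_geN/int_ringM.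
    have -> : t - (- (d^-1 * c))%:A = d^-1 *: (c%:A + d *: t).
      by rewrite scalerDr !scalerA mulVf // scale1r scaleNr opprK addrC.
    by rewrite scalerA mulrC -scalerA; apply: int_closureZ.
  split=> //.
  have od : O (pi ^ (-1) *: (d *: t)).
    rewrite scalerA; apply: int_closureZ => //.
    by apply/(val_ge_shift hpi).
  have := int_closureB ocd od; rewrite scalerDr addrK scalerA => /int_closure_scalar.
  by move/(val_ge_shift hpi); rewrite opprK add0r.
have ind k c d : val_ge v (- k%:Z) c -> val_ge v (- k%:Z) d ->
    O (c%:A + d *: t) -> int_ring v c /\ int_ring v d.
  elim: k => [|k IH] hc hd ocd; first by rewrite oppr0 in hc hd.
  have [] := prim (pi ^ k.+1 * c) (pi ^ k.+1 * d).
  - by apply/(val_ge_shift hpi); rewrite sub0r.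
  - by apply/(val_ge_shift hpi); rewrite sub0r.
  - rewrite -!scalerA -scalerDr scalerA -(unifzD hpi).
    by apply: int_closureZz => //; lia.
  by move=> /(val_ge_shift hpi) hc1 /(val_ge_shift hpi) hd1; apply: IH => //;
    [apply: val_geW hc1|apply: val_geW hd1]; lia.
have low (c : F) : val_ge v (- `|v c|%N%:Z) c by right; lia.
apply: (ind (`|v a| + `|v b|)%N) => //; apply: val_geW (low _); lia.
Qed.

End UnramifiedQuadratic.

(** * Linear spans, ideal classes, residue digits *)

Section LinearSpan.
Variable A : comPzRingType.
Implicit Types (B X : set A) (x y : A).

Lemma lin_spanP B X x : lin_span B X x <->
  exists2 l : seq (A * A), (forall p, p \in l -> B p.1 /\ X p.2) &
    x = \sum_(p <- l) p.1 * p.2.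
Proof.
split=> [[n [a [y [Ba Xy ->]]]]|[l hl ->]].
  exists [seq (a i, y i) | i <- enum 'I_n]; last by rewrite big_map big_enum.
  by move=> p /mapP[i _ ->]; split; [apply: Ba|apply: Xy].
exists (size l), (fun i => (nth (0, 0) l i).1), (fun i => (nth (0, 0) l i).2).
split; try by move=> i; have [] := hl _ (mem_nth (0, 0) (ltn_ord i)).
by rewrite (big_nth (0, 0)) big_mkord.
Qed.

Lemma lin_spanD B X x y : lin_span B X x -> lin_span B X y -> lin_span B X (x + y).
Proof.
move=> /lin_spanP[l hl ->] /lin_spanP[l' hl' ->]; apply/lin_spanP.
exists (l ++ l'); last by rewrite big_cat.
by move=> p; rewrite mem_cat => /orP[/hl|/hl'].
Qed.

Lemma lin_spanM B X b x : (forall c, B c -> B (b * c)) ->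
  lin_span B X x -> lin_span B X (b * x).
Proof.
move=> hb /lin_spanP[l hl ->]; apply/lin_spanP.
exists [seq (b * p.1, p.2) | p <- l].
  by move=> p /mapP[p' /hl[h1 h2] ->]; split=> //; apply: hb.
by rewrite big_map mulr_sumr; apply: eq_bigr => p _; rewrite mulrA.
Qed.

Lemma lin_span_gen B X b x : B b -> X x -> lin_span B X (b * x).
Proof.
move=> hb hx; apply/lin_spanP; exists [:: (b, x)]; last by rewrite big_seq1.
by move=> p; rewrite inE => /eqP ->.
Qed.

Lemma lin_span_ind B X (P : A -> Prop) :
  P 0 -> (forall x y, P x -> P y -> P (x + y)) ->
  (forall b x, B b -> X x -> P (b * x)) -> forall x, lin_span B X x -> P x.
Proof.
move=> P0 PD PM x /lin_spanP[l hl ->]; rewrite big_seq.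
by elim/big_ind: _ => // p /hl[h1 h2]; apply: PM.
Qed.

End LinearSpan.

Section IdealClass.
Variables (F : fieldType) (K : fieldExtType F).
Implicit Types (I J : set (F * K)%type).

Lemma prod_unitP (u : (F * K)%type) :
  u \is a GRing.unit <-> u.1 != 0 /\ u.2 != 0.
Proof.
by rewrite -!unitfE; split=> [/andP[]|[h1 h2]] //; apply/andP.
Qed.

Lemma ideal_class_eqP I J : ideal_class I = ideal_class J <->
  exists2 u, u \is a GRing.unit & J = [set u * x | x in I].
Proof.
split=> [h|[u uu ->]].
  have : ideal_class J J.
    exists 1; first exact: unitr1.
    by apply/seteqP; split=> [x [y Jy <-]|x Jx]; [rewrite mul1r|exists x; rewrite ?mul1r].
  by rewrite -h => -[u uu <-]; exists u.
apply/seteqP; split=> _ [w uw <-].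
  exists (w / u); first by rewrite /= unitrM uw unitrV.
  apply/seteqP; split=> [_ [_ [x Ix <-] <-]|_ [x Ix <-]].
    by exists x => //; rewrite mulrA divrK.
  by exists (u * x); [exists x|rewrite mulrA divrK].
exists (w * u); first by rewrite /= unitrM uw.
apply/seteqP; split=> [_ [x Ix <-]|_ [_ [x Ix <-] <-]].
  by exists (u * x); [exists x|rewrite mulrA].
by exists x => //; rewrite mulrA.
Qed.

End IdealClass.

(** The residue field is only a set of cosets; representatives in [F] make its cardinality the
    branching number of the tree. *)
Lemma residue_digits (F : fieldType) (v : discrete_valuation F) (q : nat) :
  (residue_field v #= `I_q)%card ->
  exists ds : seq F, [/\ size ds = q, uniq ds,
    forall d, d \in ds -> int_ring v d,
    forall a, int_ring v a -> exists2 d, d \in ds & val_ge v 1 (a - d) &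
    forall d e, d \in ds -> e \in ds -> val_ge v 1 (d - e) -> d = e].
Proof.
move=> hq; have fin : finite_set (residue_field v) by apply/finite_setP; exists q.
pose s := finmap.enum_fset (fset_set (residue_field v)).
have sP C : C \in s <-> residue_field v C.
  have := in_fset_set fin C; rewrite -[C \in s]/(C \in fset_set (residue_field v)) => ->.
  by rewrite in_setE.
have szs : size s = q by exact: card_fset_set.
have us : uniq s by exact: finmap.fset_uniq.
pose rep (C : set F) : F := xget 0 C.
have repP C : C \in s -> C (rep C) /\ int_ring v (rep C).
  move/sP => [x ix CE]; have Cx : C x by rewrite -CE; exists 0; [left|rewrite addr0].
  have Cr : C (rep C) by apply: xgetPex; exists x.
  split=> //; move: Cr; rewrite -{1}CE => -[m mm <-]; apply: val_geD => //.
  exact: val_geW mm.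
have cls C x y : C \in s -> C x -> val_ge v 1 (y - x) -> C y.
  move=> /sP[z iz CE]; rewrite -CE => -[m mm <-] h.
  by exists (m + (y - (z + m))); [apply: val_geD|rewrite addrA addrC subrK].
have clsB C x y : C \in s -> C x -> C y -> val_ge v 1 (x - y).
  move=> /sP[z iz CE]; rewrite -CE => -[m mm <-] [m' mm' <-].
  by rewrite opprD addrACA subrr add0r; apply: val_geB.
have inj C D : C \in s -> D \in s -> val_ge v 1 (rep C - rep D) -> C = D.
  move=> hC hD h; have [[rC _] [rD _]] := (repP _ hC, repP _ hD).
  apply/seteqP; split=> x hx.
    apply: (cls D (rep D)) => //; rewrite -(subrK (rep C) x) -addrA.
    by apply: val_geD => //; apply: (clsB C).
  apply: (cls C (rep C)) => //; rewrite -(subrK (rep D) x) -addrA.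
  apply: val_geD; first by apply: (clsB D).
  by rewrite -opprB; apply: val_geN.
exists [seq rep C | C <- s]; split.
- by rewrite size_map.
- rewrite map_inj_in_uniq // => C D hC hD h; apply: inj => //.
  by rewrite h subrr; left.
- by move=> _ /mapP[C hC ->]; case: (repP _ hC).
- move=> a ia; pose C := [set a + m | m in max_ideal v].
  have hC : C \in s by apply/sP; exists a.
  exists (rep C); first exact: map_f.
  apply: (clsB C) => //; last by case: (repP _ hC).
  by exists 0; [left|rewrite addr0].
- move=> _ _ /mapP[C hC ->] /mapP[D hD ->] h.
  by rewrite (inj _ _ hC hD h).
Qed.

Lemma card_set_seq (T : choiceType) (s : seq T) : uniq s -> ([set` s] #= `I_(size s))%card.
Proof.
move=> us; have -> : [set` s] = [set` [fset x in s]%fset].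
  by apply/seteqP; split=> x /=; rewrite inE.
by apply/card_eq_fsetP; rewrite card_fseq undup_id.
Qed.

(** * Orders and lattices of the quadratic extension *)

Section QuadraticOrders.
Variables (F : fieldType) (v : discrete_valuation F) (K : fieldExtType F).
Local Notation O := (int_closure v K).
Variable pi : F.
Hypothesis hpi : uniformizer v pi.
Variable t : K.
Hypothesis hB : int_basis v t.
Hypothesis ram : ramification_index1 v K.
Local Notation U := (@int_unit F v K).
Implicit Types (z u : K) (a b : F) (i j m n p : nat).

(** * Coordinates in the basis [1, t] *)

Definition coords x : F * F := xget (0, 0) [set ab : F * F | x = ab.1%:A + ab.2 *: t].
Local Notation c0 x := (coords x).1.
Local Notation c1 x := (coords x).2.

Lemma coordsE x : x = (c0 x)%:A + c1 x *: t.
Proof.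
have [a [b xE]] := hB.1 x.
have := @xgetPex _ (0, 0) [set ab : F * F | x = ab.1%:A + ab.2 *: t].
by apply; exists (a, b).
Qed.

(** Every [pi ^ (- n)] times the zero combination is integral, so both coefficients are divisible by
    all powers of [pi]. *)
Lemma int_basis_free a b : a%:A + b *: t = 0 -> a = 0 /\ b = 0.
Proof.
move=> ab0; have key n : int_ring v (pi ^ (- n%:Z) * a) /\
    int_ring v (pi ^ (- n%:Z) * b).
  apply/(hB.2); rewrite -!scalerA -scalerDr ab0 scaler0; exact: int_closure0.
have low (c : F) : (forall n, int_ring v (pi ^ (- n%:Z) * c)) -> c = 0.
  move=> h; apply/eqP; apply: contrapT => /negP cn0.
  have /(val_ge_shift hpi)/(val_geP _ _ cn0) := h `|v c|.+1%N; lia.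
by split; apply: low => n; case: (key n).
Qed.

Lemma coords_uniq a b : coords (a%:A + b *: t) = (a, b).
Proof.
set x := _ + _; have xE := coordsE x.
have /int_basis_free[/eqP + /eqP] : (a - c0 x)%:A + (b - c1 x) *: t = 0.
  by rewrite !scalerBl addrACA -opprD -xE subrr.
by rewrite !subr_eq0 => /eqP -> /eqP ->; case: (coords x).
Qed.

Lemma coords_inj x y : c0 x = c0 y -> c1 x = c1 y -> x = y.
Proof. by move=> h0 h1; rewrite (coordsE x) (coordsE y) h0 h1. Qed.

Lemma c0D x y : c0 (x + y) = c0 x + c0 y.
Proof.
by rewrite {1}(coordsE x) {1}(coordsE y) addrACA -!scalerDl coords_uniq.
Qed.

Lemma c1D x y : c1 (x + y) = c1 x + c1 y.
Proof.
by rewrite {1}(coordsE x) {1}(coordsE y) addrACA -!scalerDl coords_uniq.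
Qed.

Lemma c0Z a x : c0 (a *: x) = a * c0 x.
Proof. by rewrite {1}(coordsE x) scalerDr !scalerA coords_uniq. Qed.

Lemma c1Z a x : c1 (a *: x) = a * c1 x.
Proof. by rewrite {1}(coordsE x) scalerDr !scalerA coords_uniq. Qed.

Lemma c0A a : c0 a%:A = a.
Proof. by rewrite -[a%:A]addr0 -(scale0r t) coords_uniq. Qed.

Lemma c1A a : c1 a%:A = 0.
Proof. by rewrite -[a%:A]addr0 -(scale0r t) coords_uniq. Qed.

Lemma c0t : c0 t = 0.
Proof. by rewrite -[t]add0r -[t]scale1r -(scale0r 1) coords_uniq. Qed.

Lemma c1t : c1 t = 1.
Proof. by rewrite -[t]add0r -[t]scale1r -(scale0r 1) coords_uniq. Qed.

Lemma int_coordsP x : O x <-> int_ring v (c0 x) /\ int_ring v (c1 x).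
Proof. by rewrite {1}(coordsE x); apply: hB.2. Qed.

Lemma t_int : O t.
Proof. by apply/int_coordsP; rewrite c0t c1t; split; [left|apply: int_ring1]. Qed.

(** The order [o + pi ^ j O], in coordinates; [OrdP] is the other description. *)
Definition Ord j : set K := [set x | int_ring v (c0 x) /\ val_ge v j%:Z (c1 x)].

Lemma OrdW i j x : (i <= j)%N -> Ord j x -> Ord i x.
Proof. by move=> ij [h0 h1]; split=> //; apply: val_geW h1. Qed.

Lemma Ord0 x : Ord 0 x <-> O x.
Proof. by rewrite int_coordsP. Qed.

Lemma Ord_int j x : Ord j x -> O x.
Proof. by move/(OrdW (leq0n j))/Ord0. Qed.

Lemma OrdA j a : Ord j a%:A <-> int_ring v a.
Proof.
by split=> [[]|ia]; [rewrite c0A|split; [rewrite c0A|rewrite c1A; left]].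
Qed.

Lemma Ord1 j : Ord j 1.
Proof. by rewrite -[1]scale1r; apply/OrdA/int_ring1. Qed.

Lemma OrdZ j a x : int_ring v a -> Ord j x -> Ord j (a *: x).
Proof.
move=> ia [h0 h1]; split; first by rewrite c0Z; apply: int_ringM.
by rewrite c1Z -[j%:Z]add0r; apply: val_geM.
Qed.

Lemma OrdD j x y : Ord j x -> Ord j y -> Ord j (x + y).
Proof.
by move=> [h0 h1] [g0 g1]; split; rewrite ?c0D ?c1D; apply: val_geD.
Qed.

Lemma OrdN j x : Ord j x -> Ord j (- x).
Proof. by rewrite -scaleN1r; apply: OrdZ; apply/val_geN/int_ring1. Qed.

Lemma OrdB j x y : Ord j x -> Ord j y -> Ord j (x - y).
Proof. by move=> hx hy; apply/OrdD/OrdN. Qed.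

Lemma Ord_of_int j x : O x -> Ord j (pi ^+ j *: x).
Proof.
move=> /int_coordsP[h0 h1]; split; rewrite ?c0Z ?c1Z exprnP.
  by apply/(val_ge_shift hpi); apply: val_geW h0; lia.
by apply/(val_ge_shift hpi); rewrite subrr.
Qed.

Lemma OrdP j x :
  Ord j x <-> exists a y, [/\ int_ring v a, O y & x = a%:A + pi ^+ j *: y].
Proof.
split=> [[h0 h1]|[a [y [ia oy ->]]]]; last first.
  by apply: OrdD; [apply/OrdA|apply: Ord_of_int].
exists (c0 x), ((pi ^ (- j%:Z) * c1 x) *: t); split => //.
  rewrite -[_ *: t]add0r -(scale0r 1); apply/hB.2; split; first by left.
  by apply/(val_ge_shift hpi); rewrite opprK add0r.
by rewrite scalerA mulrA exprnP (unifzK hpi) mul1r -coordsE.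
Qed.

Lemma OrdM j x y : Ord j x -> Ord j y -> Ord j (x * y).
Proof.
move=> /OrdP[a [x' [ia ox ->]]] oy.
rewrite mulrDl mulr_algl -scalerAl; apply: OrdD; first exact: OrdZ.
by apply/Ord_of_int/int_closureM => //; apply: Ord_int oy.
Qed.


Lemma int_unitM u w : U u -> U w -> U (u * w).
Proof.
move=> [u0 ou oui] [w0 ow owi]; split; first by rewrite mulf_neq0.
  exact: int_closureM.
by rewrite invfM; apply: int_closureM.
Qed.

Lemma int_unitV u : U u -> U u^-1.
Proof. by move=> [u0 ou oui]; split; rewrite ?invr_eq0 ?invrK. Qed.

Lemma int_unit1 : U 1.
Proof. by split; rewrite ?oner_neq0 ?invr1 //; apply: int_closure1. Qed.

Lemma int_unit_coords x : O x -> U x <-> ~ (val_ge v 1 (c0 x) /\ val_ge v 1 (c1 x)).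
Proof.
move=> ox; split=> [ux|h].
  move=> h; apply: (int_unit_notin_max hpi ux); apply/int_coordsP.
  by rewrite c0Z c1Z; case: h => h0 h1; split; apply/(val_ge_shift hpi).
apply: (int_unitP hpi ram ox) => /int_coordsP[]; rewrite c0Z c1Z.
by move=> /(val_ge_shift hpi) h0 /(val_ge_shift hpi) h1; apply: h; split;
  [apply: val_geW h0|apply: val_geW h1].
Qed.

Lemma t_unit : U t.
Proof.
apply/(int_unit_coords t_int); rewrite c0t c1t => -[_].
by move/(val_geP _ _ (oner_neq0 F)); rewrite dval1.
Qed.

Lemma Ord_unit_c0 j x : U x -> Ord j.+1 x -> c0 x != 0 /\ v (c0 x) = 0.
Proof.
move=> ux [h0 h1]; apply: int_ringN1unit => // h; case: ux => x0 ox oxi.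
apply: (int_unit_coords ox).1 => //; split=> //; apply: val_geW h1; lia.
Qed.

Lemma Ord_congr j a x y : int_ring v a -> U y -> O (pi ^ (- j%:Z) *: (x - a *: y)) ->
  Ord j (x / y).
Proof.
move=> ia [y0 oy oyi] h.
have -> : x / y = a%:A + pi ^+ j *: ((pi ^ (- j%:Z) *: (x - a *: y)) / y).
  rewrite -scalerAl scalerA exprnP (unifzK hpi) scale1r mulrBl.
  by rewrite -scalerAl divff // addrC subrK.
apply: OrdD; first exact/OrdA.
by apply/Ord_of_int/int_closureM.
Qed.

(** For [j > 0] the coordinate [a = c0 u] is a unit of [o] and [u] is congruent to [a] modulo
    [pi ^ j O], so [1] is congruent to [a^-1 u] and [Ord_congr] applies. *)
Lemma OrdV j u : U u -> Ord j u -> Ord j u^-1.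
Proof.
move=> uu; case: j => [|j] hu; first by case: uu => _ _ oui; apply/Ord0.
have [a0 va] := Ord_unit_c0 uu hu; have [ia iai] := int_ring_unit a0 va.
rewrite -[u^-1]mul1r; apply: (Ord_congr iai uu).
have /OrdP[a [y [ia' oy uE]]] := hu.
have aE : c0 u = a + pi ^+ j.+1 * c0 y by rewrite uE c0D c0A c0Z.
have -> : 1 - (c0 u)^-1 *: u = (c0 u)^-1 *: ((c0 u)%:A - u).
  by rewrite scalerBr scalerA mulVf // scale1r.
have -> : (c0 u)%:A - u = pi ^+ j.+1 *: ((c0 y)%:A - y).
  by rewrite aE uE scalerDl opprD addrACA subrr add0r scalerBr scalerA.
rewrite scalerA [_ * (c0 u)^-1]mulrC -scalerA [_ *: (pi ^+ _ *: _)]scalerA.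
rewrite exprnP mulrC (unifzK hpi) scale1r.
apply: int_closureZ => //; apply: int_closureB => //.
by apply/int_closure_scalar; case/int_coordsP: oy.
Qed.

Lemma Ord_div j u w : U w -> Ord j u -> Ord j w -> Ord j (u / w).
Proof. by move=> uw hu hw; apply: OrdM => //; apply: OrdV. Qed.

(* For a unit [u], the largest [c <= j] with [u] in [Ord c]. *)
Definition level j u : nat := \sum_(c < j) `[< Ord c.+1 u >].

Lemma levelS j u : level j.+1 u = (level j u + `[< Ord j.+1 u >])%N.
Proof. exact: big_ord_recr. Qed.

Lemma level_le j u : (level j u <= j)%N.
Proof.
by elim: j => [|j IH]; rewrite ?levelS; [rewrite /level big_ord0|case: asboolP; lia].
Qed.

Lemma level_leW i j u : (i <= j)%N -> (level i u <= level j u)%N.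
Proof.
move=> ij; rewrite -(subnKC ij); elim: (j - i)%N => [|k IH]; first by rewrite addn0.
by rewrite addnS levelS; lia.
Qed.

Lemma level_full j u : O u -> (level j u == j) = `[< Ord j u >].
Proof.
move=> ou; elim: j => [|j IH].
  by rewrite /level big_ord0 eqxx; apply/esym/asboolP/Ord0.
rewrite levelS; case: (asboolP (Ord j.+1 u)) => h.
  by rewrite addn1 eqSS IH; apply/asboolP/(OrdW _ h).
by apply/negP => /eqP h2; have := level_le j u; lia.
Qed.

Lemma levelP j u c : O u -> (c <= j)%N -> Ord c u <-> (c <= level j u)%N.
Proof.
move=> ou cj; split=> [/asboolP|h].
  by rewrite -level_full // => /eqP {1}<-; apply: level_leW.
elim: j cj h => [|j IH] cj h.
  by have -> : c = 0%N; [lia|apply/Ord0].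
move: h; rewrite levelS; case: asboolP => h; first by move=> _; apply: OrdW h.
rewrite addn0 => hk; apply: IH => //; have := level_le j u; lia.
Qed.

Lemma level_congr j u w : Ord j w -> U w -> level j (u * w) = level j u.
Proof.
move=> hw uw; apply: eq_bigr => c _; congr nat_of_bool.
have {}hw : Ord c.+1 w by apply: OrdW hw.
apply: asbool_equiv_eq; split => h; last exact: OrdM.
have -> : u = u * w / w by rewrite mulfK //; case: uw.
exact: Ord_div.
Qed.

Lemma levelV j u : U u -> level j u^-1 = level j u.
Proof.
move=> uu; apply: eq_bigr => c _; congr nat_of_bool; apply: asbool_equiv_eq.
split; last exact: OrdV.
by rewrite -{2}[u]invrK; apply/OrdV/int_unitV.
Qed.

(** For [i >= 0] the factor [pi ^ i] lowers the demand on [c1] from [j] to [j - i]. For [i < 0] the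
    product is not integral, and the inequality fails because levels are at most [j]. *)
Lemma Ord_shift j (i : int) u : U u ->
  Ord j (pi ^ i *: u) <-> j%:Z <= i + (level j u)%:Z.
Proof.
move=> uu; have [u0 ou oui] := uu; have kj := level_le j u.
have [i0|i0] := ltP i 0.
  split; last lia.
  move/Ord_int => h; case: (int_unit_notin_max hpi uu).
  have -> : -1 = (-1 - i) + i by lia.
  by rewrite (unifzD hpi) -scalerA; apply: int_closureZz => //; lia.
have -> : Ord j (pi ^ i *: u) <-> Ord (j - `|i|)%N u.
  rewrite /Ord /= c0Z c1Z; split=> -[h0 h1].
    move/(val_ge_shift hpi): h1 => h1; split; first by case/int_coordsP: ou.
    have [ji|ij] := leqP j `|i|%N; last by apply: val_geW h1; lia.
    have -> : (j - `|i|)%N = 0%N by lia.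
    by case/int_coordsP: ou.
  by split; apply/(val_ge_shift hpi); [apply: val_geW h0|apply: val_geW h1]; lia.
by rewrite (@levelP j) ?leq_subr //; split; lia.
Qed.


Lemma Ord_inclP i j : (forall x, Ord j x -> Ord i x) -> (i <= j)%N.
Proof.
move=> h; have [_] : Ord i (pi ^+ j *: t).
  exact/h/Ord_of_int/t_int.
rewrite c1Z c1t mulr1 exprnP => /(val_geP _ _ (unifz_neq0 hpi _)).
by rewrite (dval_unifz hpi).
Qed.

(** The dual of [Ord p] with respect to [Ord m] is [pi ^ (m - p) Ord p]: testing [1] gives
    [x = a + pi ^ m y], and testing [pi ^ p t] gives [v a >= m - p] unless [a = 0]. *)
Lemma Ord_colon p m x : (p <= m)%N ->
  (forall y, Ord p y -> Ord m (x * y)) <-> Ord p (pi ^ (p%:Z - m%:Z) *: x).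
Proof.
move=> pm; split=> [h|hx y hy]; last first.
  have [h0 h1] := OrdM hx hy.
  have -> : x * y = pi ^ (m%:Z - p%:Z) *: ((pi ^ (p%:Z - m%:Z) *: x) * y).
    rewrite -scalerAl scalerA -(unifzD hpi) addrA subrK subrr expr0z.
    by rewrite scale1r.
  split; rewrite ?c0Z ?c1Z; apply/(val_ge_shift hpi).
    by apply: val_geW h0; lia.
  by apply: val_geW h1; lia.
have hx : Ord m x by rewrite -[x]mulr1; apply/h/Ord1.
have ot := t_int.
have ht := h _ (Ord_of_int p ot).
have /OrdP[a [y [ia oy xE]]] := hx.
have : Ord m (x * (pi ^+ p *: t) - pi ^+ m *: (y * (pi ^+ p *: t))).
  apply: OrdB => //; apply/Ord_of_int/int_closureM => //.
  by rewrite exprnP; apply: int_closureZz.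
rewrite {1}xE mulrDl mulr_algl -scalerAl addrK scalerA => -[_].
rewrite c1Z c1t mulr1 mulrC exprnP => /(val_ge_shift hpi) ha.
split; rewrite ?c0Z ?c1Z; apply/(val_ge_shift hpi); last first.
  by case: hx => _; apply: val_geW; lia.
rewrite xE c0D c0A c0Z exprnP; apply: val_geD; first by apply: val_geW ha; lia.
apply/(val_ge_shift hpi); case/int_coordsP: oy => h0 _; apply: val_geW h0; lia.
Qed.

(** * Lattices and their multiplier rings *)

Definition lat z j : set K := [set x | Ord j (z^-1 * x)].

Lemma lat_gen z j : z != 0 -> lat z j z.
Proof. by move=> z0; rewrite /lat /= mulVf //; apply: Ord1. Qed.

Lemma lat_mulP z j (a : K) : z != 0 ->
  (forall x, lat z j x -> lat z j (a * x)) <-> Ord j a.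
Proof.
move=> z0; split=> [h|ha x hx].
  by have := h _ (lat_gen j z0); rewrite /lat /= mulrCA mulVf // mulr1.
by rewrite /lat /= mulrCA; apply: OrdM.
Qed.

Lemma lat_eqP z z' i j : z != 0 -> z' != 0 ->
  lat z i = lat z' j <-> [/\ i = j, U (z' / z) & Ord j (z' / z)].
Proof.
move=> z0 z0'; split=> [h|[-> uz oz]]; last first.
  apply/seteqP; split=> x; rewrite /lat /= => hx.
    have -> : z'^-1 * x = (z' / z)^-1 * (z^-1 * x).
      by rewrite invf_div [z / _]mulrC -mulrA mulVKf.
    by apply: OrdM => //; apply: OrdV.
  have -> : z^-1 * x = (z' / z) * (z'^-1 * x).
    by rewrite [z' / _]mulrC -mulrA mulVKf.
  exact: OrdM.
have ij : i = j.
  apply/eqP; rewrite eqn_leq; apply/andP; split; apply: Ord_inclP => x.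
    by move/(lat_mulP j x z0').2 => hx; apply/(lat_mulP i x z0); rewrite h.
  by move/(lat_mulP i x z0).2 => hx; apply/(lat_mulP j x z0'); rewrite -h.
have h1 : Ord j (z' / z).
  by have := lat_gen j z0'; rewrite -h ij /lat /= mulrC.
have h2 : Ord j (z / z').
  by have := lat_gen i z0; rewrite h /lat /= mulrC.
split=> //; split; rewrite ?mulf_neq0 ?invr_eq0 //; first exact: Ord_int h1.
by rewrite invf_div; apply: Ord_int h2.
Qed.

Lemma scaler_inv a (x : K) : (a *: x)^-1 = a^-1 *: x^-1.
Proof.
by rewrite -mulr_algl invfM -[a%:A]/(in_alg K a) -fmorphV /= mulr_algl.
Qed.

Lemma scale_unifz_pred (i : int) (x : K) : pi *: (pi ^ (i - 1) *: x) = pi ^ i *: x.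
Proof.
rewrite scalerA -{1}[pi]expr1z; congr (_ *: _).
by rewrite -[LHS](unifzD hpi) addrC subrK.
Qed.

Lemma int_unifz (i : int) u : U u -> O (pi ^ i *: u) <-> 0 <= i.
Proof.
move=> uu; have [_ ou _] := uu; split=> [h|]; last by move=> h; apply: int_closureZz.
rewrite leNgt; apply/negP => i0; case: (int_unit_notin_max hpi uu).
have -> : -1 = (-1 - i) + i by lia.
by rewrite (unifzD hpi) -scalerA; apply: int_closureZz => //; lia.
Qed.

Lemma int_div (i j : int) u w : U u -> U w ->
  O ((pi ^ i *: u)^-1 * (pi ^ j *: w)) <-> i <= j.
Proof.
move=> uu uw; rewrite scaler_inv -scalerAl -scalerAr scalerA invr_expz.
rewrite -(unifzD hpi) int_unifz; first by split; lia.
exact/int_unitM/uw/int_unitV.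
Qed.

(** For [z] of least valuation in [L], the module [z^-1 L] lies between [o] and [O]; it is
    [o + pi ^ j o t] for the least [j] with [pi ^ j t] in it, and this is [Ord j]. *)
Lemma lattice_principal (L : set K) (A B : int) :
  (forall x y, L x -> L y -> L (x + y)) ->
  (forall a x, int_ring v a -> L x -> L (a *: x)) ->
  (forall x, O x -> L (pi ^ A *: x)) ->
  (forall x, L x -> O (pi ^ B *: x)) ->
  exists z j, z != 0 /\ L = lat z j.
Proof.
move=> LD LZ LA LB.
have LB0 x : L x -> L (- x).
  by move=> Lx; rewrite -scaleN1r; apply: LZ => //; apply/val_geN/int_ring1.
have [z [z0 Lz zmin]] : exists z, [/\ z != 0, L z & forall x, L x -> O (z^-1 * x)].
  (* Descent on the exponent of [pi], which cannot fall below [- B]. *)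
  have key k : forall (i : int) u, U u -> L (pi ^ i *: u) -> i + B < k%:Z ->
      exists z, [/\ z != 0, L z & forall x, L x -> O (z^-1 * x)].
    elim: k => [|k IH] i u uu Lz ik.
      by have := LB _ Lz; rewrite scalerA -(unifzD hpi) int_unifz //; lia.
    have z0 : pi ^ i *: u != 0.
      by rewrite scaler_eq0 negb_or (unifz_neq0 hpi); case: uu.
    case: (pselect (forall x, L x -> O ((pi ^ i *: u)^-1 * x))) => [h|].
      by exists (pi ^ i *: u).
    move/existsNP => [x /not_implyP[Lx nx]].
    have x0 : x != 0.
      by apply: contra_not_neq nx => ->; rewrite mulr0; apply: int_closure0.
    have [i' [u' [uu' xE]]] := int_unit_decomp hpi ram x0.
    move: nx Lx; rewrite xE int_div // => nx Lx.
    by apply: (IH i' u') => //; lia.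
  apply: (key (`|A| + `|B|).+1%N A 1) => //; last by lia.
    exact: int_unit1.
  exact/LA/int_closure1.
pose P j := `[< L (z * (pi ^+ j *: t)) >].
have ot := t_int.
have exP : exists j, P j.
  (* [pi ^ N] makes [z t] integral, and [|A|] further factors bring it into [pi ^ A O], which [L]
     contains. *)
  have [N oN] := int_closure_denom hpi (z * t); exists (N + `|A|)%N; apply/asboolP.
  have -> : z * (pi ^+ (N + `|A|) *: t) =
      pi ^ A *: (pi ^ (`|A|%N%:Z - A) *: (pi ^+ N *: (z * t))).
    by rewrite -scalerAr !scalerA !exprnP -!(unifzD hpi); congr (pi ^ _ *: _); lia.
  by apply/LA/int_closureZz => //; lia.
case: (ex_minnP exP) => j /asboolP Lj jmin.
exists z, j; split=> //; apply/seteqP; split=> x; last first.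
  rewrite /lat /= => -[h0 h1].
  have -> : x = c0 (z^-1 * x) *: z +
      (pi ^ (- j%:Z) * c1 (z^-1 * x)) *: (z * (pi ^+ j *: t)).
    have {1}-> : x = z * ((c0 (z^-1 * x))%:A + c1 (z^-1 * x) *: t).
      by rewrite -coordsE mulVKf.
    rewrite mulrDr -!scalerAr mulr1 scalerA mulrAC exprnP [_ * pi ^ _]mulrC.
    by rewrite (unifzK hpi) mul1r.
  apply: LD; apply: LZ => //.
  by apply/(val_ge_shift hpi); rewrite sub0r opprK.
move=> Lx; have ox := zmin _ Lx; have /int_coordsP[h0 h1] := ox.
split=> //; set c := c1 (z^-1 * x).
have [->|cn0] := eqVneq c 0; first by left.
right; have vc : 0 <= v c by move/(val_geP _ _ cn0): h1.
suff : (j <= `|v c|)%N by lia.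
apply: jmin; apply/asboolP.
have -> : z * (pi ^+ `|v c| *: t) = (pi ^+ `|v c| / c) *: (x - c0 (z^-1 * x) *: z).
  have {1}-> : x = z * ((c0 (z^-1 * x))%:A + c *: t) by rewrite -coordsE mulVKf.
  rewrite mulrDr -!scalerAr mulr1 addrAC subrr add0r scalerA.
  by rewrite divfK.
have Lm : L (x - c0 (z^-1 * x) *: z) by apply: LD => //; apply/LB0/LZ.
case: (int_ring_unit (v := v) (x := pi ^+ `|v c| / c)) => [||h _].
- by rewrite mulf_neq0 ?invr_eq0 // exprnP (unifz_neq0 hpi).
- rewrite dvalM ?invr_eq0 ?exprnP ?(unifz_neq0 hpi) //.
  by rewrite (dval_unifz hpi) dvalV //; lia.
exact: LZ.
Qed.



(** * Modules generated by [1] and one more element *)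

Definition cspan m (s : K) : set K :=
  [set x | exists a b : K, [/\ Ord m a, Ord m b & x = a + b * s]].

Lemma Ord_0 j : Ord j 0.
Proof. by rewrite -(scale0r 1); apply/OrdA; left. Qed.

Lemma cspan1 m s : cspan m s 1.
Proof.
by exists 1, 0; split; [apply: Ord1|apply: Ord_0|rewrite mul0r addr0].
Qed.

Lemma cspan_self m s : cspan m s s.
Proof.
by exists 0, 1; split; [apply: Ord_0|apply: Ord1|rewrite mul1r add0r].
Qed.

Lemma cspan_mul m s (a x : K) : Ord m a -> cspan m s x -> cspan m s (a * x).
Proof.
move=> ha [b [c [hb hc ->]]]; exists (a * b), (a * c).
by split; rewrite ?mulrDr ?mulrA //; apply: OrdM.
Qed.

Lemma cspan_add m s x y : cspan m s x -> cspan m s y -> cspan m s (x + y).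
Proof.
move=> [b [c [hb hc ->]]] [b' [c' [hb' hc' ->]]]; exists (b + b'), (c + c').
by split; [exact: OrdD|exact: OrdD|rewrite mulrDl addrACA].
Qed.

Lemma cspan_sub m s (s' : K) : cspan m s s' -> cspan m s' `<=` cspan m s.
Proof.
move=> hs x [a [b [ha hb ->]]]; apply: cspan_add; last exact: cspan_mul.
by rewrite -[a]mulr1; apply: cspan_mul => //; apply: cspan1.
Qed.

Lemma int_unit_1B x : O x -> ~ U x -> U (1 - x).
Proof.
move=> ox nx; apply: (int_unitP hpi ram).
  by apply: int_closureB => //; apply: int_closure1.
move=> h; have hx : O (pi ^ (-1) *: x).
  by apply: contrapT => hx; apply: nx; apply: (int_unitP hpi ram).
apply: (int_unit_notin_max hpi int_unit1).
by rewrite -(subrK x 1) scalerDr; apply: int_closureD.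
Qed.

(** Write [s = a' + b' s'] and [s' = a + b s]. If [b] or [b'] is a unit, it provides [u]. Otherwise
    [1 - b' b] is a unit, and solving the two relations puts [s] and [s'] in [Ord m], where [u = 1]
    serves. *)
Lemma cspan_eqP m (s s' : K) :
  cspan m s = cspan m s' <-> exists u, [/\ U u, Ord m u & Ord m (s' - u * s)].
Proof.
split=> [h|[u [uu hu hs]]]; last first.
  have u0 : u != 0 by case: uu.
  apply/seteqP; split; apply: cspan_sub.
    exists (- (u^-1 * (s' - u * s))), u^-1; split.
    - by apply/OrdN/OrdM => //; apply: OrdV.
    - exact: OrdV.
    by rewrite mulrBr opprB mulKf // subrK.
  by exists (s' - u * s), u; split; rewrite ?subrK.
have := cspan_self m s; rewrite h => -[a' [b' [ha' hb' sE]]].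
have := cspan_self m s'; rewrite -h => -[a [b [ha hb sE']]].
have [ub|nb] := pselect (U b).
  by exists b; split; rewrite // sE' addrK.
have [ub|nb'] := pselect (U b').
  have b0 : b' != 0 by case: ub.
  exists b'^-1; split; [exact: int_unitV|exact: OrdV|].
  have -> : s' - b'^-1 * s = - (b'^-1 * a').
    by rewrite {1}sE mulrDr mulKf // opprD addrCA subrr addr0.
  by apply/OrdN/OrdM => //; apply: OrdV.
have ubb : U (1 - b' * b).
  apply: int_unit_1B; first by apply: int_closureM; [exact: Ord_int hb'|exact: Ord_int hb].
  move=> [h0 h1 h2]; apply: nb; split.
  - by apply: contraNneq h0 => ->; rewrite mulr0.
  - exact: Ord_int hb.
  have -> : b^-1 = b' * (b' * b)^-1.
    by rewrite invfM mulVKf //; apply: contraNneq h0 => ->; rewrite mul0r.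
  by apply: int_closureM => //; apply: Ord_int hb'.
have hs : Ord m s.
  have -> : s = (1 - b' * b)^-1 * (a' + b' * a).
    have -> : a' + b' * a = (1 - b' * b) * s.
      by rewrite mulrBl mul1r -mulrA {1}sE sE' mulrDr addrA addrK.
    by rewrite mulKf //; case: ubb.
  apply: OrdM; first apply: OrdV => //; last by apply: OrdD => //; apply: OrdM.
  by apply: OrdB; [apply: Ord1|apply: OrdM].
exists 1; split; [exact: int_unit1|exact: Ord1|].
by rewrite mul1r; apply: OrdB => //; rewrite sE'; apply: OrdD; [|apply: OrdM].
Qed.

Lemma cspan_lat m s : exists z j, [/\ z != 0, (j <= m)%N & cspan m s = lat z j].
Proof.
have [N oN] := int_closure_denom hpi s.
have [|a x ia gx|x ox|x [a [b [ha hb ->]]]|z [j [z0 E]]] :=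
    @lattice_principal (cspan m s) m%:Z N%:Z.
- exact: cspan_add.
- by rewrite -mulr_algl; apply: cspan_mul => //; apply/OrdA.
- rewrite -[_ *: x]mulr1; apply: cspan_mul; last exact: cspan1.
  by rewrite -exprnP; apply: Ord_of_int.
- rewrite -exprnP scalerDr; apply: int_closureD.
    by rewrite exprnP; apply: int_closureZz => //; apply: Ord_int ha.
  by rewrite scalerAr; apply: int_closureM => //; apply: Ord_int hb.
exists z, j; split=> //; apply: Ord_inclP => x hx; apply/(lat_mulP j x z0).
by move=> y; rewrite -E; apply: cspan_mul.
Qed.

(** Describes when [lat z j] is generated over [Ord m] by [1] and another element. For [j < m] the
    maximal ideal of [Ord m] maps the lattice into [pi] times itself, so two generators are needed,
    and [1] may be one exactly when it is outside [pi] times the lattice. *)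
Definition cyclic_type m z j : Prop :=
  [/\ (j <= m)%N, Ord j z^-1 & (j < m)%N -> ~ Ord j (pi ^ (-1) *: z^-1)].

Lemma val_ge_pi_unit (a b : F) : int_ring v a -> val_ge v 1 b -> ~ val_ge v 1 (1 - a * b).
Proof.
move=> ia ib h; have : val_ge v 1 1.
  rewrite -(subrK (a * b) 1); apply: val_geD => //.
  exact: (@val_geM _ v 0 1).
by move/(val_geP _ _ (oner_neq0 F)); rewrite dval1.
Qed.

Lemma cspan_cyclic_type m s z j : z != 0 -> (j <= m)%N -> cspan m s = lat z j -> cyclic_type m z j.
Proof.
move=> z0 jm E; split=> //.
  by have := cspan1 m s; rewrite E /lat /= mulr1.
move=> ltjm h1; have mul_lat x y : Ord j x -> lat z j y -> lat z j (x * y).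
  by move=> hx; apply: (lat_mulP j x z0).2.
have ot := t_int.
(* Modulo pi the lattice would be generated by [s] alone. *)
have gens x : lat z j x -> exists a y,
    [/\ int_ring v a, lat z j y & x = pi *: y + a *: s].
  rewrite -{1}E => -[b [c [hb hc ->]]].
  have /OrdP[a [y [ia oy cE]]] := hc.
  have l1 : lat z j (pi ^ (-1) *: b).
    rewrite /lat /= -scalerAr mulrC scalerAr; apply: OrdM => //.
    exact: OrdW hb.
  have l2 : lat z j (pi ^ (m%:Z - 1) *: (y * s)).
    rewrite scalerAl; apply: mul_lat; last by rewrite -E; apply: cspan_self.
    apply: (@OrdW j m.-1); first by lia.
    have -> : m%:Z - 1 = m.-1%:Z by lia.
    by rewrite -exprnP; apply: Ord_of_int.
  exists a, (pi ^ (-1) *: b + pi ^ (m%:Z - 1) *: (y * s)); split=> //.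
    by rewrite /lat /= mulrDr; apply: OrdD.
  rewrite cE mulrDl mulr_algl scalerDr scale_unifz_pred -[-1]sub0r scale_unifz_pred.
  by rewrite expr0z scale1r exprnP scalerAl -addrA; congr (_ + _); rewrite addrC.
have lz : lat z j z by apply: lat_gen.
have lt : lat z j (z * (pi ^+ j *: t)).
  by rewrite mulrC; apply: mul_lat => //; apply: Ord_of_int.
have [a [x [ia lx zE]]] := gens _ lz.
have [b [y [ib ly tE]]] := gens _ lt.
set s' := z^-1 * s.
have ls : lat z j s by rewrite -E; apply: cspan_self.
have e1 : 1 = pi *: (z^-1 * x) + a *: s'.
  by rewrite scalerAr /s' scalerAr -mulrDr -zE mulVf.
have e2 : pi ^+ j *: t = pi *: (z^-1 * y) + b *: s'.
  by rewrite scalerAr /s' scalerAr -mulrDr -tE mulKf.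
have val_pi (c : F) (k : int) : val_ge v k c -> val_ge v (1 + k) (pi * c).
  by apply: val_geM; right; case: hpi => _ ->.
have f1 : 1 = pi * c0 (z^-1 * x) + a * c0 s'.
  by rewrite -{1}(c0A 1) scale1r e1 c0D !c0Z.
have f2 : 0 = pi * c1 (z^-1 * x) + a * c1 s'.
  by rewrite -{1}(c1A 1) scale1r e1 c1D !c1Z.
have f3 : pi ^+ j = pi * c1 (z^-1 * y) + b * c1 s'.
  by rewrite -[LHS]mulr1 -c1t -c1Z e2 c1D !c1Z.
have [xa xb] := lx; have [ya yb] := ly; have [sa sb] := ls.
(* The relation for [1] makes [a] a unit, hence [c1 s'] divisible by [pi ^ (j + 1)]; the relation
   for [pi ^ j t] then makes [pi ^ j] divisible by it too. *)
have va : a != 0 /\ v a = 0.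
  apply: int_ringN1unit => // a1.
  apply: (@val_ge_pi_unit (c0 s') a) => //.
  have -> : 1 - c0 s' * a = pi * c0 (z^-1 * x) by rewrite {1}f1 [a * _]mulrC addrK.
  by rewrite -[1]addr0; apply: val_pi.
have [a0 v0] := va; have [_ iai] := int_ring_unit a0 v0.
have s1 : val_ge v (1 + j%:Z) (c1 s').
  have -> : c1 s' = - (a^-1 * (pi * c1 (z^-1 * x))).
    by apply/eqP; rewrite -addr_eq0 -(mulrI_eq0 _ (mulfI a0)) mulrDr mulVKf // addrC -f2.
  by apply/val_geN; rewrite -[1 + _]add0r; apply: val_geM => //; apply: val_pi.
have : val_ge v (1 + j%:Z) (pi ^+ j).
  rewrite f3; apply: val_geD; first exact: val_pi.
  by rewrite -[1 + _]add0r; apply: val_geM.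
rewrite exprnP => /(val_geP _ _ (unifz_neq0 hpi _)); rewrite (dval_unifz hpi); lia.
Qed.

(** For [j = m] the generator [z] serves as [s]. For [j < m], [1] can replace one element of the
    [o]-basis [z], [z pi ^ j t], according to whether [c0 z^-1] is a unit, and [s] is the element
    kept. *)
Lemma cyclic_type_cspan m z j : z != 0 -> cyclic_type m z j -> exists s, cspan m s = lat z j.
Proof.
move=> z0 [jm hz nz].
have l1 : lat z j 1 by rewrite /lat /= mulr1.
have mul_lat x y : Ord m x -> lat z j y -> lat z j (x * y).
  by move=> hx; apply: (lat_mulP j x z0).2; apply: OrdW hx.
have key s : lat z j s -> (forall x, lat z j x -> cspan m s x) -> cspan m s = lat z j.
  move=> ls h; apply/seteqP; split=> x; last exact: h.
  move=> [a [b [ha hb ->]]]; rewrite /lat /= mulrDr; apply: OrdD.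
    by rewrite -[a]mulr1; apply: mul_lat.
  exact: mul_lat.
have [ejm|ltjm] := eqVneq j m.
  exists z; apply: key; first exact: lat_gen.
  move=> x hx; exists 0, (z^-1 * x); split; [exact: Ord_0|by rewrite -ejm|].
  by rewrite add0r mulrC mulVKf.
have {nz ltjm} nz : ~ Ord j (pi ^ (-1) *: z^-1) by apply: nz; rewrite ltn_neqAle ltjm.
have ot := t_int.
have [za zb] := hz.
have [na|/not_val_ge[a0 va]] := pselect (val_ge v 1 (c0 z^-1)).
  have b0 : c1 z^-1 != 0.
    apply/eqP => b0; apply: nz; split; rewrite ?c0Z ?c1Z.
      by apply/(val_ge_shift hpi).
    by rewrite b0 mulr0; left.
  have vb : v (c1 z^-1) = j%:Z.
    move/(val_geP _ _ b0): zb => zb; apply/eqP; rewrite eq_le zb andbT leNgt.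
    apply/negP => h; apply: nz; split; rewrite ?c0Z ?c1Z.
      by apply/(val_ge_shift hpi).
    by apply/(val_ge_shift hpi); right; lia.
  exists z; apply: key; first exact: lat_gen.
  move=> x [h0 h1]; set y := z^-1 * x in h0 h1.
  have yE : y = (c1 y / c1 z^-1) *: z^-1 + (c0 y - c1 y / c1 z^-1 * c0 z^-1)%:A.
    apply: coords_inj; rewrite ?c0D ?c1D ?c0A ?c1A ?c0Z ?c1Z.
      by rewrite addrC subrK.
    by rewrite divfK // addr0.
  have -> : x = (c1 y / c1 z^-1)%:A + (c0 y - c1 y / c1 z^-1 * c0 z^-1)%:A * z.
    rewrite -[LHS](mulVKf z0) -/y {1}yE mulrDr -scalerAr divff //.
    by rewrite [z * _]mulrC.
  have ib : int_ring v (c1 y / c1 z^-1).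
    rewrite /int_ring -[0](subrr j%:Z); apply: val_geM => //.
    by right; rewrite dvalV // vb.
  do 2!eexists; split; last reflexivity; apply/OrdA => //.
  by apply: val_geB => //; apply: int_ringM => //; apply: val_geW na.
have {}va : v (c0 z^-1) = 0 by move/(val_geP _ _ a0): za; lia.
have [_ iai] := int_ring_unit a0 va.
exists (z * (pi ^+ j *: t)); apply: key.
  by rewrite /lat /= mulKf //; apply: Ord_of_int.
move=> x [h0 h1]; set y := z^-1 * x in h0 h1.
set a := c0 y / c0 z^-1.
have ia : int_ring v a by apply: int_ringM.
have yE : y = a *: z^-1 + (pi ^ (- j%:Z) * (c1 y - a * c1 z^-1)) *: (pi ^+ j *: t).
  apply: coords_inj; rewrite ?c0D ?c1D ?c0Z ?c1Z ?c0t ?c1t.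
    by rewrite !mulr0 addr0 /a divfK.
  rewrite mulr1 [X in _ + X]mulrC mulrA exprnP (unifzK hpi) mul1r.
  by rewrite addrC subrK.
have -> : x = a%:A + (pi ^ (- j%:Z) * (c1 y - a * c1 z^-1))%:A * (z * (pi ^+ j *: t)).
  rewrite -[LHS](mulVKf z0) -/y {1}yE mulrDr -scalerAr divff //.
  by rewrite mulr_algl scalerAr.
do 2!eexists; split; last reflexivity; apply/OrdA => //.
apply/(val_ge_shift hpi); rewrite sub0r opprK; apply: val_geB => //.
by rewrite -[j%:Z]add0r; apply: val_geM.
Qed.

(** [Ord n] and [Ord j] together generate [Ord p] for [p = minn j n]; then [Ord_colon] and
    [Ord_shift] turn the inclusion into an inequality, with [w / u] replaced by its inverse, of the
    same level. *)
Lemma lat_colon (m n j : nat) (d i : int) w u : U w -> U u -> (j <= m)%N ->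
  (forall x y, Ord n y -> lat (pi ^ i *: u)^-1 j x ->
     Ord m ((pi ^ d *: w) * y * x)) <->
  m%:Z + i <= d + (level (minn j n) (u / w))%:Z.
Proof.
move=> uw uu jm; set p := minn j n; set z := (pi ^ i *: u)^-1.
have pm : (p <= m)%N by rewrite /p; lia.
have z0 : z != 0.
  by rewrite invr_eq0 scaler_eq0 negb_or (unifz_neq0 hpi); case: uu.
have uwu : U (w / u) by apply/int_unitM/int_unitV.
have wzE : (pi ^ d *: w) * z = pi ^ (d - i) *: (w / u).
  by rewrite /z scaler_inv -scalerAl -scalerAr scalerA invr_expz -(unifzD hpi).
rewrite -(levelV _ (int_unitM uu (int_unitV uw))) invf_div.
transitivity (forall y, Ord p y -> Ord m ((pi ^ d *: w) * z * y)); last first.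
  rewrite (Ord_colon _ pm) wzE scalerA -(unifzD hpi) Ord_shift //.
  by move: (level _ _) => k; split; lia.
split=> h.
  move=> y hy; have [jn|nj] := leqP j n.
    rewrite -mulrA -[_ *: w]mulr1; apply: h; first exact: Ord1.
    by rewrite /lat /= mulKf //; move: hy; rewrite /p (minn_idPl jn).
  rewrite mulrAC; apply: h; last exact: lat_gen.
  by move: hy; rewrite /p (minn_idPr (ltnW nj)).
move=> x y hy hx.
have -> : (pi ^ d *: w) * y * x = (pi ^ d *: w) * z * (y * (z^-1 * x)).
  by rewrite -mulrA -[RHS]mulrA; congr (_ * _); rewrite mulrCA mulVKf.
by apply/h/OrdM; [apply: OrdW hy|apply: OrdW hx]; rewrite /p; lia.
Qed.

Local Notation E := (F * K)%type.

(** * Ideals of the cubic algebra *)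

Lemma pair0M (k : K) (x : E) : ((0, k) : E) * x = (0, k * x.2).
Proof. by congr (_, _); rewrite /= mul0r. Qed.

Lemma pair0D (k l : K) : ((0, k) : E) + (0, l) = (0, k + l).
Proof. by congr (_, _); rewrite /= addr0. Qed.

Lemma seq_bounded (gs : seq E) : exists B : nat, forall x, x \in gs ->
  val_ge v (- B%:Z) x.1 /\ O (pi ^ B%:Z *: x.2).
Proof.
elim: gs => [|g gs [B hgs]]; first by exists 0%N.
have [N oN] := int_closure_denom hpi g.2.
have [M gM] : exists M : nat, val_ge v (- M%:Z) g.1.
  by exists `|v g.1|%N; right; lia.
exists (B + N + M)%N => x; rewrite inE => /orP[/eqP ->|/hgs[h0 h1]].
  split; first by apply: val_geW gM; lia.
  have -> : (B + N + M)%N%:Z = (B + M)%N%:Z + N%:Z by lia.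
  by rewrite (unifzD hpi) -scalerA; apply: int_closureZz.
split; first by apply: val_geW h0; lia.
have -> : (B + N + M)%N%:Z = (N + M)%N%:Z + B%:Z by lia.
by rewrite (unifzD hpi) -scalerA; apply: int_closureZz.
Qed.

Definition std_ideal m (s : K) : set E :=
  [set x | int_ring v x.1 /\ Ord m (x.2 - x.1 *: s)].

Lemma std_ideal_snd m s y : std_ideal m s (0, y) <-> Ord m y.
Proof.
rewrite /std_ideal /= scale0r subr0; split=> [[]|h] //; split=> //; by left.
Qed.

Lemma std_idealD m s x y : std_ideal m s x -> std_ideal m s y -> std_ideal m s (x + y).
Proof.
move=> [h0 h1] [g0 g1]; split; first exact: val_geD.
by rewrite /= scalerDl opprD addrACA; apply: OrdD.
Qed.

(** A unit [(a, b)] matching two such ideals matches their parts with first coordinate [0], so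
    [m = m'] and [b] is a unit of [Ord m], and their projections to [F], so [a] is a unit of [o];
    then [b / a] is the [u] of [cspan_eqP]. *)
Lemma ideal_class_std_eqP m m' s s' :
  ideal_class (std_ideal m s) = ideal_class (std_ideal m' s') <->
  m = m' /\ cspan m s = cspan m' s'.
Proof.
rewrite ideal_class_eqP; split=> [[u /prod_unitP[a0 b0] E]|[<- /cspan_eqP[u [uu hu hs]]]];
    last first.
  have u0 : u != 0 by case: uu.
  exists (1, u); first by apply/prod_unitP; rewrite oner_neq0.
  have key x : int_ring v x.1 -> Ord m (x.2 - x.1 *: s) <-> Ord m (u * x.2 - x.1 *: s').
    move=> ix; have hx : Ord m (x.1 *: (s' - u * s)) by apply: OrdZ.
    split=> h.
      have -> : u * x.2 - x.1 *: s' = u * (x.2 - x.1 *: s) - x.1 *: (s' - u * s).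
        by rewrite mulrBr scalerBr -scalerAr opprB addrA subrK.
      by apply: OrdB => //; apply: OrdM.
    have -> : x.2 - x.1 *: s = u^-1 * (u * x.2 - x.1 *: s' + x.1 *: (s' - u * s)).
      rewrite scalerBr addrA subrK mulrBr mulKf // [u * s]mulrC -scalerAr.
      by rewrite mulrA mulrAC mulVf // mul1r.
    by apply: OrdM; [apply: OrdV|apply: OrdD].
  apply/seteqP; split=> [x [ix hx]|_ [x [ix hx] <-]].
    exists (x.1, u^-1 * x.2).
      split=> //=; apply: (key (x.1, u^-1 * x.2) ix).2.
      by rewrite /= mulVKf.
    by case: x {ix hx} => x1 x2; congr (_, _); rewrite /= ?mul1r ?mulVKf.
  by split; rewrite /= mul1r //; apply: (key x ix).1.
case: u a0 b0 E => a b /= a0 b0 E.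
have lift y : std_ideal m' s' y <-> std_ideal m s (a^-1 * y.1, b^-1 * y.2).
  rewrite E; split=> [[x hx <-]|h].
    by rewrite /= !mulKf //; case: x hx.
  exists (a^-1 * y.1, b^-1 * y.2) => //; case: y {h} => y1 y2.
  by congr (_, _); rewrite /= mulVKf.
have latE : lat 1 m' = lat b m.
  apply/seteqP; split=> y; rewrite /lat /= invr1 mul1r.
    by move/(std_ideal_snd m' s')/lift; rewrite /= mulr0 => /std_ideal_snd.
  move=> h; apply/(std_ideal_snd m' s')/lift; rewrite /= mulr0.
  exact/std_ideal_snd.
have [mm ub hb] := (lat_eqP m' m (oner_neq0 _) b0).1 latE.
rewrite divr1 in ub hb; subst m'; split=> //; apply/cspan_eqP.
have id_s n y : std_ideal n y (1, y).
  by split; [apply: int_ring1|rewrite /= scale1r subrr; apply: Ord_0].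
have [/= iai hs] := (lift _).1 (id_s m s').
have ia : int_ring v a.
  have : std_ideal m s' (a * 1, b * s) by rewrite E; exists (1, s).
  by case=> /=; rewrite mulr1.
rewrite mulr1 in iai hs.
have ua : U (a^-1)%:A.
  split; [by rewrite scaler_eq0 negb_or invr_eq0 a0 oner_neq0| |].
    exact/int_closure_scalar.
  have -> : ((a^-1)%:A)^-1 = a%:A :> K by rewrite scaler_inv invrK invr1.
  exact/int_closure_scalar.
exists (a^-1 *: b); split.
- by rewrite -mulr_algl; apply: int_unitM.
- exact: OrdZ.
have -> : s' - (a^-1 *: b) * s = b * (b^-1 * s' - a^-1 *: s).
  by rewrite mulrBr mulVKf // -scalerAl -scalerAr.
exact: OrdM.
Qed.

Section OrderIdeals.
Variables (R : set E) (z : K) (n : nat).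
Hypothesis z0 : z != 0.
Hypothesis RE : forall x, R x <-> int_ring v x.1 /\ lat z n (x.2 - (x.1)%:A).
Hypothesis RM : forall x y, R x -> R y -> R (x * y).
Hypothesis R_max : R `<=` @max_order F v K.

(** Stability of [std_ideal m s] under the elements [(0, z y)] of [R]. Testing all of [cspan m s]
    costs nothing, since [Ord m] absorbs its own multiples. *)
Definition compatible m (s : K) : Prop :=
  forall x y, Ord n y -> cspan m s x -> Ord m (z * y * x).

Lemma R_snd y : R (0, y) <-> lat z n y.
Proof. by rewrite RE /= scale0r subr0; split=> [[]|h] //; split=> //; left. Qed.

Lemma R_diag a : int_ring v a -> R (a, a%:A).
Proof.
by move=> ia; rewrite RE /= subrr; split=> //; rewrite /lat /= mulr0; apply: Ord_0.
Qed.

Lemma std_idealM m s x y : compatible m s -> R x -> std_ideal m s y ->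
  std_ideal m s (x * y).
Proof.
move=> hc /RE[ix hx] [iy hy]; split; first exact: int_ringM.
rewrite /=; set l := x.2 - (x.1)%:A in hx.
have -> : x.2 * y.2 - (x.1 * y.1) *: s =
    x.1 *: (y.2 - y.1 *: s) + z * (z^-1 * l) * (y.2 - y.1 *: s + y.1 *: s).
  rewrite subrK mulVKf // /l mulrBl mulr_algl scalerBr scalerA.
  by rewrite [RHS]addrC addrA subrK.
apply: OrdD; first exact: OrdZ.
apply: hc => //; apply: cspan_add.
  by rewrite -[_ - _]mulr1; apply: cspan_mul => //; apply: cspan1.
by rewrite -mulr_algl; apply: cspan_mul; [apply/OrdA|apply: cspan_self].
Qed.

Lemma std_ideal_frac m s : compatible m s -> frac_ideal R (std_ideal m s).
Proof.
move=> hc; have mem1 : std_ideal m s (1, s).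
  by split; [apply: int_ring1|rewrite /= scale1r subrr; apply: Ord_0].
have mem2 : std_ideal m s (0, 1) by apply/std_ideal_snd/Ord1.
have ot := t_int.
have mem3 : std_ideal m s (0, pi ^+ m *: t) by apply/std_ideal_snd/Ord_of_int.
have decomp (x : E) : let l := x.2 - x.1 *: s in
    x = (x.1, (x.1)%:A) * (1, s) + (c0 l, (c0 l)%:A) * (0, 1) +
        (pi ^ (- m%:Z) * c1 l, (pi ^ (- m%:Z) * c1 l)%:A) * (0, pi ^+ m *: t).
  move=> l; case: x @l => x1 x2 l; congr (_, _) => /=.
    by rewrite mulr1 !mulr0 !addr0.
  rewrite !mulr_algl -addrA.
  have -> : (pi ^ (- m%:Z) * c1 l) *: (pi ^+ m *: t) = c1 l *: t.
    by rewrite scalerA mulrAC exprnP [_ * pi ^ _]mulrC (unifzK hpi) mul1r.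
  by rewrite -coordsE /l /= addrC subrK.
split.
  exists [:: (1, s); (0, 1); (0, pi ^+ m *: t)]; apply/seteqP; split=> x.
    move=> [ix hx]; rewrite (decomp x); set l := x.2 - x.1 *: s.
    have [h0 h1] := hx.
    apply: lin_spanD; first apply: lin_spanD.
    - by apply: lin_span_gen; [apply: R_diag|rewrite /= !inE eqxx].
    - by apply: lin_span_gen; [apply: R_diag|rewrite /= !inE eqxx orbT].
    - apply: lin_span_gen; last by rewrite /= !inE eqxx !orbT.
      by apply: R_diag; apply/(val_ge_shift hpi); rewrite sub0r opprK.
  apply: lin_span_ind.
  - by rewrite -[0]/((0, 0) : E); apply/std_ideal_snd/Ord_0.
  - exact: std_idealD.
  - move=> b y Rb; rewrite /= !inE => /or3P[] /eqP ->; exact: std_idealM.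
apply/seteqP; split=> // x _; rewrite (decomp x).
have df a : @diag_field F K (a, a%:A) by exists a.
apply: lin_spanD; last exact: lin_span_gen (df _) mem3.
by apply: lin_spanD; [exact: lin_span_gen (df _) mem1|exact: lin_span_gen (df _) mem2].
Qed.

(** Let [x0] have first coordinate of least valuation, and let [lat z' m] be the kernel of the first
    projection. Dividing by [(x0.1, z')] turns [x0] into [(1, s)] and the kernel into [Ord m]. *)
Lemma frac_ideal_std I : frac_ideal R I ->
  exists m s, compatible m s /\ ideal_class I = ideal_class (std_ideal m s).
Proof.
move=> [[gs IE] Ispan].
have ID x y : I x -> I y -> I (x + y) by rewrite IE; apply: lin_spanD.
have IM x y : R x -> I y -> I (x * y).
  by rewrite IE => Rx; apply: lin_spanM => c; apply: RM.
have IZ a x : int_ring v a -> I x -> I (a * x.1, a *: x.2).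
  move=> ia Ix; have -> : a *: x.2 = a%:A * x.2 by rewrite mulr_algl.
  exact: IM (R_diag ia) Ix.
have [B IB] : exists B : nat, forall x, I x ->
    val_ge v (- B%:Z) x.1 /\ O (pi ^ B%:Z *: x.2).
  have [B hB'] := seq_bounded gs.
  exists B => x; rewrite IE; apply: (@lin_span_ind _ R [set` gs] (fun x : E =>
    val_ge v (- B%:Z) x.1 /\ O (pi ^ B%:Z *: x.2))).
  - by split; [left|rewrite /= scaler0; exact: (int_closure0 v K)].
  - move=> y y' [h0 h1] [g0 g1]; split; first exact: val_geD.
    by rewrite scalerDr; apply: int_closureD.
  - move=> b y /R_max[ib ob] /hB'[h0 h1]; split.
      by rewrite -[- _]add0r; apply: val_geM.
    by rewrite scalerAr; apply: int_closureM.
(* As [I] spans [E] over [F], a linear condition valid on [I] is valid on [E]; so neither projection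
   vanishes on [I]. *)
have nz (P : E -> Prop) : (forall x, I x -> P x) ->
    (forall a x, P x -> P (diag K a * x)) -> (forall x y, P x -> P y -> P (x + y)) ->
    P 0 -> forall x, P x.
  move=> hI hM hD h0 x; have : lin_span (@diag_field F K) I x by rewrite Ispan.
  by apply: lin_span_ind => // _ y [a _ <-] Iy; apply/hM/hI.
have [x [Ix x10]] : exists x, I x /\ x.1 != 0.
  apply: contrapT => h.
  have : (1 : F) = 0; last by move/eqP; rewrite oner_eq0.
  apply: (nz (fun x => x.1 = 0) _ _ _ _ ((1, 0) : E)) => //=.
  - move=> x Ix; apply/eqP; apply: contrapT => /negP x10; apply: h.
    by exists x.
  - by move=> a y ->; rewrite mulr0.
  - by move=> y y' -> ->; rewrite addr0.
have [y [Iy y20]] : exists y, I y /\ y.2 != 0.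
  apply: contrapT => h.
  have : (1 : K) = 0; last by move/eqP; rewrite oner_eq0.
  apply: (nz (fun x => x.2 = 0) _ _ _ _ ((0, 1) : E)) => //=.
  - move=> x' Ix'; apply/eqP; apply: contrapT => /negP x20; apply: h.
    by exists x'.
  - by move=> a y ->; rewrite mulr0.
  - by move=> y y' -> ->; rewrite addr0.
have [x0 [Ix0 x010 x0min]] : exists x0, [/\ I x0, x0.1 != 0 &
    forall x, I x -> val_ge v (v x0.1) x.1].
  have key k : forall x, I x -> x.1 != 0 -> v x.1 + B%:Z < k%:Z ->
    exists x0, [/\ I x0, x0.1 != 0 & forall x, I x -> val_ge v (v x0.1) x.1].
    elim: k => [|k IH] x' Ix' x0' hk.
      by have [/(val_geP _ _ x0')] := IB _ Ix'; lia.
    case: (pselect (forall x, I x -> val_ge v (v x'.1) x.1)) => [h|]; first by exists x'.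
    move/existsNP => [x'' /not_implyP[Ix'' /not_val_ge[n0 nv]]].
    by apply: (IH x'') => //; lia.
  by apply: (key (`|v x.1| + B).+1%N x) => //; lia.
have [i [u [uu yE]]] := int_unit_decomp hpi ram y20.
have [zi [zu [uzu zE]]] := int_unit_decomp hpi ram z0.
have Rz k y' : Ord n k -> I y' -> I (0, z * k * y'.2).
  move=> hk Iy'; have : R (0, z * k) by apply/R_snd; rewrite /lat /= mulKf.
  by move=> Rk; rewrite -pair0M; apply: IM.
(* The kernel contains [y] multiplied by the elements [(0, z pi ^ n x)] of [R], whence the exponent
   [zi + n + i]. *)
have [|a x' ia Lx|x' ox|x' Lx|z' [m [z0' LE]]] :=
   @lattice_principal [set l | I (0, l)] (zi + n%:Z + i) B%:Z.
- by move=> x' y' /= Lx Ly; have := ID _ _ Lx Ly; rewrite pair0D.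
- by have := IZ _ _ ia Lx; rewrite /= mulr0.
- rewrite /=.
  have -> : pi ^ (zi + n%:Z + i) *: x' = z * (pi ^+ n *: (zu^-1 * u^-1 * x')) * y.2.
    rewrite zE yE -!(scalerAl, scalerAr) !scalerA exprnP -!(unifzD hpi).
    have [[nu _ _] [nzu _ _]] := (uu, uzu).
    by rewrite -!mulrA mulVKf // [x' * u]mulrC mulKf // [i + _]addrC.
  apply: Rz => //; apply: Ord_of_int; apply: int_closureM => //.
  by apply: int_closureM; [case: uzu|case: uu].
- by case: (IB _ Lx).
have Ispec x' : I x' <-> val_ge v (v x0.1) x'.1 /\
    lat z' m (x'.2 - (x'.1 / x0.1) *: x0.2).
  have quot_int : val_ge v (v x0.1) x'.1 -> int_ring v (x'.1 / x0.1).
    move=> h; rewrite /int_ring -[0](subrr (v x0.1)); apply: val_geM => //.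
    by right; rewrite dvalV.
  have E : x' = (0, x'.2 - (x'.1 / x0.1) *: x0.2) +
      (x'.1 / x0.1 * x0.1, (x'.1 / x0.1) *: x0.2) :> E.
    by case: x' {quot_int} => a b; congr (_, _); rewrite /= ?add0r ?divfK ?subrK.
  rewrite -LE /=; split=> [Ix'|[h Lx']].
    have h := x0min _ Ix'; split=> //.
    have := ID _ _ Ix' (IZ _ _ (val_geN (quot_int h)) Ix0).
    congr I; case: x' {Ix' quot_int E h} => a b; congr (_, _).
      by rewrite /= mulNr divfK // subrr.
    by rewrite /= scaleNr.
  by rewrite E; apply: ID => //; apply: IZ => //; apply: quot_int.
have Ord_I l : Ord m l -> I (0, z' * l).
  by move=> hl; rewrite -[I _]/([set l | I (0, l)] (z' * l)) LE /lat /= mulKf.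
have I_Ord l : I (0, l) -> Ord m (z'^-1 * l).
  by rewrite -[I _]/([set l | I (0, l)] l) LE.
exists m, (z'^-1 * x0.2); split.
  move=> x' k hk [a [b [ha hb ->]]]; rewrite mulrDr; apply: OrdD.
    have := I_Ord _ (Rz _ _ hk (Ord_I _ ha)).
    by congr (Ord m _); rewrite /= mulrCA mulKf.
  rewrite [b * _]mulrC mulrA; apply: OrdM => //.
  have := I_Ord _ (Rz _ _ hk Ix0).
  by congr (Ord m _); rewrite mulrCA.
apply/esym/ideal_class_eqP; exists (x0.1, z'); first exact/prod_unitP.
apply/seteqP; split=> [x' /Ispec[h0 h1]|_ [x' [ix' hx'] <-]].
  exists (x'.1 / x0.1, z'^-1 * x'.2).
    split=> /=.
      rewrite /int_ring -[0](subrr (v x0.1)); apply: val_geM => //.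
      by right; rewrite dvalV.
    by rewrite scalerAr -mulrBr.
  by case: x' {h0 h1} => a b; congr (_, _); rewrite /= ?mulVKf // mulrC divfK.
apply/Ispec; split => /=.
  by rewrite -[v x0.1]addr0; apply: val_geM => //; right.
by rewrite /lat /= mulrBr mulKf // [x0.1 * _]mulrC mulfK // -scalerAr.
Qed.

End OrderIdeals.

Lemma int_unitX u (k : nat) : U u -> U (u ^+ k).
Proof.
move=> uu; elim: k => [|k IH]; first exact: int_unit1.
by rewrite exprS; apply: int_unitM.
Qed.

(** * Structure and length of an order *)

(** The kernel of the first projection of [R] is [pi ^ d w O_n]. Then [f2] is the least exponent
    with [pi ^ f2 O] inside it, and [f1] the least with [pi ^ f1] in it, as [(pi ^ i, 0)] and
    [(0, pi ^ i)] add up to a diagonal element. The last inequality says that the square of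
    [pi ^ d w] stays in the kernel. *)
Lemma order_structure (R : set E) (f1 f2 : nat) :
  is_order v R ->
  conductor v R = [set pi ^+ f1 * x | x in int_ring v] `*`
                  [set (pi ^+ f2)%:A * y | y in O] ->
  exists d n w, [/\ U w, R `<=` @max_order F v K,
    forall x : E, R x <->
      int_ring v x.1 /\ lat (pi ^+ d *: w) n (x.2 - (x.1)%:A),
    f2 = (d + n)%N /\ (f1 + level n w = d + n)%N & (n <= d + level n w)%N].
Proof.
move=> [[R1' RB' RM'] Rdiag [gs RE] Rspan] hcond.
have R1 : R 1 := set_mem R1'.
have RB x y : R x -> R y -> R (x - y).
  by move=> Rx Ry; apply/set_mem/RB'; apply: mem_set.
have RM x y : R x -> R y -> R (x * y).
  by move=> Rx Ry; apply/set_mem/RM'; apply: mem_set.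
have R0 : R 0 by rewrite -(subrr 1); apply: RB.
have RD x y : R x -> R y -> R (x + y).
  by move=> Rx Ry; rewrite -[y]opprK; apply: (RB) => //; rewrite -[- y]sub0r; apply: RB.
have RX x k : R x -> R (x ^+ k).
  by move=> Rx; elim: k => [|k IH] //; rewrite exprS; apply: RM.
have [B RB0] : exists B : nat, forall x, R x ->
    val_ge v (- B%:Z) x.1 /\ O (pi ^ B%:Z *: x.2).
  have [B hB'] := seq_bounded gs.
  exists B => x; rewrite RE; apply: (@lin_span_ind _ (@diag_int F v K) [set` gs]
    (fun x : E => val_ge v (- B%:Z) x.1 /\ O (pi ^ B%:Z *: x.2))).
  - by split; [left|rewrite /= scaler0; exact: (int_closure0 v K)].
  - move=> y y' [h0 h1] [g0 g1]; split; first exact: val_geD.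
    by rewrite scalerDr; apply: int_closureD.
  - move=> _ y [a ia <-] /hB'[h0 h1]; split.
      by rewrite -[- _]add0r; apply: val_geM.
    by rewrite /= mulr_algl scalerA mulrC -scalerA; apply: int_closureZ.
have fstX (x : E) k : (x ^+ k).1 = x.1 ^+ k.
  by elim: k => //= k IH; rewrite !exprS /= IH.
have sndX (x : E) k : (x ^+ k).2 = x.2 ^+ k.
  by elim: k => //= k IH; rewrite !exprS /= IH.
(* A pole of [x] would give [x ^ (B + 1)] a pole of order more than [B]. *)
have R_max : R `<=` @max_order F v K.
  move=> x Rx; split.
    apply: contrapT => /not_val_ge[x0 vx].
    have [+ _] := RB0 _ (RX x B.+1 Rx); rewrite fstX.
    by move/(val_geP _ _ (expf_neq0 _ x0)); rewrite dvalXn //; nia.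
  have [->|x0] := eqVneq x.2 0; first exact: (int_closure0 v K).
  have [i [u [uu xE]]] := int_unit_decomp hpi ram x0.
  have [_] := RB0 _ (RX x B.+1 Rx); rewrite sndX xE exprZn scalerA exprnP exprz_exp.
  rewrite -(unifzD hpi) (int_unifz _ (int_unitX _ uu)) => h.
  by rewrite (int_unifz _ uu); nia.
have Rdg a : int_ring v a -> R (a, a%:A) by move=> ia; apply: Rdiag; exists a.
have Rsub (x : E) : int_ring v x.1 -> R x <-> R (0, x.2 - (x.1)%:A).
  move=> ix; have xE : x = (0, x.2 - (x.1)%:A) + (x.1, (x.1)%:A) :> E.
    by case: x ix => a b ia; congr (_, _); rewrite /= ?add0r ?subrK.
  split=> [Rx|h]; last by rewrite xE; apply: RD => //; apply: Rdg.
  have -> : (0, x.2 - (x.1)%:A) = x - (x.1, (x.1)%:A) :> E.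
    by apply/esym/eqP; rewrite subr_eq; apply/eqP.
  by apply: RB => //; apply: Rdg.
have snd_f2 y : O y -> R (0, pi ^+ f2 *: y).
  move=> oy; have : conductor v R (0, pi ^+ f2 *: y).
    rewrite hcond; split=> /=; first by exists 0; [left|rewrite mulr0].
    by exists y => //; rewrite mulr_algl.
  move=> [_ /(_ 1)]; rewrite mulr1; apply; split; [exact: int_ring1|exact: int_closure1].
have [|a x' ia Lx|x' ox|x' Lx|z [n [z0 LE]]] :=
   @lattice_principal [set l | R (0, l)] f2%:Z 0.
- by move=> x' y' /= Lx Ly; have := RD _ _ Lx Ly; rewrite pair0D.
- have := RM _ _ Lx (Rdg _ ia); rewrite pair0M /= mulrC.
  by rewrite mulr_algl.
- by rewrite /= -exprnP; apply: snd_f2.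
- by rewrite expr0z scale1r; have [] := R_max _ Lx.
have zR : R (0, z) by rewrite -[R _]/([set l | R (0, l)] z) LE; apply: lat_gen.
have zO : O z by have [] := R_max _ zR.
have [i [w [uw zE]]] := int_unit_decomp hpi ram z0.
have i0 : 0 <= i by rewrite -(int_unifz _ uw) -zE.
have iE : i = `|i|%N by lia.
rewrite iE -exprnP in zE; set d := `|i|%N in zE; clear iE i0.
have LP y : R (0, y) <-> lat z n y by rewrite -LE.
have latP (j : int) u : U u -> lat z n (pi ^ j *: u) <->
    n%:Z <= j - d%:Z + (level n (u / w))%:Z.
  move=> uu; rewrite /lat /=.
  have -> : z^-1 * (pi ^ j *: u) = pi ^ (j - d%:Z) *: (u / w).
    rewrite zE scaler_inv -scalerAl -scalerAr scalerA exprnP invr_expz.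
    by rewrite -(unifzD hpi) addrC mulrC.
  by rewrite Ord_shift //; apply/int_unitM/int_unitV.
exists d, n, w; split=> //.
- move=> x; rewrite -zE; split=> [Rx|[ix hx]].
    have [ix _] := R_max _ Rx; split=> //; apply/LP; exact: (Rsub _ ix).1.
  by apply/(Rsub _ ix)/LP.
- have scalar_unif (i' f : nat) :
      ((pi ^+ f)^-1 * pi ^+ i')%R = pi ^ (i'%:Z - f%:Z) :> F.
    by rewrite !exprnP invr_expz -(unifzD hpi) addrC.
  split.
    have key (i' : nat) : (f2 <= i')%N <-> (d + n <= i')%N.
      transitivity (conductor v R (0, (pi ^+ i')%:A)).
        rewrite hcond; split=> [h|[_ [y oy /= yE]]].
          split; first by exists 0; [left|rewrite mulr0].
          exists (pi ^+ (i' - f2))%:A; last by rewrite mulr_algl scalerA -exprD subnKC.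
          by rewrite exprnP; apply: int_closureZz => //; apply: int_closure1.
        have : O (pi ^ (i'%:Z - f2%:Z))%:A.
          rewrite -scalar_unif -scalerA -yE mulr_algl scalerA mulVf ?scale1r //.
          by rewrite expf_neq0 // (unif_neq0 hpi).
        by rewrite (int_unifz _ int_unit1); lia.
      split=> [[_ h]|h].
        (* The integer [w t] is the worst case, because [t] has level [0]. *)
        have ut := t_unit; have [w0 ow _] := uw; have [_ ot _] := ut.
        have /h : @max_order F v K (0, w * t) by split; [left|apply: int_closureM].
        rewrite pair0M mulr_algl => /LP; rewrite exprnP latP; last exact: int_unitM.
        rewrite mulrAC divff // mul1r => hh.
        case: (posnP n) => [n0|n0]; first by move: hh; rewrite n0 /level big_ord0; lia.
        suff : level n t = 0%N by move=> k0; move: hh; rewrite k0; lia.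
        apply/eqP; rewrite -leqn0 leqNgt; apply/negP => /(levelP ot n0)[_].
        by rewrite c1t => /(val_geP _ _ (oner_neq0 _)); rewrite dval1.
      split; first by split; [left|rewrite /= exprnP; apply: int_closureZz => //; apply: int_closure1].
      move=> x [_ ox]; rewrite pair0M mulr_algl; apply/LP; rewrite /lat /=.
      have -> : z^-1 * (pi ^+ i' *: x.2) = pi ^+ n *: (pi ^ (i'%:Z - (d + n)%N%:Z) *: (w^-1 * x.2)).
        rewrite zE scaler_inv -scalerAl -scalerAr !scalerA !exprnP invr_expz -!(unifzD hpi).
        by congr (pi ^ _ *: _); lia.
      apply: Ord_of_int; apply: int_closureZz => //; first by lia.
      by apply: int_closureM => //; case: uw.
    by apply/eqP; rewrite eqn_leq; apply/andP; split; apply/key.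
  have key (i' : nat) : (f1 <= i')%N <-> (d + n - level n w <= i')%N.
    have kn := level_le n w.
    transitivity (conductor v R (pi ^+ i', 0)).
      rewrite hcond; split=> [h|[[y iy /= yE] _]].
        split; last by exists 0; [apply: int_closure0|rewrite mulr0].
        exists (pi ^+ (i' - f1)); last by rewrite -exprD subnKC.
        by rewrite exprnP; apply: val_geW (val_ge_unifz hpi _).
      have : int_ring v (pi ^ (i'%:Z - f1%:Z)).
        rewrite -scalar_unif -yE mulKf //.
        by rewrite expf_neq0 // (unif_neq0 hpi).
      by move/(val_geP _ _ (unifz_neq0 hpi _)); rewrite (dval_unifz hpi); lia.
    have ii x : int_ring v x -> int_ring v (pi ^+ i' * x).
      move=> ix; rewrite exprnP; apply/(val_ge_shift hpi).
      by apply: val_geW ix; lia.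
    transitivity (R (0, (pi ^+ i')%:A)).
      split=> [[_ /(_ 1)]|h].
        rewrite mulr1 => h.
        have ipi := ii _ (int_ring1 v); rewrite mulr1 in ipi.
        have -> : (0, (pi ^+ i')%:A) = (pi ^+ i', (pi ^+ i')%:A) - (pi ^+ i', 0) :> E.
          by congr (_, _); rewrite /= ?subrr ?subr0.
        apply: RB; first exact: Rdg.
        by apply: h; split; [apply: int_ring1|apply: int_closure1].
      split; first by split; [rewrite -[_ ^+ _]mulr1; apply/ii/int_ring1|apply: int_closure0].
      move=> x [ix ox].
      have -> : (pi ^+ i', 0) * x = (pi ^+ i' * x.1, (pi ^+ i' * x.1)%:A) -
          (0, (pi ^+ i')%:A) * (x.1, (x.1)%:A) :> E.
        congr (_, _); rewrite /= ?mul0r ?subr0 //.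
        by rewrite mulr_algl scalerA subrr.
      by apply: RB; [apply/Rdg/ii|apply: RM => //; apply: Rdg].
    rewrite LP exprnP (latP _ _ int_unit1) mul1r levelV //.
    by split; lia.
  have kn := level_le n w.
  suff : f1 = (d + n - level n w)%N by lia.
  by apply/eqP; rewrite eqn_leq; apply/andP; split; apply/key.
have := RM _ _ zR zR; rewrite pair0M /= => /LP; rewrite /lat /= mulKf //.
by rewrite zE exprnP Ord_shift //; lia.
Qed.

(** * The length of the maximal order over an order *)

Definition int_submodule (M : set K) : Prop :=
  (forall x y, M x -> M y -> M (x + y)) /\
  (forall a x, int_ring v a -> M x -> M (a *: x)).

(* For [M] between [pi ^ d * o + pi ^ e * o * t] and the maximal order, the
   length of [M] over the former, read off the valuations of its coordinates. *)
Definition coord_length (d e : nat) (M : set K) : nat :=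
  (\sum_(i < d) `[< exists2 x, M x & c0 x = pi ^+ i >] +
   \sum_(i < e) `[< M (pi ^+ i *: t) >])%N.

Lemma coord_length_le d e M : (coord_length d e M <= d + e)%N.
Proof.
by apply: leq_add; rewrite -[leqRHS]card_ord -sum1_card leq_sum // => i _; case: asboolP.
Qed.

(** If the counts agreed, [M] and [N] would have the same image under [c0] and the same multiples of
    [t], hence be equal. *)
Lemma coord_length_lt d e (M N : set K) :
  int_submodule M -> int_submodule N -> M (pi ^+ d)%:A -> M (pi ^+ e *: t) ->
  (forall x, N x -> O x) -> M `<` N -> (coord_length d e M < coord_length d e N)%N.
Proof.
move=> [MD MZ] [ND NZ] Md Me NO [MN nNM].
have le1 i : (`[< exists2 x, M x & c0 x = pi ^+ i >] <=
    `[< exists2 x, N x & c0 x = pi ^+ i >])%N.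
  case: asboolP => // -[x Mx xE]; case: asboolP => // -[].
  by exists x => //; apply: MN.
have le2 i : (`[< M (pi ^+ i *: t) >] <= `[< N (pi ^+ i *: t) >])%N.
  by case: asboolP => // /MN Nx; case: asboolP.
rewrite ltn_neqAle leq_add ?leq_sum // andbT; apply/negP => /eqP eqMN.
have [e1 e2] : coord_length d 0 M = coord_length d 0 N /\
    coord_length 0 e M = coord_length 0 e N.
  rewrite /coord_length !big_ord0.
  have h1 : (\sum_(i < d) `[< exists2 x, M x & c0 x = pi ^+ i >] <=
    \sum_(i < d) `[< exists2 x, N x & c0 x = pi ^+ i >])%N by apply: leq_sum.
  have h2 : (\sum_(i < e) `[< M (pi ^+ i *: t) >] <=
    \sum_(i < e) `[< N (pi ^+ i *: t) >])%N by apply: leq_sum.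
  by move: eqMN; rewrite /coord_length; lia.
have sum_eq k (f g : nat -> bool) : (forall i, (f i <= g i)%N) ->
    (\sum_(i < k) f i = \sum_(i < k) g i)%N -> forall i, (i < k)%N -> g i -> f i.
  move=> fg; elim: k => // k IH; rewrite !big_ord_recr /= => h i.
  have hs : (\sum_(i < k) f i <= \sum_(i < k) g i)%N by apply: leq_sum => j _; apply: fg.
  have fgk := fg k; rewrite ltnS leq_eqVlt => /orP[/eqP ->|ik].
    case gk: (g k) => // _; case fk: (f k) => //.
    move: h hs; rewrite gk fk.
    move: (\sum_(i < k) f i)%N (\sum_(i < k) g i)%N => A B.
    by rewrite addn0 addn1 => ->; rewrite ltnn.
  apply: IH => //; move: h hs fgk.
  move: (\sum_(i < k) f i)%N (\sum_(i < k) g i)%N (f k : nat) (g k : nat) => A1 A2 A3 A4.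
  lia.
have key1 (i : nat) : (exists2 x, N x & c0 x = pi ^+ i) -> exists2 x, M x & c0 x = pi ^+ i.
  have [id|di] := ltnP i d.
    move=> h; apply/asboolP; move: e1; rewrite /coord_length !big_ord0 !addn0 => e0.
    by apply: (sum_eq d _ _ le1 e0 i id); apply/asboolP.
  move=> _; exists (pi ^+ (i - d) *: (pi ^+ d)%:A); last first.
    by rewrite c0Z c0A -exprD subnK.
  by apply: MZ => //; rewrite exprnP; apply: val_geW (val_ge_unifz hpi _).
have key2 (i : nat) : N (pi ^+ i *: t) -> M (pi ^+ i *: t).
  have [ie|ei] := ltnP i e.
    move=> h; apply/asboolP; move: e2; rewrite /coord_length !big_ord0 !add0n => e0.
    by apply: (sum_eq e _ _ le2 e0 i ie); apply/asboolP.
  move=> _; rewrite -(subnK ei) exprD -scalerA; apply: MZ => //.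
  by rewrite exprnP; apply: val_geW (val_ge_unifz hpi _).
apply: nNM => x Nx; have /int_coordsP[i0 i1] := NO _ Nx.
have [y [My xy0]] : exists y, M y /\ c0 (x - y) = 0.
  have [x0|x0] := eqVneq (c0 x) 0.
    exists (0 *: (pi ^+ d)%:A); split; first by apply: MZ => //; left.
    by rewrite scale0r subr0.
  have vx : 0 <= v (c0 x) by move/(val_geP _ _ x0): i0.
  have pn : pi ^+ `|v (c0 x)| != 0 by rewrite expf_neq0 // (unif_neq0 hpi).
  have [||iu iui] := @int_ring_unit _ v (c0 x / pi ^+ `|v (c0 x)|).
  - by rewrite mulf_neq0 ?invr_eq0.
  - rewrite dvalM ?invr_eq0 // dvalV // exprnP (dval_unifz hpi); lia.
  have [|y My yE] := key1 `|v (c0 x)|%N.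
    exists ((c0 x / pi ^+ `|v (c0 x)|)^-1 *: x); first exact: NZ.
    by rewrite c0Z invf_div divfK.
  exists ((c0 x / pi ^+ `|v (c0 x)|) *: y); split; first exact: MZ.
  by rewrite c0D -scaleNr c0Z yE mulNr divfK // subrr.
have Nxy : N (x - y).
  by apply: ND => //; rewrite -scaleN1r; apply: NZ; [apply/val_geN/int_ring1|apply: MN].
rewrite -(subrK y x); apply: MD => //.
have [_ j1] := (int_coordsP _).1 (NO _ Nxy).
have -> : x - y = c1 (x - y) *: t.
  by rewrite {1}(coordsE (x - y)) xy0 scale0r add0r.
move: (c1 (x - y)) (coordsE (x - y)) j1 => c; rewrite xy0 scale0r add0r => xyE ic.
have [->|n0] := eqVneq c 0.
  by rewrite scale0r -(scale0r (pi ^+ d)%:A); apply: MZ => //; left.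
have vc : 0 <= v c by move/(val_geP _ _ n0): ic.
have pn : pi ^+ `|v c| != 0 by rewrite expf_neq0 // (unif_neq0 hpi).
have [||iu iui] := @int_ring_unit _ v (c / pi ^+ `|v c|).
- by rewrite mulf_neq0 ?invr_eq0.
- rewrite dvalM ?invr_eq0 // dvalV // exprnP (dval_unifz hpi); lia.
have -> : c *: t = (c / pi ^+ `|v c|) *: (pi ^+ `|v c| *: t) by rewrite scalerA divfK.
apply: MZ => //; apply: key2.
have -> : pi ^+ `|v c| *: t = (c / pi ^+ `|v c|)^-1 *: (x - y).
  by rewrite xyE scalerA invf_div divfK.
exact: NZ.
Qed.

(** A module between [R] and the maximal order contains the diagonal integers, so its part with
    first coordinate [0] determines it. Dividing that part by [w] makes [coord_length] bound every
    chain; an explicit chain attains the bound. *)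
Lemma order_length_eq (R : set E) (d n S : nat) w : U w ->
  (forall x : E, R x <->
      int_ring v x.1 /\ lat (pi ^+ d *: w) n (x.2 - (x.1)%:A)) ->
  order_length v R S -> S = (2 * d + n)%N.
Proof.
move=> uw RE [[c [c0E cSE csub clt]] cmax].
have [w0 ow owi] := uw.
have latE l : lat (pi ^+ d *: w) n l <->
    val_ge v d%:Z (c0 (w^-1 * l)) /\ val_ge v (d + n)%N%:Z (c1 (w^-1 * l)).
  rewrite /lat /= /Ord /= scaler_inv -scalerAl c0Z c1Z !exprnP invr_expz.
  rewrite /int_ring; split=> -[h0 h1].
    move/(val_ge_shift hpi): h0 => h0; move/(val_ge_shift hpi): h1 => h1.
    by split; [apply: val_geW h0|apply: val_geW h1]; lia.
  by split; apply/(val_ge_shift hpi); [apply: val_geW h0|apply: val_geW h1]; lia.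
have Oval x : O x <-> val_ge v 0 (c0 x) /\ val_ge v 0 (c1 x) := int_coordsP x.
have Rdiag a : int_ring v a -> R (a, a%:A).
  move=> ia; apply/RE; split=> //=; apply/latE.
  by rewrite subrr mulr0 -(scale0r 1) c0A c1A; split; left.
have Rsnd l : R (0, w * l) <-> val_ge v d%:Z (c0 l) /\ val_ge v (d + n)%N%:Z (c1 l).
  rewrite RE /= scale0r subr0 latE mulKf //.
  by split=> [[]|] // h; split=> //; left.
have upper m : quot_chain (@diag_int F v K) (@max_order F v K) R m -> (m <= 2 * d + n)%N.
  move=> [b [b0E bmE bsub blt]].
  have bmono i k : (i + k <= m)%N -> b i `<=` b (i + k)%N.
    elim: k => [|k IH] ik x bx; first by rewrite addn0.
    rewrite addnS in ik *; have [h _] := blt _ ik.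
    by apply/h/IH => //; apply: ltnW.
  have bR i : (i <= m)%N -> R `<=` b i by rewrite -b0E; apply: (bmono 0%N).
  have bmax i : (i <= m)%N -> b i `<=` @max_order F v K.
    by move=> im; rewrite -bmE -(subnKC im); apply: bmono; rewrite subnKC.
  pose L i := [set l | b i (0, w * l)].
  have Lint i : (i <= m)%N -> forall x, L i x -> O x.
    move=> im x /(bmax _ im)[_ /= oxw].
    have -> : x = w^-1 * (w * x) by rewrite mulKf.
    exact: int_closureM.
  have Lsub i : (i <= m)%N -> int_submodule (L i).
    move=> im; have [_ bD bZ] := bsub i im; split=> [x y|a x ia] Lx.
      by move=> Ly; have := bD _ _ Lx Ly; rewrite pair0D -mulrDr.
    have ai : @diag_int F v K (a, a%:A) by exists a.
    by have := bZ _ _ ai Lx; rewrite mulrC pair0M /= mulrC mulr_algl /L /= scalerAr.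
  have bL i (x : E) : (i <= m)%N -> int_ring v x.1 ->
      b i x <-> L i (w^-1 * (x.2 - (x.1)%:A)).
    move=> im ix; have [_ bD bZ] := bsub i im.
    have bdiag a : int_ring v a -> b i (a, a%:A) by move=> ia; apply/(bR _ im)/Rdiag.
    rewrite /L /= mulVKf //; split=> bx.
      have -> : (0, x.2 - (x.1)%:A) = x + (- x.1, (- x.1)%:A) :> E.
        by case: x {ix bx} => y z; congr (_, _); rewrite /= ?subrr // scaleNr.
      by apply: bD => //; apply/bdiag/val_geN.
    have -> : x = (0, x.2 - (x.1)%:A) + (x.1, (x.1)%:A) :> E.
      by case: x {ix bx} => y z; congr (_, _); rewrite /= ?add0r ?subrK.
    by apply: bD => //; apply: bdiag.
  have len i : (i <= m)%N -> (i <= coord_length d (d + n) (L i))%N.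
    elim: i => // i IH im; apply: leq_ltn_trans (IH (ltnW im)) _.
    apply: coord_length_lt.
    - exact: Lsub (ltnW im).
    - exact: Lsub.
    - apply/(bR _ (ltnW im))/Rsnd; rewrite c0A c1A; split; last by left.
      by rewrite exprnP; apply: val_ge_unifz.
    - apply/(bR _ (ltnW im))/Rsnd; rewrite c0Z c1Z c0t c1t mulr0 mulr1; split; first by left.
      by rewrite exprnP; apply: val_ge_unifz.
    - exact: Lint.
    have [h1 h2] := blt _ im; split; first by move=> l; apply: h1.
    move=> h; apply: h2 => x bx; have [ix _] := bmax _ im _ bx.
    by apply/(bL _ _ (ltnW im) ix)/h/(bL _ _ im ix).
  apply: leq_trans (len m (leqnn m)) _; apply: leq_trans (coord_length_le _ _ _) _.
  by lia.
apply/eqP; rewrite eqn_leq upper /=; last by exists c.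
apply: cmax.
(* The first [d] steps lower the valuation of [c0], the other [d + n] that of [c1]; truncated
   subtraction and the minimum hold the other coordinate fixed. *)
pose N i : set E := [set x | [/\ int_ring v x.1,
  val_ge v (d - i)%N%:Z (c0 (w^-1 * (x.2 - (x.1)%:A))) &
  val_ge v (minn (d + n) (2 * d + n - i))%N%:Z (c1 (w^-1 * (x.2 - (x.1)%:A)))]].
exists N; split.
- apply/seteqP; split=> x.
    move=> [ix h0 h1]; apply/RE; split=> //; apply/latE; rewrite subn0 in h0.
    by split=> //; apply: val_geW h1; lia.
  move/RE => [ix /latE[h0 h1]]; split=> //; first by rewrite subn0.
  by apply: val_geW h1; lia.
- apply/seteqP; split=> x.
    move=> [ix h0 h1]; split=> //=.
    have ol : O (w^-1 * (x.2 - (x.1)%:A)).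
      by apply/Oval; split; [apply: val_geW h0|apply: val_geW h1]; lia.
    have -> : x.2 = w * (w^-1 * (x.2 - (x.1)%:A)) + (x.1)%:A by rewrite mulVKf // subrK.
    by apply: int_closureD; [apply: int_closureM|apply/int_closure_scalar].
  move=> [ix ox].
  have /Oval[h0 h1] : O (w^-1 * (x.2 - (x.1)%:A)).
    by apply: int_closureM => //; apply: int_closureB => //; apply/int_closure_scalar.
  by split=> //; [apply: val_geW h0|apply: val_geW h1]; lia.
- move=> i _; split.
  + split; rewrite /= ?scale0r ?subr0 ?mulr0; first by left.
      by rewrite -(scale0r 1) c0A; left.
    by rewrite -(scale0r 1) c1A; left.
  + move=> x y [ix h0 h1] [iy g0 g1].
    have xyE : w^-1 * ((x + y).2 - ((x + y).1)%:A) =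
       w^-1 * (x.2 - (x.1)%:A) + w^-1 * (y.2 - (y.1)%:A).
      by rewrite -mulrDr /= scalerDl opprD addrACA.
    by split; [apply: val_geD|rewrite xyE c0D; apply: val_geD|rewrite xyE c1D; apply: val_geD].
  + move=> _ x [a ia <-] [ix h0 h1].
    have axE : w^-1 * ((diag K a * x).2 - ((diag K a * x).1)%:A) =
       a *: (w^-1 * (x.2 - (x.1)%:A)).
      by rewrite /= mulr_algl -scalerA -scalerBr scalerAr.
    split; rewrite ?axE ?c0Z ?c1Z; first exact: int_ringM.
      by rewrite -[_%:Z]add0r; apply: val_geM.
    by rewrite -[_%:Z]add0r; apply: val_geM.
- move=> i im; split.
    by move=> x [ix h0 h1]; split=> //; [apply: val_geW h0|apply: val_geW h1]; lia.
  have Nsnd j l : N j (0, w * l) <-> val_ge v (d - j)%N%:Z (c0 l) /\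
      val_ge v (minn (d + n) (2 * d + n - j))%N%:Z (c1 l).
    by rewrite /N /= scale0r subr0 mulKf //; split=> [[]|[]] // h0 h1; split=> //; left.
  move=> h; have [id|di] := ltnP i d.
    have /h/Nsnd[] : N i.+1 (0, w * (pi ^+ (d - i.+1))%:A).
      apply/Nsnd; rewrite c0A c1A; split; last by left.
      by rewrite exprnP; apply: val_ge_unifz.
    rewrite c0A exprnP => /(val_geP _ _ (unifz_neq0 hpi _)).
    by rewrite (dval_unifz hpi); lia.
  have /h/Nsnd[_] : N i.+1 (0, w * (pi ^+ (2 * d + n - i.+1) *: t)).
    apply/Nsnd; rewrite c0Z c1Z c0t c1t mulr0 mulr1; split; first by left.
    by rewrite exprnP; apply: val_geW (val_ge_unifz hpi _); lia.
  rewrite c1Z c1t mulr1 exprnP => /(val_geP _ _ (unifz_neq0 hpi _)).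
  by rewrite (dval_unifz hpi); lia.
Qed.

(** * The tree of unit classes *)

Variable ds : seq F.
Hypothesis ds_int : forall d, d \in ds -> int_ring v d.
Hypothesis ds_onto : forall a, int_ring v a -> exists2 d, d \in ds & val_ge v 1 (a - d).
Hypothesis ds_inj : forall d e, d \in ds -> e \in ds -> val_ge v 1 (d - e) -> d = e.
Hypothesis ds_uniq : uniq ds.

(* Representatives of the units of [Ord j] modulo those of [Ord j.+1]. *)
Definition step_reps j : seq K :=
  (if j is 0 then [:: t] else [::]) ++ [seq 1 + (pi ^+ j * d) *: t | d <- ds].

(** At the root the classes form the projective line over the residue field, with [t] as the point
    at infinity; deeper down only an affine line remains. *)
Lemma size_step_reps j : size (step_reps j) = (size ds + (j == 0%N))%N.
Proof. by rewrite /step_reps size_cat size_map addnC; case: j. Qed.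

Lemma c0_step_rep j (d : F) : c0 (1 + (pi ^+ j * d) *: t) = 1.
Proof. by have := coords_uniq 1 (pi ^+ j * d); rewrite scale1r => ->. Qed.

Lemma c1_step_rep j (d : F) : c1 (1 + (pi ^+ j * d) *: t) = pi ^+ j * d.
Proof. by have := coords_uniq 1 (pi ^+ j * d); rewrite scale1r => ->. Qed.

Lemma step_reps_unit j r : r \in step_reps j -> U r /\ Ord j r.
Proof.
rewrite mem_cat => /orP[|/mapP[d hd ->]].
  case: j => [|j] //; rewrite inE => /eqP ->; split; first exact: t_unit.
  by apply/Ord0; case: t_unit.
have hr : Ord j (1 + (pi ^+ j * d) *: t).
  split; rewrite ?c0_step_rep ?c1_step_rep; first exact: int_ring1.
  rewrite exprnP; apply/(val_ge_shift hpi); rewrite subrr; exact: ds_int.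
split=> //; apply/(int_unit_coords (Ord_int hr)); rewrite c0_step_rep => -[+ _].
by move/(val_geP _ _ (oner_neq0 F)); rewrite dval1.
Qed.

Lemma int_scale_coords (i : int) x :
  O (pi ^ (- i) *: x) <-> val_ge v i (c0 x) /\ val_ge v i (c1 x).
Proof.
rewrite int_coordsP c0Z c1Z.
by split=> -[h0 h1]; split; move: h0 h1; rewrite /int_ring !(val_ge_shift hpi) sub0r opprK.
Qed.

(** Units modulo those of [Ord j] are points of the projective line over [o / pi ^ j]: their
    coordinates are compared up to a scalar. *)
Lemma Ord_divP j x y : U x -> U y -> Ord j (x / y) <->
  exists a, [/\ int_ring v a, val_ge v j%:Z (c0 x - a * c0 y) &
    val_ge v j%:Z (c1 x - a * c1 y)].
Proof.
move=> ux uy; split=> [/OrdP[a [z [ia oz E]]]|[a [ia h0 h1]]].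
  exists a; have : O (pi ^ (- j%:Z) *: (x - a *: y)).
    have -> : x - a *: y = pi ^+ j *: (z * y).
      have y0 : y != 0 by case: uy.
      by rewrite -[x in LHS](divfK y0) E mulrDl mulr_algl addrAC subrr add0r scalerAl.
    rewrite scalerA exprnP mulrC (unifzK hpi) scale1r.
    by apply: int_closureM => //; case: uy.
  by move/int_scale_coords; rewrite -scaleNr !c0D !c1D !c0Z !c1Z !mulNr => -[].
apply: (Ord_congr ia uy); apply/int_scale_coords.
by rewrite -scaleNr !c0D !c1D !c0Z !c1Z !mulNr.
Qed.

Lemma step_reps_onto j c : U c -> Ord j c -> exists2 r, r \in step_reps j & Ord j.+1 (c / r).
Proof.
move=> uc hc; have [h0 h1] := hc.
have [na|/(int_ringN1unit h0) [a0 va]] := pselect (val_ge v 1 (c0 c)).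
  case: j hc h0 h1 => [|j] hc h0 h1; last first.
    by have [a0 va] := Ord_unit_c0 uc hc; move/(val_geP _ _ a0): na; rewrite va.
  exists t; first by rewrite inE eqxx.
  apply/(Ord_divP _ uc t_unit); exists (c1 c).
  by rewrite c0t c1t mulr0 subr0 mulr1 subrr; split=> //; left.
have [_ iai] := int_ring_unit a0 va.
have [|d hd dP] := ds_onto (a := (c0 c)^-1 * (pi ^ (- j%:Z) * c1 c)).
  by apply: int_ringM => //; apply/(val_ge_shift hpi); rewrite sub0r opprK.
set r := 1 + (pi ^+ j * d) *: t.
have hr : r \in step_reps j by rewrite mem_cat; apply/orP; right; apply/mapP; exists d.
have [ur _] := step_reps_unit hr.
exists r => //; apply/(Ord_divP _ uc ur); exists (c0 c).
rewrite c0_step_rep c1_step_rep mulr1 subrr; split=> //; first by left.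
have -> : c1 c - c0 c * (pi ^+ j * d) =
    pi ^ j%:Z * (c0 c * ((c0 c)^-1 * (pi ^ (- j%:Z) * c1 c) - d)).
  by rewrite mulrBr mulVKf // [RHS]mulrBr [X in _ = X - _]mulrA (unifzK hpi) mul1r -exprnP mulrCA.
apply/(val_ge_shift hpi); have -> : j.+1%:Z - j%:Z = 0 + 1 by lia.
exact: val_geM.
Qed.

Lemma step_reps_inj j r r' : r \in step_reps j -> r' \in step_reps j -> Ord j.+1 (r / r') -> r = r'.
Proof.
move=> hr hr'; have [ur _] := step_reps_unit hr; have [ur' _] := step_reps_unit hr'.
have t_rep e : U (1 + (pi ^+ 0 * e) *: t) -> ~ Ord 1 (t / (1 + (pi ^+ 0 * e) *: t)).
  move=> ue /(Ord_divP _ t_unit ue)[a [ia]].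
  rewrite c0t c1t c0_step_rep c1_step_rep sub0r mulr1 => /val_geN; rewrite opprK => a1 h.
  apply: (@val_ge_pi_unit (c1 (1 + (pi ^+ 0 * e) *: t)) a) => //.
    by have [_ /int_coordsP[]] := ue.
  by rewrite c1_step_rep mulrC.
move: hr hr'; rewrite !mem_cat => /orP[hr|/mapP[d hd rE]] /orP[hr'|/mapP[e he rE']].
- by case: j hr hr' => // /[!inE] /eqP -> /eqP ->.
- case: j hr rE' => // /[!inE] /eqP -> rE'; rewrite rE' in ur' *.
  by move/(t_rep _ ur').
- case: j hr' rE => // /[!inE] /eqP -> rE; rewrite rE in ur *.
  move=> h; case: (t_rep _ ur); rewrite -invf_div; apply: OrdV => //.
  exact/int_unitM/int_unitV/t_unit.
rewrite rE rE' in ur ur' *; move/(Ord_divP _ ur ur')=> [a [ia]].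
rewrite !c0_step_rep !c1_step_rep mulr1 => h0 h1; congr (1 + (_ * _) *: t); apply: ds_inj => //.
have : val_ge v j.+1%:Z (pi ^ j%:Z * (d - e)).
  have -> : pi ^ j%:Z * (d - e) = (pi ^+ j * d - a * (pi ^+ j * e)) - (1 - a) * (pi ^+ j * e).
    by rewrite -exprnP; ring.
  apply: val_geB => //; rewrite -[j.+1%:Z]addr0; apply: val_geM => //.
  rewrite -[0]addr0; apply: val_geM; last exact: ds_int.
  by rewrite exprnP; apply: val_geW (val_ge_unifz hpi _).
by move/(val_ge_shift hpi); apply: val_geW; lia.
Qed.

Lemma step_reps_uniq j : uniq (step_reps j).
Proof.
rewrite cat_uniq; apply/and3P; split; first by case: j.
  apply/hasPn => r /mapP[d hd ->]; case: j => // /[!inE].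
  apply/eqP => E; have := c0_step_rep 0 d; rewrite E c0t => /esym/eqP.
  by rewrite oner_eq0.
rewrite map_inj_in_uniq // => d e hd he E.
apply: (@mulfI _ (pi ^+ j)); first by rewrite exprnP (unifz_neq0 hpi).
by rewrite -c1_step_rep E c1_step_rep.
Qed.

Lemma step_repsP j c : U c -> Ord j c ->
  exists2 r0, r0 \in step_reps j & forall r, r \in step_reps j -> `[< Ord j.+1 (c * r) >] = (r == r0).
Proof.
move=> uc hc; have [r0 h0 hr0] := step_reps_onto (int_unitV uc) (OrdV uc hc).
have [ur0 _] := step_reps_unit h0.
have uc0 : U (c^-1 / r0) by apply/int_unitM/int_unitV => //; apply: int_unitV.
exists r0 => // r hr; have [ur _] := step_reps_unit hr; apply/asboolP/eqP => [h|->].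
  apply: (step_reps_inj hr h0).
  have -> : r / r0 = (c^-1 / r0) * (c * r) by rewrite mulrACA mulVf ?mul1r 1?mulrC //; case: uc.
  exact: OrdM.
have -> : c * r0 = (c^-1 / r0)^-1 by rewrite invfM !invrK.
exact: OrdV.
Qed.

(** The vertices at depth [j], one factor for each edge of the path from the root. *)
Fixpoint unit_reps j : seq K :=
  if j is i.+1 then [seq u * r | u <- unit_reps i, r <- step_reps i] else [:: 1].

Lemma unit_reps_unit j u : u \in unit_reps j -> U u.
Proof.
elim: j u => [|j IH] u /=; first by rewrite inE => /eqP ->; apply: int_unit1.
by case/allpairsP => -[w r] /= [hw /step_reps_unit[hr _] ->]; apply: int_unitM => //; apply: IH.
Qed.

Lemma unit_reps_onto j c : U c -> exists2 u, u \in unit_reps j & Ord j (c / u).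
Proof.
move=> uc; elim: j => [|j [u hu cu]].
  exists 1; first by rewrite inE.
  by rewrite divr1; apply/Ord0; case: uc.
have uu := unit_reps_unit hu.
have [r hr hcr] := step_reps_onto (int_unitM uc (int_unitV uu)) cu.
exists (u * r); first by apply/allpairsP; exists (u, r).
by rewrite invfM mulrA.
Qed.

Lemma unit_reps_inj j u w : u \in unit_reps j -> w \in unit_reps j ->
  Ord j (u / w) -> u = w.
Proof.
elim: j u w => [|j IH] u w /=; first by rewrite !inE => /eqP -> /eqP ->.
case/allpairsP => -[u1 r] /= [hu hr ->] /allpairsP[[w1 s]] /= [hw hs ->] h.
have [[ur lr] [us ls]] := (step_reps_unit hr, step_reps_unit hs).
have [uu uw] := (unit_reps_unit hu, unit_reps_unit hw).
have E : (u1 * r) / (w1 * s) = (u1 / w1) * (r / s) by rewrite mulrACA -invfM.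
have uw1 : u1 = w1.
  apply: IH => //; have -> : u1 / w1 = (u1 * r) / (w1 * s) * (s / r).
    have [[r0 _ _] [s0 _ _]] := (ur, us).
    by rewrite E -mulrA [r / s * _]mulf_div [s * r]mulrC divff ?mulr1 ?mulf_neq0.
  apply: OrdM; first exact: OrdW h.
  exact: Ord_div.
rewrite uw1 in E h *; congr (_ * _); apply: (step_reps_inj hr hs).
by move: h; rewrite E divff ?mul1r //; case: uw.
Qed.

Lemma unit_reps_uniq j : uniq (unit_reps j).
Proof.
elim: j => //= j IH; rewrite allpairs_uniq ?step_reps_uniq //.
move=> [u r] [w s] /allpairsP[[u1 r1] /= [hu hr [-> ->]]].
move=> /allpairsP[[w1 s1] /= [hw hs [-> ->]]] E.
have [[ur lr] [us ls]] := (step_reps_unit hr, step_reps_unit hs).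
have [uu uw] := (unit_reps_unit hu, unit_reps_unit hw).
have uw1 : u1 = w1.
  apply: (unit_reps_inj hu hw).
  have -> : u1 / w1 = s1 / r1.
    apply/eqP; rewrite eqr_div ?E 1?mulrC //; [by case: uw|by case: ur].
  exact: Ord_div.
by rewrite uw1 in E *; rewrite (mulfI _ E) //; case: uw.
Qed.

(** * Weights along the two rays *)

Variables (n d : nat) (w : K).
Hypothesis uw : U w.
Let Q : rat := (size ds)%:R.
Let k := level n w.
Local Notation G := (branch Q).

Definition weight j u : int :=
  d%:Z + (level j u)%:Z + (level (minn j n) (u / w))%:Z - 2 * j%:Z.

(** A common vertex below the root, with all branches except one continuing child, yields [odd_count
    d + (Q - 1) * G (d - 2) = G d - G (d - 2)]. What the potential at depth [k], where the rays
    part, has beyond this is [core]. *)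
Let core : rat := 2 * G (d%:Z - 1) + G (d%:Z - 2) - G (d%:Z - (n - k)%:Z - 1).

Definition on_ray1 j u : bool := `[< Ord j u >].
Definition on_ray2 j u : bool := (j <= n)%N && `[< Ord j (u / w) >].

(* The sum of [odd_count (weight _ _)] over all descendants of the vertex [u] at
   depth [j]; rays 1 and 2 are the paths of [1] and of [w]. *)
Definition potential j u : rat :=
  let T := weight j u in
  match on_ray1 j u, on_ray2 j u with
  | true, true => (k - j + 1)%:R * (G d - G (d%:Z - 2)) + core
                  + (j == 0%N)%:R * G (d%:Z - 2)
  | true, false => G T + G (T - 1)
  | false, true => G T + G (T - 1) - G (T - (n - j)%:Z - 1)
  | false, false => G T
  end.

(** A factor from [Ord j] preserves levels up to [j], so each level grows by one exactly when the
    child stays on the corresponding ray. *)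
Lemma weightS j u r : U u -> r \in step_reps j ->
  weight j.+1 (u * r) =
    weight j u - 2 + (on_ray1 j.+1 (u * r))%:Z + (on_ray2 j.+1 (u * r))%:Z.
Proof.
move=> uu /step_reps_unit[ur hr].
have E1 : level j.+1 (u * r) = (level j u + on_ray1 j.+1 (u * r))%N.
  by rewrite levelS level_congr.
have E2 : level (minn j.+1 n) (u * r / w) =
    (level (minn j n) (u / w) + on_ray2 j.+1 (u * r))%N.
  rewrite /on_ray2; have [jn|nj] := ltnP j n; last first.
    rewrite (minn_idPr (leqW nj)) addn0 mulrAC (@level_congr n (u / w) r) //.
    exact: OrdW hr.
  by rewrite (minn_idPl jn) levelS mulrAC (@level_congr j (u / w) r).
rewrite /weight E1 E2; lia.
Qed.

Lemma weight_both j u : U u -> on_ray1 j u -> on_ray2 j u -> weight j u = d%:Z.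
Proof.
move=> uu h1 /andP[jn h2]; have uuw : U (u / w) by apply/int_unitM/int_unitV.
have /eqP e1 : level j u == j by rewrite level_full //; case: uu.
have /eqP e2 : level j (u / w) == j by rewrite level_full //; case: uuw.
by rewrite /weight (minn_idPl jn) e1 e2; lia.
Qed.

Lemma on_ray12 j u : U u -> (j <= n)%N -> on_ray1 j u -> on_ray2 j u = (j <= k)%N.
Proof.
move=> uu jn /asboolP hu; rewrite /on_ray2 jn /=.
have [_ ow _] := uw; apply/asboolP/idP => [h|/(levelP ow jn) h]; last exact: Ord_div.
apply/(levelP ow jn); have -> : w = u / (u / w).
  by rewrite invf_div mulrC divfK //; case: uu.
by apply: Ord_div => //; apply/int_unitM/int_unitV.
Qed.

Lemma child_ray1 j u : U u -> exists2 r0, r0 \in step_reps j &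
  forall r, r \in step_reps j -> on_ray1 j.+1 (u * r) = on_ray1 j u && (r == r0).
Proof.
move=> uu; have [/asboolP hu|/asboolPn hu] := boolP (on_ray1 j u).
  exact: (step_repsP uu hu).
have [r0 h0 _] := step_reps_onto int_unit1 (Ord1 j).
exists r0 => // r /step_reps_unit[ur hr]; apply/asboolP => h; apply: hu.
have -> : u = u * r / r by rewrite mulfK //; case: ur.
by apply: Ord_div => //; apply: OrdW h.
Qed.

Lemma child_ray2 j u : U u -> exists2 r0, r0 \in step_reps j &
  forall r, r \in step_reps j ->
    on_ray2 j.+1 (u * r) = [&& on_ray2 j u, (j < n)%N & r == r0].
Proof.
move=> uu; have uuw : U (u / w) by apply/int_unitM/int_unitV.
have [r1 h1 _] := step_reps_onto int_unit1 (Ord1 j).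
rewrite /on_ray2; have [jn|nj] := ltnP j n; last first.
  by exists r1 => // r hr; rewrite andbF.
rewrite (ltnW jn) /=.
have [/asboolP hu|/asboolPn hu] := boolP `[< Ord j (u / w) >].
  have [r0 h0 hr0] := step_repsP uuw hu; exists r0 => // r hr.
  by rewrite mulrAC hr0.
exists r1 => // r /step_reps_unit[ur hr]; apply/asboolP; rewrite mulrAC => h; apply: hu.
have -> : u / w = u / w * r / r by rewrite mulfK //; case: ur.
by apply: Ord_div => //; apply: OrdW h.
Qed.

Lemma sum_step_reps1 j (r0 : K) (A : rat) : r0 \in step_reps j ->
  \sum_(r <- step_reps j) (r == r0)%:R * A = A.
Proof.
move=> h0; rewrite (bigD1_seq r0) ?step_reps_uniq //= eqxx mul1r big1 ?addr0 //.
by move=> r /negPf ->; rewrite mul0r.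
Qed.

Lemma sum_step_reps_const j (A : rat) :
  \sum_(r <- step_reps j) A = (Q + (j == 0%N)%:R) * A.
Proof.
by rewrite big_const_seq count_predT size_step_reps iter_addr_0 -[LHS]mulr_natl natrD.
Qed.

Lemma sum_step_reps_eq j (f : K -> rat) (A B C : rat) r1 r2 :
  r1 \in step_reps j -> r2 \in step_reps j ->
  (forall r, r \in step_reps j -> f r = A + (r == r1)%:R * B + (r == r2)%:R * C) ->
  \sum_(r <- step_reps j) f r = (Q + (j == 0%N)%:R) * A + B + C.
Proof.
move=> h1 h2 hf; rewrite (eq_big_seq _ hf).
by rewrite !big_split /= !sum_step_reps1 // sum_step_reps_const.
Qed.

Lemma rays0 u : U u -> on_ray1 0 u /\ on_ray2 0 u.
Proof.
move=> uu; have [_ ouw _] : U (u / w) by apply/int_unitM/int_unitV.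
by split; apply/asboolP/Ord0 => //; case: uu.
Qed.

(** Off the rays this is [branchE]. On ray 1 alone, one of the [Q] children has weight [T - 1] and
    potential [G (T - 1) + G (T - 2)], whose second term completes [(Q - 1) * G (T - 2)]. On both
    rays the weight stays [d], and the extra child of the root explains the term with [j == 0]. *)
Lemma potentialS j u : U u ->
  potential j u = (odd_count (weight j u))%:R + \sum_(r <- step_reps j) potential j.+1 (u * r).
Proof.
move=> uu; have [r1 h1 c1] := child_ray1 j uu; have [r2 h2 c2] := child_ray2 j uu.
have T0 := branchE Q (weight j u).
have wS r (hr : r \in step_reps j) := weightS uu hr.
have kn : (k <= n)%N by apply: level_le.
case e1 : (on_ray1 j u) (c1) => {}c1; case e2 : (on_ray2 j u) (c2) => {}c2; last 3 first.
- have j0 : (j == 0%N) = false.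
    by apply/eqP => j0; move: e2; rewrite j0 (rays0 uu).2.
  rewrite (@sum_step_reps_eq j _ (G (weight j u - 2)) (G (weight j u - 1)) 0 r1 r1) //.
    by rewrite /potential e1 e2 j0 T0 /=; ring.
  move=> r hr; have := wS r hr; rewrite /potential c1 // c2 //=.
  case: eqP => _ -> /=.
    have -> : weight j u - 2 + 1 + 0 = weight j u - 1 by lia.
    have -> : weight j u - 1 - 1 = weight j u - 2 by lia.
    by rewrite mul1r mulr0 addr0 addrC.
  by rewrite !addr0 !mul0r !addr0.
- have j0 : (j == 0%N) = false.
    by apply/eqP => j0; move: e1; rewrite j0 (rays0 uu).1.
  have jn : (j <= n)%N by case/andP: e2.
  (* At depth [n] ray 2 ends and the subtracted term cancels [G (T - 1)]. *)
  have [ltjn|nj] := ltnP j n; last first.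
    have {jn nj} jn : j = n by apply/eqP; rewrite eqn_leq jn.
    rewrite (@sum_step_reps_eq j _ (G (weight j u - 2)) 0 0 r1 r1) //.
      rewrite /potential e1 e2 j0 -jn subnn T0 subr0 /=; ring.
    move=> r hr; have := wS r hr; rewrite /potential c1 // c2 //= -jn ltnn /=.
    by move=> ->; rewrite !mulr0 !addr0.
  rewrite (@sum_step_reps_eq j _ (G (weight j u - 2)) 0
     (G (weight j u - 1) - G (weight j u - (n - j)%:Z - 1)) r1 r2) //.
    by rewrite /potential e1 e2 j0 T0 /=; ring.
  move=> r hr; have := wS r hr; rewrite /potential c1 // c2 //= ltjn /=.
  case: eqP => _ -> /=.
    have -> : weight j u - 2 + 0 + 1 = weight j u - 1 by lia.
    have -> : weight j u - 1 - 1 = weight j u - 2 by lia.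
    have -> : weight j u - 1 - (n - j.+1)%:Z - 1 = weight j u - (n - j)%:Z - 1 by lia.
    by ring.
  by rewrite !addr0 !mul0r !mulr0 !addr0.
- have j0 : (j == 0%N) = false.
    by apply/eqP => j0; move: e2; rewrite j0 (rays0 uu).2.
  rewrite (@sum_step_reps_eq j _ (G (weight j u - 2)) 0 0 r1 r1) //.
    by rewrite /potential e1 e2 j0 T0 !addr0.
  move=> r hr; have := wS r hr; rewrite /potential c1 // c2 //=.
  by move=> ->; rewrite !mulr0 !addr0.
have Td := weight_both uu e1 e2; rewrite Td in T0 wS *.
have jn : (j <= n)%N by case/andP: e2.
have jk : (j <= k)%N by rewrite -(on_ray12 uu jn e1).
have uur r : r \in step_reps j -> U (u * r) by case/step_reps_unit => ur _; apply: int_unitM.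
(* Above depth [k] both rays pass to the same child. *)
have [ltjk|kj] := ltnP j k.
  have ltjn : (j < n)%N by apply: leq_trans kn.
  have r12 : r2 = r1.
    have h : on_ray1 j.+1 (u * r1) by rewrite c1 // eqxx.
    by have := on_ray12 (uur _ h1) ltjn h; rewrite c2 // ltjk ltjn => /= /eqP.
  rewrite (@sum_step_reps_eq j _ (G (d%:Z - 2))
    ((k - j)%:R * (G d - G (d%:Z - 2)) + core - G (d%:Z - 2)) 0 r1 r1) //.
    rewrite /potential e1 e2 natrD; move: (core) => c; rewrite T0; ring.
  move=> r hr; have := wS r hr; rewrite /potential c1 // c2 //= ltjn r12 /=.
  case: eqP => _ hw /=; last by rewrite hw !addr0 !mul0r !addr0.
  have -> : (k - j.+1 + 1)%N = (k - j)%N by lia.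
  by ring.
have {kj jk} jk : j = k by apply/eqP; rewrite eqn_leq jk.
(* At depth [k] either ray 2 ends, when [k = n], or the two rays pass to different children. *)
have [ltjn|nj] := ltnP j n; last first.
  have {jn nj} jn : j = n by apply/eqP; rewrite eqn_leq jn.
  rewrite (@sum_step_reps_eq j _ (G (d%:Z - 2)) (G (d%:Z - 1)) 0 r1 r1) //.
    by rewrite /potential e1 e2 /core -jk -jn subnn subr0 T0; ring.
  move=> r hr; have := wS r hr; rewrite /potential c1 // c2 //= -jn ltnn /=.
  case: eqP => _ -> /=; last by rewrite !addr0 !mul0r !addr0.
  have -> : d%:Z - 2 + 1 + 0 = d%:Z - 1 by lia.
  have -> : d%:Z - 1 - 1 = d%:Z - 2 by lia.
  by ring.
have r12 : r2 == r1 = false.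
  apply/negP => /eqP r12.
  have h : on_ray1 j.+1 (u * r1) by rewrite c1 // eqxx.
  have := on_ray12 (uur _ h1) ltjn h.
  by rewrite c2 // ltjn r12 eqxx jk ltnn.
rewrite (@sum_step_reps_eq j _ (G (d%:Z - 2)) (G (d%:Z - 1))
  (G (d%:Z - 1) - G (d%:Z - (n - k)%:Z - 1)) r1 r2) //.
  by rewrite /potential e1 e2 /core -jk subnn T0; ring.
move=> r hr; have := wS r hr; rewrite /potential c1 // c2 //= ltjn /=.
have [->|_] := eqVneq r r1; last first.
  case: eqP => _ -> /=; last by rewrite !addr0 !mul0r !addr0.
  have -> : d%:Z - 2 + 0 + 1 = d%:Z - 1 by lia.
  have -> : d%:Z - 1 - 1 = d%:Z - 2 by lia.
  have -> : d%:Z - 1 - (n - j.+1)%:Z - 1 = d%:Z - (n - k)%:Z - 1 by lia.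
  by ring.
rewrite [r1 == r2]eq_sym r12 /= => ->.
have -> : d%:Z - 2 + 1 + 0 = d%:Z - 1 by lia.
have -> : d%:Z - 1 - 1 = d%:Z - 2 by lia.
by ring.
Qed.

Lemma potential0 : potential 0 1 = (k + 1)%:R * (G d - G (d%:Z - 2)) +
  2 * G (d%:Z - 1) + 2 * G (d%:Z - 2) - G (d%:Z - (n - k)%:Z - 1).
Proof.
have [h1 h2] := rays0 int_unit1.
by rewrite /potential h1 h2 eqxx subn0 /core /=; ring.
Qed.

Lemma weight_le j u : weight j u <= d%:Z + n%:Z - j%:Z.
Proof.
have := level_le j u; have := level_le (minn j n) (u / w); rewrite /weight; lia.
Qed.

Lemma potential_far j u : (d + n < j)%N -> potential j u = 0.
Proof.
move=> h; have hw := weight_le j u.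
have r2 : on_ray2 j u = false.
  by rewrite /on_ray2; have -> : (j <= n)%N = false by lia.
rewrite /potential r2; case: (on_ray1 j u); last by rewrite branch_neg //; lia.
by rewrite !branch_neg ?addr0 //; lia.
Qed.

(** [potentialS] telescopes layer by layer, and below depth [d + n] all weights are negative, so no
    potential remains. *)
Lemma sum_odd_count : (\sum_(j < (d + n).+1) \sum_(u <- unit_reps j)
    (odd_count (weight j u))%:R : rat) =
  (k + 1)%:R * (G d - G (d%:Z - 2)) +
  2 * G (d%:Z - 1) + 2 * G (d%:Z - 2) - G (d%:Z - (n - k)%:Z - 1).
Proof.
rewrite -potential0.
have key J : \sum_(j < J) \sum_(u <- unit_reps j) (odd_count (weight j u))%:R =
    potential 0 1 - \sum_(u <- unit_reps J) potential J u.
  elim: J => [|J IH]; first by rewrite big_ord0 /= big_seq1 subrr.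
  rewrite big_ord_recr /= IH big_allpairs_dep /=.
  have -> : \sum_(u <- unit_reps J) potential J u =
      \sum_(u <- unit_reps J) (odd_count (weight J u))%:R +
      \sum_(u <- unit_reps J) \sum_(r <- step_reps J) potential J.+1 (u * r).
    rewrite -big_split; apply: eq_big_seq => u /unit_reps_unit; exact: potentialS.
  by rewrite opprD -!addrA [- _ + (- _ + _)]addrCA addNr addr0 addrC.
rewrite key big1_seq ?subr0 // => u _; exact: potential_far.
Qed.

(** * Enumeration of the ideal classes *)

Local Notation vertex := (nat * (K * nat))%type.

Definition index_list : seq vertex :=
  [seq (j, e) | j <- iota 0 (d + n).+1,
     e <- [seq (u, c) | u <- unit_reps j, c <- iota 0 (odd_count (weight j u))]].

(* The order [Ord (index_m x)] and the lattice [index_lat x]: the first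
   [weight + 1] values of the counter are the lattices whose multiplier ring is
   [Ord (index_m x)] itself, the others those with a larger multiplier ring. *)
Definition index_m (x : vertex) : nat :=
  (x.1 + (x.2.2 - `|weight x.1 x.2.1|))%N.
Definition index_i (x : vertex) : int :=
  x.1%:Z - (level x.1 x.2.1)%:Z
  + (if (x.2.2 <= `|weight x.1 x.2.1|)%N then x.2.2 else 0%N)%:Z.
Definition index_lat (x : vertex) : set K := lat (pi ^ index_i x *: x.2.1)^-1 x.1.

Lemma index_listP j u c : (j, (u, c)) \in index_list <->
  [/\ (j <= d + n)%N, u \in unit_reps j, 0 <= weight j u &
    (c <= 2 * `|weight j u|)%N].
Proof.
rewrite /index_list; split=> [/allpairsPdep[j' [_ [hj /allpairsPdep[u' [c' [hu hc ->]]] [-> -> ->]]]]|].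
  by move: hc hj; rewrite !mem_iota /odd_count; case: ifP.
move=> [hj hu T0 hc]; apply/allpairsPdep; exists j, (u, c); split=> //.
  by rewrite mem_iota.
apply/allpairsPdep; exists u, c; split=> //.
by rewrite mem_iota /odd_count T0.
Qed.

Lemma size_index_list : size index_list =
  (\sum_(j < (d + n).+1) \sum_(u <- unit_reps j) odd_count (weight j u))%N.
Proof.
rewrite size_allpairs_dep sumnE big_map -(big_mkord xpredT
  (fun j => \sum_(u <- unit_reps j) odd_count (weight j u))%N) /index_iota subn0.
apply: eq_bigr => j _; rewrite size_allpairs_dep sumnE big_map.
by apply: eq_bigr => u _; rewrite size_iota.
Qed.

Lemma index_list_uniq : uniq index_list.
Proof.
apply: allpairs_uniq_dep; first exact: iota_uniq.
  move=> j _; apply: allpairs_uniq_dep; first exact: unit_reps_uniq.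
    by move=> u _; apply: iota_uniq.
  by move=> [u c] [u' c'] _ _ [-> ->].
by move=> [j p] [j' p'] _ _ [-> ->].
Qed.

Lemma scaled_unit_neq0 (i : int) u : U u -> pi ^ i *: u != 0.
Proof. by move=> [u0 _ _]; rewrite scaler_eq0 negb_or (unifz_neq0 hpi). Qed.

Lemma cyclic_type_scaled_unit m (i : int) u j : U u ->
  cyclic_type m (pi ^ i *: u)^-1 j <-> [/\ (j <= m)%N, j%:Z <= i + (level j u)%:Z &
    (j < m)%N -> i + (level j u)%:Z <= j%:Z].
Proof.
move=> uu; rewrite /cyclic_type invrK scalerA -(unifzD hpi).
have h1 := Ord_shift j i uu; have h2 := Ord_shift j (-1 + i) uu.
split=> -[jm hj hn]; split=> //; [exact/h1| |exact/h1|] => lt.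
  have := hn lt; rewrite h2; lia.
by rewrite h2; have := hn lt; lia.
Qed.

(** The lattice determines [j] through its multiplier ring, [i] as a valuation and [u] modulo the
    units of [Ord j]; the counter is read off from [m] and [i]. *)
Lemma index_lat_inj x y : x \in index_list -> y \in index_list ->
  index_m x = index_m y -> index_lat x = index_lat y -> x = y.
Proof.
case: x y => [j [u c]] [j' [u' c']] /index_listP[hj hu T0 hc].
move=> /index_listP[hj' hu' T0' hc'] hm.
have [uu uu'] := (unit_reps_unit hu, unit_reps_unit hu').
have n0 (i : int) : (pi ^ i *: u)^-1 != 0 by rewrite invr_eq0 scaled_unit_neq0.
have n0' (i : int) : (pi ^ i *: u')^-1 != 0 by rewrite invr_eq0 scaled_unit_neq0.
move=> hl; have [jj] := (lat_eqP j j' (n0 (index_i (j, (u, c))))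
  (n0' (index_i (j', (u', c'))))).1 hl; subst j'.
set i := index_i (j, (u, c)); set i' := index_i (j, (u', c')); rewrite invrK => ub hb.
have qE : (pi ^ i' *: u')^-1 * (pi ^ i *: u) = pi ^ (i - i') *: (u / u').
  rewrite scaler_inv -scalerAl -scalerAr scalerA invr_expz -(unifzD hpi) addrC.
  by rewrite [u'^-1 * u]mulrC.
have uuu : U (u / u') by apply/int_unitM/int_unitV.
have ii : i = i'.
  have [_ h1 h2] := ub; move: h1 h2; rewrite int_div //.
  rewrite qE scaler_inv invr_expz (int_unifz _ (int_unitV uuu)).
  by lia.
move: hb; rewrite qE ii subrr expr0z scale1r => hb.
have uE := unit_reps_inj hu hu' hb; subst u'.
move: hm ii; rewrite /i /i' /index_i /index_m /= => hm ii.
suff -> : c = c' by [].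
move: hm ii; move: (`|weight j u|)%N (level j u) => T k0.
by case: (leqP c T); case: (leqP c' T); lia.
Qed.

Lemma compatible_scaled_unit m s j u (i : int) : U u -> (j <= m)%N ->
  cspan m s = lat (pi ^ i *: u)^-1 j ->
  compatible (pi ^+ d *: w) n m s <->
  m%:Z + i <= d%:Z + (level (minn j n) (u / w))%:Z.
Proof.
move=> uu jm E; rewrite -(lat_colon n d%:Z i uw uu jm) -E.
by split=> h x y; apply: h.
Qed.

Lemma index_cspan x : x \in index_list -> exists s,
  cspan (index_m x) s = index_lat x /\ compatible (pi ^+ d *: w) n (index_m x) s.
Proof.
case: x => j [u c] /index_listP[hj hu T0 hc]; have uu := unit_reps_unit hu.
have nz : (pi ^ index_i (j, (u, c)) *: u)^-1 != 0.
  by rewrite invr_eq0 scaled_unit_neq0.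
have [|s sE] := @cyclic_type_cspan (index_m (j, (u, c))) _ j nz.
  apply/(cyclic_type_scaled_unit _ _ _ uu); rewrite /index_i /index_m /=.
  move: (`|weight j u|)%N (level j u) => T k0.
  by case: (leqP c T) => h; split; lia.
exists s; split=> //; apply/(compatible_scaled_unit uu _ sE).
  by rewrite /index_m /=; lia.
move: T0 hc; rewrite /index_i /index_m /=; move: (level_le j u) => kj.
have := erefl (weight j u); rewrite {2}/weight; move: (weight j u) => T.
by case: (leqP c `|T|%N); lia.
Qed.

Lemma cspan_index m s : compatible (pi ^+ d *: w) n m s ->
  exists2 x, x \in index_list & index_m x = m /\ index_lat x = cspan m s.
Proof.
move=> hc; have [z [j [z0 jm E]]] := cspan_lat m s.
have [i [u0 [uu0 zE]]] := int_unit_decomp hpi ram (invr_neq0 z0).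
have [u hu hu0] := unit_reps_onto j uu0; have uu := unit_reps_unit hu.
have latE : lat z j = lat (pi ^ i *: u)^-1 j.
  apply/(lat_eqP _ _ z0); first by rewrite invr_eq0 scaled_unit_neq0.
  have -> : (pi ^ i *: u)^-1 / z = u0 / u.
    rewrite zE scaler_inv -scalerAl -scalerAr scalerA invr_expz mulrC.
    by rewrite (unifzK hpi) scale1r mulrC.
  by split=> //; apply/int_unitM/int_unitV.
rewrite latE in E.
have n0 : (pi ^ i *: u)^-1 != 0 by rewrite invr_eq0 scaled_unit_neq0.
have /(cyclic_type_scaled_unit _ _ _ uu)[_ ij im] := cspan_cyclic_type n0 jm E.
move/(compatible_scaled_unit uu jm E): hc => hc.
have kj := level_le j u; have kn := level_le (minn j n) (u / w).
have [T wE] : exists T, weight j u = T by exists (weight j u).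
have TE : T = d%:Z + (level j u)%:Z + (level (minn j n) (u / w))%:Z - 2 * j%:Z by rewrite -wE.
(* The lower bound [j - level u] on [i] and the upper bound from stability, with [j <= m], are
   consistent only for [T >= 0]; as [T <= d + n - j], the depth is bounded too. *)
have T0 : 0 <= T by lia.
have jdn : (j <= d + n)%N by lia.
(* For [j < m] the exponent [i] is forced and the counter, beyond [T], records [m]; for [j = m] it
   records the excess of [i] over its minimum. *)
pose c := if (j < m)%N then (m - j + `|T|)%N else `|(i + (level j u)%:Z - j%:Z)%R|%N.
have hx : (j, (u, c)) \in index_list.
  apply/index_listP; rewrite wE; split=> //.
  by rewrite /c; case: ltnP; lia.
exists (j, (u, c)) => //.
have mE : index_m (j, (u, c)) = m.
  by rewrite /index_m /= wE /c; case: ltnP => h; lia.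
have iE : index_i (j, (u, c)) = i.
  by rewrite /index_i /= wE /c; case: (ltnP j m) => h; case: leqP => h'; lia.
by split=> //; rewrite /index_lat iE E.
Qed.

Lemma card_ideal_class_monoid (R : set E) :
  (forall x : E, R x <->
     int_ring v x.1 /\ lat (pi ^+ d *: w) n (x.2 - (x.1)%:A)) ->
  (forall x y, R x -> R y -> R (x * y)) -> R `<=` @max_order F v K ->
  (ideal_class_monoid R #= `I_(size index_list))%card.
Proof.
move=> RE RM R_max.
pose repr x := xget 0 [set s | cspan (index_m x) s = index_lat x /\
  compatible (pi ^+ d *: w) n (index_m x) s].
have reprP x : x \in index_list -> cspan (index_m x) (repr x) = index_lat x /\
    compatible (pi ^+ d *: w) n (index_m x) (repr x).
  by move=> /index_cspan; apply: xgetPex.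
pose cls x := ideal_class (std_ideal (index_m x) (repr x)).
have z0 : pi ^+ d *: w != 0 by rewrite exprnP scaled_unit_neq0.
have -> : ideal_class_monoid R = [set` [seq cls x | x <- index_list]].
  apply/seteqP; split=> C.
    move=> [I hI <-].
    have [m [s [hc ->]]] := frac_ideal_std z0 RE RM R_max hI.
    have [x hx [mE lE]] := cspan_index hc.
    apply/mapP; exists x => //; apply/ideal_class_std_eqP.
    by split; [rewrite mE|rewrite (reprP x hx).1 lE].
  case/mapP => x hx ->; exists (std_ideal (index_m x) (repr x)) => //.
  exact: (std_ideal_frac z0 RE (reprP x hx).2).
rewrite -(size_map cls); apply: card_set_seq.
rewrite map_inj_in_uniq ?index_list_uniq // => x y hx hy.
move/ideal_class_std_eqP => [mE gE]; apply: index_lat_inj => //.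
by rewrite -(reprP x hx).1 -(reprP y hy).1.
Qed.

End QuadraticOrders.

Theorem theorem5p2 (F : fieldType) (v : discrete_valuation F)
    (hF : nonarch_local_field v)
    (q : nat) (hq : (residue_field v #= `I_q)%card)
    (pi : F) (hpi : uniformizer v pi)
    (E' : fieldExtType F) (hdim : \dim {:E'} = 2%N) (hE' : unramified v E')
    (R : set (F * E')%type) (hR : is_order v R)
    (f1 f2 : nat)
    (hcond : conductor v R =
       [set pi ^+ f1 * x | x in int_ring v] `*`
       [set (pi ^+ f2)%:A * y | y in int_closure v E'])
    (S : nat) (hS : order_length v R S) :
  exists2 n : nat, (ideal_class_monoid R #= `I_n)%card &
  let Q : rat := q%:R in
  let s : int := S%:Z in
  let g1 : int := f1%:Z in
  let g2 : int := f2%:Z in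
  n%:R =
    2 * (\sum_(b \in [set b : int | 0 <= b <= s - g1])
      (\sum_(a \in [set a : int | [/\ 0 <= a <= g1, a <= 2 * b & a <= s - g2]])
          Q ^ Num.min (a %/ 2)%Z (s - g1 - b)
       + \sum_(a \in [set a : int | [/\ s - g2 < a <= g1, a <= 2 * b
                        & - ((- a) %/ 2)%Z - b <= g1 - g2]])
          Q ^ (s - g1 - b)))
    - (s - g1 + 1)%:~R
    - \sum_(a \in [set a : int | [/\ 0 < a <= g1, a <= s - g2 & (2 %| a)%Z]])
        Q ^ Num.min (a %/ 2)%Z (s - g1 - (a %/ 2)%Z)
    - \sum_(a \in [set a : int | [/\ s - g2 < a <= g1, (2 %| a)%Z
                      & s - g1 <= s - g2]])
        Q ^ (s - g1 - (a %/ 2)%Z)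
    - \sum_(b \in [set b : int | 0 < b <= s - g1])
      \sum_(a \in [set a : int | [/\ 0 < a <= g1, a < 2 * b, (2 %| a)%Z,
                      a <= s - g2 & (a %/ 2)%Z <= s - g1 - b]])
        (Q ^ (a %/ 2)%Z - Q ^ ((a %/ 2)%Z - 1))
    - \sum_(a \in [set a : int | [/\ s - g2 < a <= g1, (2 %| a)%Z
                      & s - g2 < s - g1]])
        Q ^ (s - g2 - (a %/ 2)%Z).
Proof.
have [ram _] := hE'.
have [t hB] := int_basis_exists hpi hF hdim.
have [ds [dsq ds_uniq ds_int ds_onto ds_inj]] := residue_digits hq.
have [d [n [w [uw R_max RE [f2E f1E] hk]]]] := order_structure hpi hB ram hR hcond.
have SE := order_length_eq hpi hB uw RE hS.
have kn := level_le v t n w; set k := level v t n w in f1E hk kn.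
have [[_ _ RM] _ _ _] := hR.
exists (size (index_list v pi t ds n d w)).
  apply: (card_ideal_class_monoid hpi hB ram ds_int ds_onto ds_inj ds_uniq uw RE) => //.
  by move=> x y Rx Ry; apply/set_mem/RM; apply: mem_set.
move=> Q s g1 g2; rewrite size_index_list natr_sum.
under eq_bigr do rewrite natr_sum.
rewrite (sum_odd_count hpi hB ram ds_int ds_onto ds_inj ds_uniq n d uw) -/k dsq -/Q.
have rd : (n - k <= d)%N by lia.
by rewrite -(@formula_eval Q d (n - k) k rd s g1 g2) // /s /g1 /g2; congr Posz; lia.
Qed.
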